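(* Let $\Omega\subset\mathbb C^m$ be a Reinhardt domain with $0\in\Omega$. Let $\mathscr H$ be a reproducing kernel Hilbert space of functions on $\Omega$ which is invariant under multiplication by each coordinate function $z_1,\dots,z_m$, such that $\mathscr H\subset\mathrm{Hol}(\Omega)$ with continuous inclusion, and let $\kappa(z,w)$ $(z,w\in\Omega)$ be its reproducing kernel. Then the following are equivalent: (1) for every $\zeta\in\mathbb T^m$, $\kappa(\zeta\cdot z,\zeta\cdot w)=\kappa(z,w)$ for all $z,w\in\Omega$, where $\zeta\cdot z=(\zeta_1z_1,\dots,\zeta_mz_m)$; (2) for every $\zeta\in\mathbb T^m$, $f(\zeta\,\cdot)\in\mathscr H$ whenever $f\in\mathscr H$, and $\langle f(\zeta\,\cdot),g(\zeta\,\cdot)\rangle=\langle f,g\rangle$ for all $f,g\in\mathscr H$; (3) there exist a multi-sequence $\{\beta_n\}_{n\in\mathbb N^m}$ of positive numbers and an inductive set $\Lambda\subset\mathbb N^m$ such that $\mathscr H=H^2(\beta)_\Lambda$; (4) there exists an inductive set $\Lambda'\subset\mathbb N^m$ such that the functions $z^n$, $n\in\Lambda'$, belong to $\mathscr H$ and form an orthogonal basis of $\mathscr H$; (5) there exist an inductive set $\Lambda''\subset\mathbb N^m$ and positive numbers $\{\alpha_n\}_{n\in\Lambda''}$ such that $\kappa(z,w)=\sum_{n\in\Lambda''}\alpha_nz^n\overline w^n$ for $z,w\in\Omega$. Moreover, if (1)–(5) hold, then $\Lambda=\Lambda'=\Lambda''$.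
   Context: $\mathbb N=\{0,1,2,\dots\}$, $\mathbb T$ is the unit circle. A set $\Lambda\subset\mathbb N^m$ is inductive if $n\in\Lambda$ implies $n+\epsilon_j\in\Lambda$ for $j=1,\dots,m$, where $\epsilon_j$ is the $j$-th unit multi-index. For a positive multi-sequence $\beta$, $H^2(\beta)$ is the Hilbert space of formal power series $f=\sum a_nz^n$ with $\|f\|^2=\sum|a_n|^2\beta_n^2<\infty$, and $H^2(\beta)_\Lambda=\{f\in H^2(\beta): D^nf(0)=0 \text{ for all } n\in\mathbb N^m\setminus\Lambda\}$ (i.e. the coefficients $a_n$ vanish for $n\notin\Lambda$). The equality $\mathscr H=H^2(\beta)_\Lambda$ means that, identifying analytic functions on $\Omega$ with their Taylor series at the origin, the two spaces consist of the same functions and have identical norms. *)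

(* Defs.v *)
(* Scalars: C := R[i] (complex numbers
   over an arbitrary realType R, from mathcomp-real-closed), points of C^m are
   row vectors 'rV[C]_m (normed space over C, sup norm). *)
From HB Require Import structures.
From mathcomp Require Import all_boot all_order all_algebra.
From mathcomp Require Import complex.
From mathcomp Require Import finmap.
From mathcomp Require Import all_classical all_reals all_analysis.
Import Order.TTheory GRing.Theory Num.Theory.
Import numFieldNormedType.Exports.

Set Implicit Arguments.
Unset Strict Implicit.
Unset Printing Implicit Defensive.

Local Open Scope classical_set_scope.
Local Open Scope ring_scope.

(* the complex field *)
Definition CC (R : realType) : numFieldType := (R[i] : numFieldType).
(* points of C^m *)
Definition pt (R : realType) (m : nat) := 'rV[CC R]_m.
(* complex valued functions on C^m (functions on Omega are extended by 0) *)
Definition fn (R : realType) (m : nat) := pt R m -> CC R.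
(* multi-indices in N^m *)
Definition mi (m : nat) := {ffun 'I_m -> nat}.

Section Defs.
Variables (R : realType) (m : nat).
Local Notation C := (CC R).
Local Notation pt := (pt R m).
Local Notation fn := (fn R m).
Local Notation mi := (mi m).

(* n + eps_j *)
Definition mi_addeps (n : mi) (j : 'I_m) : mi := [ffun i => (n i + (i == j))%N].

(* inductive sets of multi-indices *)
Definition inductive (L : set mi) : Prop :=
  forall n, L n -> forall j : 'I_m, L (mi_addeps n j).

(* z^n *)
Definition monom (z : pt) (n : mi) : C := \prod_(j < m) (z 0 j) ^+ (n j).

(* zeta . z *)
Definition tmul (zeta z : pt) : pt := \row_j (zeta 0 j * z 0 j).

(* zeta in T^m *)
Definition torus (zeta : pt) : Prop := forall j, `|zeta 0 j| = 1.

(* Reinhardt domain: open, connected, nonempty, invariant under T^m *)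
Definition reinhardt_domain (Om : set pt) : Prop :=
  [/\ open Om, connected Om, Om !=set0 &
      forall zeta z, torus zeta -> Om z -> Om (tmul zeta z)].

(* restriction to Om of a function on C^m (extended by 0 outside Om) *)
Definition restr (Om : set pt) (g : fn) : fn :=
  fun z => if `[< Om z >] then g z else 0.

(* H is a Hilbert space of functions on Om (elements are extended by zero
   outside Om) with inner product ip (linear in the first variable). *)
Definition hilbert_fun_space (Om : set pt) (H : set fn) (ip : fn -> fn -> C)
  : Prop :=
  [/\ (forall f, H f -> forall z, ~ Om z -> f z = 0),
      (* linear subspace *)
      [/\ H (fun _ => 0),
          (forall f g, H f -> H g -> H (fun z => f z + g z)) &
          (forall (a : C) f, H f -> H (fun z => a * f z))],
      (* inner product *)
      [/\ (forall f g h, H f -> H g -> H h ->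
             ip (fun z => f z + g z) h = ip f h + ip g h),
          (forall (a : C) f g, H f -> H g ->
             ip (fun z => a * f z) g = a * ip f g),
          (forall f g, H f -> H g -> ip g f = (ip f g)^*),
          (forall f, H f -> 0 <= ip f f) &
          (forall f, H f -> ip f f = 0 -> f = (fun _ => 0))] &
      (* completeness (norms squared: ||f||^2 = ip f f) *)
      (forall u : nat -> fn, (forall k, H (u k)) ->
        (forall e : C, 0 < e -> exists N, forall k l, (N <= k)%N -> (N <= l)%N ->
           ip (fun z => u k z - u l z) (fun z => u k z - u l z) < e) ->
        exists2 f, H f &
          forall e : C, 0 < e -> exists N, forall k, (N <= k)%N ->
           ip (fun z => u k z - f z) (fun z => u k z - f z) < e)].

(* kappa is the reproducing kernel of H: for w in Om, kappa(.,w) (on Om)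
   belongs to H and f(w) = <f, kappa(.,w)>. *)
Definition reproducing_kernel (Om : set pt) (H : set fn) (ip : fn -> fn -> C)
  (kappa : pt -> pt -> C) : Prop :=
  forall w, Om w -> H (restr Om (fun z => kappa z w)) /\
    forall f, H f -> f w = ip f (restr Om (fun z => kappa z w)).

(* H is contained in Hol(Om) with continuous inclusion: elements are
   holomorphic (C-Frechet differentiable) on Om, and every seminorm
   sup_K |f| (K compact in Om) is bounded by a multiple of ||f||. *)
Definition hol_cont_incl (Om : set pt) (H : set fn) (ip : fn -> fn -> C)
  : Prop :=
  (forall f, H f -> forall z, Om z -> differentiable f z) /\
  (forall K : set pt, compact K -> K `<=` Om ->
     exists c : C, forall f, H f -> forall z, K z -> `|f z| ^+ 2 <= c * ip f f).

(* H is invariant under multiplication by each coordinate function *)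
Definition coord_invariant (H : set fn) : Prop :=
  forall (j : 'I_m) f, H f -> H (fun z => z 0 j * f z).

(* complex partial derivative d/dz_j *)
Definition pderiv (j : 'I_m) (f : fn) : fn :=
  fun z => 'D_(delta_mx 0 j : pt) f z.

(* D^n f = d_1^{n_1} ... d_m^{n_m} f *)
Definition Dn (n : mi) (f : fn) : fn :=
  foldr (fun j g => iter (n j) (pderiv j) g) f (enum 'I_m).

(* n-th Taylor coefficient at the origin: D^n f(0) / n! *)
Definition taylor_coef (f : fn) (n : mi) : C :=
  Dn n f 0 / (\prod_(j < m) (n j)`!)%:R.

(* unordered (net of finite subsets) summation over D *)
Definition has_usum (D : set mi) (a : mi -> C) (s : C) : Prop :=
  forall e : C, 0 < e -> exists F0 : {fset mi}, [set` F0] `<=` D /\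
    forall F : {fset mi}, [set` F0] `<=` [set` F] -> [set` F] `<=` D ->
      `|\sum_(i <- F) a i - s| < e.

(* Condition (1) *)
Definition cond1 (Om : set pt) (kappa : pt -> pt -> C) : Prop :=
  forall zeta, torus zeta -> forall z w, Om z -> Om w ->
    kappa (tmul zeta z) (tmul zeta w) = kappa z w.

(* Condition (2) *)
Definition cond2 (H : set fn) (ip : fn -> fn -> C) : Prop :=
  forall zeta, torus zeta ->
    (forall f, H f -> H (fun z => f (tmul zeta z))) /\
    (forall f g, H f -> H g ->
       ip (fun z => f (tmul zeta z)) (fun z => g (tmul zeta z)) = ip f g).

(* H = H^2(beta)_Lambda, identifying functions with their Taylor series *)
Definition cond3 (H : set fn) (ip : fn -> fn -> C) (beta : mi -> R)
  (L : set mi) : Prop :=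
  [/\ (forall n, 0 < beta n), inductive L,
      (forall f, H f ->
         (forall n, ~ L n -> taylor_coef f n = 0) /\
         has_usum setT (fun n => `|taylor_coef f n| ^+ 2 * (real_complex R (beta n) : C) ^+ 2)
                  (ip f f)) &
      (forall a : mi -> C, (forall n, ~ L n -> a n = 0) ->
         (exists s, has_usum setT (fun n => `|a n| ^+ 2 * (real_complex R (beta n) : C) ^+ 2) s) ->
         exists2 f, H f & forall n, taylor_coef f n = a n)].

(* the z^n, n in L', are in H and form an orthogonal basis of H *)
Definition cond4 (Om : set pt) (H : set fn) (ip : fn -> fn -> C)
  (L' : set mi) : Prop :=
  [/\ inductive L',
      (forall n, L' n -> H (restr Om (monom^~ n))),
      (forall n n', L' n -> L' n' -> n <> n' ->
         ip (restr Om (monom^~ n)) (restr Om (monom^~ n')) = 0) &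
      (forall f, H f -> (forall n, L' n -> ip f (restr Om (monom^~ n)) = 0) ->
         f = (fun _ => 0))].

(* kappa(z,w) = sum_{n in L''} alpha_n z^n conj(w)^n on Om x Om *)
Definition cond5 (Om : set pt) (kappa : pt -> pt -> C) (L'' : set mi)
  (alpha : mi -> R) : Prop :=
  [/\ inductive L'', (forall n, L'' n -> 0 < alpha n) &
      forall z w, Om z -> Om w ->
        has_usum L'' (fun n => (real_complex R (alpha n) : C) * monom z n * (monom w n)^*)
                 (kappa z w)].

End Defs.

(* Main.v *)
Require Import Defs.
From HB Require Import structures.
From mathcomp Require Import all_boot all_order all_algebra.
From mathcomp Require Import complex.
From mathcomp Require Import finmap.
From mathcomp Require Import all_classical all_reals all_analysis.
From mathcomp Require Import ring lra.
Import Order.TTheory GRing.Theory Num.Theory.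
Import numFieldNormedType.Exports.
Local Open Scope classical_set_scope.
Local Open Scope ring_scope.

Set Implicit Arguments.
Unset Strict Implicit.
Unset Printing Implicit Defensive.

Local Notation Re := complex.Re.
Local Notation Im := complex.Im.

(* For f in H the Taylor coefficient a_n(f) at 0 is a bounded linear functional (Cauchy's
   estimates and continuity of the inclusion in Hol(Om)), so a_n(f) = <f, g_n> with g_n in H.
   If the inner product is torus invariant, g_n is homogeneous of degree n, hence a multiple
   of z^n; so the monomials lying in H are orthogonal, and a function orthogonal to all of
   them has zero Taylor series, hence is zero by the identity theorem. Thus they form an
   orthogonal basis, indexed by Lambda = {n | z^n in H}, and Parseval's identity gives the
   expansion of the kernel and, with Riesz-Fischer, the description of H as a weighted space;
   conversely the norm of a weighted space determines its inner product by polarisation.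
   Invariance of the kernel passes to the inner product since the kernel functions span a
   dense subspace. Lambda'' is recovered from the Taylor coefficients of the single function
   kappa(., w), w = (d, ..., d).
   The complex analysis needed goes through Goursat's lemma for rectangles: a Cauchy estimate
   with a non-sharp constant (64) suffices for holomorphy of partial derivatives, for the
   vanishing of functions with zero Taylor series, and for the boundedness of a_n. *)

(** The estimates are arranged so that no power series has to converge and no Cauchy integral
    formula is proved: two contour integrals of a quotient with a simple pole at 0 are compared, and
    the exact value 2 pi i of the integral of 1/w is replaced by the crude lower bound 2. Several
    variables are reached along complex lines. Holomorphy means differentiability only, so the
    partial derivatives must be shown differentiable before any Taylor coefficient can be handled.

    On the Hilbert space side the representative g_n serves twice. Under (2) its homogeneity makes
    it a multiple of z^n. Under (4), without any use of the torus, it is z^n / ||z^n||^2 for n in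
    Lambda' and 0 otherwise; this determines Lambda' and leads to (3). In (1) => (2) the obstacle is
    that f(zeta .) is not known to lie in H, so it has to be produced as a limit in H. The expansion
    (5) does not say that its monomials lie in H, and the way from (5) back to (4) passes through
    (1) and forgets the index set; hence the separate identification of Lambda''. *)

Section Modulus.
Variable R : realType.
Implicit Types z w : R[i].

(** The norm of [R[i]] takes its values in [R[i]]; a copy with values in [R] makes the total order
    and [lra] available. *)
Definition cmod z : R := Num.sqrt (Re z ^+ 2 + Im z ^+ 2).

Lemma cmodE z : `|z| = (cmod z)%:C%C.
Proof. exact: normc_def. Qed.

Lemma cmod_ge0 z : 0 <= cmod z.
Proof. exact: sqrtr_ge0. Qed.

Lemma cmod0 : cmod 0 = 0.
Proof. by apply: complexI; rewrite -cmodE normr0. Qed.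

Lemma cmod1 : cmod 1 = 1.
Proof. by apply: complexI; rewrite -cmodE normr1. Qed.

Lemma cmod_eq0 z : (cmod z == 0) = (z == 0).
Proof. by rewrite -(inj_eq (@complexI R)) -cmodE normr_eq0. Qed.

Lemma cmod_gt0 z : (0 < cmod z) = (z != 0).
Proof. by rewrite lt0r cmod_ge0 andbT cmod_eq0. Qed.

Lemma cmodN z : cmod (- z) = cmod z.
Proof. by apply: complexI; rewrite -!cmodE normrN. Qed.

Lemma cmodBC z w : cmod (z - w) = cmod (w - z).
Proof. by rewrite -cmodN opprB. Qed.

Lemma cmodM z w : cmod (z * w) = cmod z * cmod w.
Proof. by apply: complexI; rewrite -cmodE normrM !cmodE rmorphM. Qed.

Lemma cmodV z : cmod z^-1 = (cmod z)^-1.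
Proof. by apply: complexI; rewrite -cmodE normfV cmodE fmorphV. Qed.

Lemma cmodX z n : cmod (z ^+ n) = cmod z ^+ n.
Proof. by apply: complexI; rewrite -cmodE normrX cmodE rmorphXn. Qed.

Lemma cmodD z w : cmod (z + w) <= cmod z + cmod w.
Proof. by have := ler_normD z w; rewrite !cmodE -rmorphD lecR. Qed.

Lemma cmodB z w : cmod (z - w) <= cmod z + cmod w.
Proof. by rewrite -(cmodN w); exact: cmodD. Qed.

Lemma cmod_real (x : R) : cmod x%:C%C = `|x|.
Proof. by rewrite /cmod /= expr0n /= addr0 sqrtr_sqr. Qed.

Lemma cmod_imag (x : R) : cmod (Complex 0 x) = `|x|.
Proof. by rewrite /cmod /= expr0n /= add0r sqrtr_sqr. Qed.

Lemma cmod_i : cmod (Complex 0 1) = 1.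
Proof. by rewrite cmod_imag normr1. Qed.

Lemma Re_le_cmod z : `|Re z| <= cmod z.
Proof. by rewrite -sqrtr_sqr ler_wsqrtr// lerDl sqr_ge0. Qed.

Lemma Im_le_cmod z : `|Im z| <= cmod z.
Proof. by rewrite -sqrtr_sqr ler_wsqrtr// lerDr sqr_ge0. Qed.

Lemma cmod_le z : cmod z <= `|Re z| + `|Im z|.
Proof.
rewrite {1}(complexE z) (le_trans (cmodD _ _))// cmod_real lerD2l cmodM.
by rewrite cmod_i mul1r cmod_real.
Qed.

Lemma complex_gt0P z : 0 < z -> exists2 r : R, 0 < r & z = r%:C%C.
Proof.
move=> z0; have zE : z = (Re z)%:C%C.
  by move: z0; rewrite ltcE /= => /andP[/eqP d0 _]; rewrite [LHS]complexE d0 mulr0 addr0.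
by exists (Re z) => //; rewrite -ltcR -zE.
Qed.

Lemma complexR_neq0 (x : R) : 0 < x -> x%:C%C != 0 :> R[i].
Proof.
by move=> x0; rewrite -(rmorph0 (real_complex R)) (inj_eq (@complexI R)) lt0r_neq0.
Qed.

Lemma sqr_cmodD z w : cmod (z + w) ^+ 2 <= 2 * cmod z ^+ 2 + 2 * cmod w ^+ 2.
Proof.
have h : cmod (z + w) ^+ 2 <= (cmod z + cmod w) ^+ 2.
  by rewrite lerXn2r ?nnegrE ?cmod_ge0 ?addr_ge0 ?cmod_ge0// cmodD.
by have := sqr_ge0 (cmod z - cmod w); lra.
Qed.

Lemma mul_conjc z : z * conjc z = (cmod z ^+ 2)%:C%C.
Proof. by have := sqr_normc z; rewrite cmodE -rmorphXn => <-. Qed.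

Lemma cmod_conjc z : cmod (conjc z) = cmod z.
Proof. by apply: complexI; rewrite -!cmodE normcJ. Qed.

(** Explicit Archimedean rank, for the sequences below that are controlled at speed 1/(k+1). *)
Lemma invS_lt (x : R) (k : nat) : 0 < x -> (Num.truncn x^-1 <= k)%N -> k.+1%:R^-1 < x.
Proof.
move=> x0 xk; rewrite -[ltRHS]invrK ltf_pV2 ?posrE ?invr_gt0 ?ltr0n//.
by rewrite (lt_le_trans (truncnS_gt _))// ler_nat ltnS.
Qed.

Lemma cmod_sum (I : Type) (s : seq I) (P : pred I) (F : I -> R[i]) :
  cmod (\sum_(i <- s | P i) F i) <= \sum_(i <- s | P i) cmod (F i).
Proof.
elim/big_rec2 : _ => [|i x y _ le]; first by rewrite cmod0.
exact/(le_trans (cmodD _ _))/lerD.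
Qed.

Lemma cmod_prod (I : Type) (s : seq I) (P : pred I) (F : I -> R[i]) :
  cmod (\prod_(i <- s | P i) F i) = \prod_(i <- s | P i) cmod (F i).
Proof. by apply: (big_morph cmod cmodM cmod1). Qed.

End Modulus.

(** * Goursat's lemma and Cauchy's estimate *)

Section RealIntegral.
Variable R : realType.
Notation mu := (@lebesgue_measure R).

Implicit Types (u v : R -> R) (a b c x : R).

Definition rcont u x := forall e, 0 < e -> exists2 d : R, 0 < d &
  forall y, `|y - x| < d -> `|u y - u x| <= e.

Lemma rcont_cvg u x : rcont u x -> {for x, continuous u}.
Proof.
move=> cu; apply/cvgrPdist_le => /= e e0; have [d d0 dP] := cu e e0.
apply/nbhs_normP; exists d => //= y; rewrite /= distrC => /dP.
by rewrite distrC.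
Qed.

Lemma rcont_integrable u a b : (forall x, a <= x <= b -> rcont u x) ->
  mu.-integrable `[a, b] (EFin \o u).
Proof.
move=> cu; apply: continuous_compact_integrable; first exact: segment_compact.
apply: continuous_in_subspaceT => x; rewrite inE/= in_itv/= => /cu.
exact: rcont_cvg.
Qed.

Definition rint (u : R -> R) a b : R := \int[mu]_(x in `[a, b]) u x.

Lemma rint_split u a b c : a <= b -> b <= c ->
  (forall x, a <= x <= c -> rcont u x) ->
  rint u a c = rint u a b + rint u b c.
Proof.
move=> ab bc /rcont_integrable iu; rewrite /rint.
rewrite -[X in _ = _ + X]Rintegral_itv_obnd_cbnd; last first.
  apply: integrableS iu => //; apply: subset_itvr => //=.
by rewrite -(Rintegral_itvB iu) ?bnd_simp// addrC subrK.
Qed.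

Lemma rintD u v a b : (forall x, a <= x <= b -> rcont u x) ->
  (forall x, a <= x <= b -> rcont v x) ->
  rint (fun x => u x + v x) a b = rint u a b + rint v a b.
Proof.
by move=> /rcont_integrable cu /rcont_integrable cv; rewrite /rint RintegralD.
Qed.

Lemma rint_ge u a b m : a <= b -> (forall x, a <= x <= b -> rcont u x) ->
  (forall x, a <= x <= b -> m <= u x) -> m * (b - a) <= rint u a b.
Proof.
move=> ab cu mu'.
have -> : m * (b - a) = rint (fun=> m) a b.
  rewrite /rint Rintegral_cst//= lebesgue_measure_itv/= lte_fin.
  by move: ab; rewrite le_eqVlt => /predU1P[->|->//]; rewrite ltxx subrr.
rewrite /rint; apply: le_Rintegral => //.
- apply: rcont_integrable => x _ e e0; exists 1 => // y _.
  by rewrite subrr normr0 ltW.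
- exact: rcont_integrable.
Qed.

Lemma rint_le u a b m : a <= b -> (forall x, a <= x <= b -> rcont u x) ->
  (forall x, a <= x <= b -> u x <= m) -> rint u a b <= m * (b - a).
Proof.
move=> ab cu mu'.
have -> : m * (b - a) = rint (fun=> m) a b.
  rewrite /rint Rintegral_cst//= lebesgue_measure_itv/= lte_fin.
  by move: ab; rewrite le_eqVlt => /predU1P[->|->//]; rewrite ltxx subrr.
rewrite /rint; apply: le_Rintegral => //.
- exact: rcont_integrable.
- apply: rcont_integrable => x _ e e0; exists 1 => // y _.
  by rewrite subrr normr0 ltW.
Qed.

End RealIntegral.

Section ComplexIntegral.
Variable R : realType.
Implicit Types (u v : R -> R[i]) (a b c d x y : R).
Local Notation C := R[i].

Definition ccont u x := forall e, 0 < e -> exists2 d : R, 0 < d &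
  forall y, `|y - x| < d -> cmod (u y - u x) <= e.

Definition cint u a b : C :=
  Complex (rint (fun x => Re (u x)) a b) (rint (fun x => Im (u x)) a b).

Lemma ReB (z w : C) : Re (z - w) = Re z - Re w.
Proof. by case: z w => [? ?] []. Qed.

Lemma ImB (z w : C) : Im (z - w) = Im z - Im w.
Proof. by case: z w => [? ?] []. Qed.

Lemma ReD (z w : C) : Re (z + w) = Re z + Re w.
Proof. by case: z w => [? ?] []. Qed.

Lemma ImD (z w : C) : Im (z + w) = Im z + Im w.
Proof. by case: z w => [? ?] []. Qed.

Lemma ccontRe u x : ccont u x -> rcont (fun x => Re (u x)) x.
Proof.
move=> cu e e0; have [d d0 dP] := cu e e0; exists d => // y /dP.
by rewrite -ReB; apply: le_trans; exact: Re_le_cmod.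
Qed.

Lemma ccontIm u x : ccont u x -> rcont (fun x => Im (u x)) x.
Proof.
move=> cu e e0; have [d d0 dP] := cu e e0; exists d => // y /dP.
by rewrite -ImB; apply: le_trans; exact: Im_le_cmod.
Qed.

Lemma ccontD u v x : ccont u x -> ccont v x -> ccont (fun x => u x + v x) x.
Proof.
move=> cu cv e e0; have e20 : 0 < e / 2 by rewrite divr_gt0.
have [d d0 dP] := cu _ e20; have [d' d'0 d'P] := cv _ e20.
exists (Num.min d d'); first by rewrite lt_min d0.
move=> y; rewrite lt_min => /andP[/dP le1 /d'P le2].
rewrite opprD addrACA (le_trans (cmodD _ _))//; lra.
Qed.

Lemma ccontN u x : ccont u x -> ccont (fun x => - u x) x.
Proof.
move=> cu e e0; have [d d0 dP] := cu _ e0; exists d => // y /dP.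
by rewrite -opprD cmodN.
Qed.

Lemma ccontB u v x : ccont u x -> ccont v x -> ccont (fun x => u x - v x) x.
Proof. by move=> cu cv; apply: ccontD => //; exact: ccontN. Qed.

Lemma cint_split u a b c : a <= b -> b <= c ->
  (forall x, a <= x <= c -> ccont u x) ->
  cint u a c = cint u a b + cint u b c.
Proof.
move=> ab bc cu; rewrite /cint (rint_split ab bc); last first.
  by move=> x /cu/ccontRe.
rewrite [X in Complex _ X](rint_split ab bc)//.
by move=> x /cu/ccontIm.
Qed.

Lemma cintD u v a b : (forall x, a <= x <= b -> ccont u x) ->
  (forall x, a <= x <= b -> ccont v x) ->
  cint (fun x => u x + v x) a b = cint u a b + cint v a b.
Proof.
move=> cu cv; rewrite /cint.
have -> : rint (fun x => Re (u x + v x)) a b =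
    rint (fun x => Re (u x)) a b + rint (fun x => Re (v x)) a b.
  rewrite -rintD; [|by move=> x /cu/ccontRe|by move=> x /cv/ccontRe].
  by congr rint; apply/funext => x; rewrite ReD.
have -> // : rint (fun x => Im (u x + v x)) a b =
    rint (fun x => Im (u x)) a b + rint (fun x => Im (v x)) a b.
rewrite -rintD; [|by move=> x /cu/ccontIm|by move=> x /cv/ccontIm].
by congr rint; apply/funext => x; rewrite ImD.
Qed.

(** Bounding real and imaginary parts separately costs the factor 2, which all later constants
    inherit. *)
Lemma cint_est u a b (k : C) M : a <= b ->
  (forall x, a <= x <= b -> ccont u x) ->
  (forall x, a <= x <= b -> cmod (u x - k) <= M) ->
  cmod (cint u a b - k * (b - a)%:C%C) <= 2 * M * (b - a).
Proof.
move=> ab cu leM.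
have cRe x : a <= x <= b -> rcont (fun x => Re (u x)) x by move=> /cu/ccontRe.
have cIm x : a <= x <= b -> rcont (fun x => Im (u x)) x by move=> /cu/ccontIm.
have leRe x : a <= x <= b -> `|Re (u x) - Re k| <= M.
  by move=> /leM; apply: le_trans; rewrite -ReB Re_le_cmod.
have leIm x : a <= x <= b -> `|Im (u x) - Im k| <= M.
  by move=> /leM; apply: le_trans; rewrite -ImB Im_le_cmod.
have re1 := @rint_ge _ _ _ _ (Re k - M) ab cRe.
have re2 := @rint_le _ _ _ _ (Re k + M) ab cRe.
have im1 := @rint_ge _ _ _ _ (Im k - M) ab cIm.
have im2 := @rint_le _ _ _ _ (Im k + M) ab cIm.
have {}re1 : (Re k - M) * (b - a) <= rint (fun x => Re (u x)) a b.
  by apply: re1 => x /leRe; rewrite ler_distl => /andP[].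
have {}re2 : rint (fun x => Re (u x)) a b <= (Re k + M) * (b - a).
  by apply: re2 => x /leRe; rewrite ler_distl => /andP[].
have {}im1 : (Im k - M) * (b - a) <= rint (fun x => Im (u x)) a b.
  by apply: im1 => x /leIm; rewrite ler_distl => /andP[].
have {}im2 : rint (fun x => Im (u x)) a b <= (Im k + M) * (b - a).
  by apply: im2 => x /leIm; rewrite ler_distl => /andP[].
rewrite (le_trans (cmod_le _))// ReB ImB /=.
have -> : Re (k * (b - a)%:C%C) = Re k * (b - a).
  by case: (k) => k1 k2 /=; rewrite mulr0 subr0.
have -> : Im (k * (b - a)%:C%C) = Im k * (b - a).
  by case: (k) => k1 k2 /=; rewrite mulr0 add0r.
rewrite -mulrA mulrDl mul1r lerD// ler_norml; lra.
Qed.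

Lemma cint_le u a b M : a <= b -> (forall x, a <= x <= b -> ccont u x) ->
  (forall x, a <= x <= b -> cmod (u x) <= M) ->
  cmod (cint u a b) <= 2 * M * (b - a).
Proof.
move=> ab cu leM; have := @cint_est u a b 0 M ab cu.
by rewrite mul0r subr0; apply => x /leM; rewrite subr0.
Qed.

End ComplexIntegral.

(** * Complex differentiability at a point and integrals over boundaries of rectangles *)

Section Goursat.
Variable R : realType.
Local Notation C := R[i].
Implicit Types (f g : C -> C) (p k w : C) (a b c d e x y : R).

Definition pcont f p := forall e, 0 < e -> exists2 d : R, 0 < d &
  forall w, cmod (w - p) < d -> cmod (f w - f p) <= e.

Definition cdiff f p k := forall e, 0 < e -> exists2 d : R, 0 < d &
  forall w, cmod (w - p) < d ->
    cmod (f w - f p - k * (w - p)) <= e * cmod (w - p).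

Lemma cdiff_pcont f p k : cdiff f p k -> pcont f p.
Proof.
move=> df e e0; have [d d0 dP] := df 1 ltr01.
have q0 : 0 < 1 + cmod k by rewrite ltr_pwDl// cmod_ge0.
exists (Num.min d (e / (1 + cmod k))).
  by rewrite lt_min d0 divr_gt0.
move=> w; rewrite lt_min => /andP[/dP le1 le2].
rewrite -(subrK (k * (w - p)) (f w - f p)) (le_trans (cmodD _ _))//.
rewrite cmodM (le_trans (lerD le1 (lexx _)))// -mulrDl mulrC.
by rewrite -ler_pdivlMr// ltW.
Qed.

Lemma pcont_hor f y x : pcont f (Complex x y) -> ccont (fun x => f (Complex x y)) x.
Proof.
move=> cf e e0; have [d d0 dP] := cf e e0; exists d => // x' xx'; apply: dP.
rewrite [_ - _](_ : _ = (x' - x)%:C%C) ?cmod_real//.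
by apply/eqP; rewrite eq_complex /= subrr !eqxx.
Qed.

Lemma pcont_ver f x y : pcont f (Complex x y) -> ccont (fun y => f (Complex x y)) y.
Proof.
move=> cf e e0; have [d d0 dP] := cf e e0; exists d => // x' xx'; apply: dP.
rewrite [_ - _](_ : _ = Complex 0 (x' - y)) ?cmod_imag//.
by apply/eqP; rewrite eq_complex /= subrr !eqxx.
Qed.

Local Notation ii := (Complex (0 : R) 1).

(* The contour integral of f along the boundary of [a, b] x [c, d], counterclockwise. *)
Definition rectint f a b c d :=
  cint (fun x => f (Complex x c) - f (Complex x d)) a b +
  ii * cint (fun y => f (Complex b y) - f (Complex a y)) c d.

Definition on_hor f a b y := forall x, a <= x <= b -> pcont f (Complex x y).
Definition on_ver f x c d := forall y, c <= y <= d -> pcont f (Complex x y).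

Lemma rectint_splitx f a e b c d : a <= e -> e <= b ->
  on_hor f a b c -> on_hor f a b d ->
  on_ver f a c d -> on_ver f e c d -> on_ver f b c d ->
  rectint f a b c d = rectint f a e c d + rectint f e b c d.
Proof.
move=> ae eb hc hd va ve vb; rewrite /rectint.
rewrite (cint_split ae eb); last first.
  by move=> x xab; apply: ccontB; apply: pcont_hor; [exact: hc|exact: hd].
rewrite addrACA -mulrDr; congr (_ + _ * _).
rewrite -cintD; last 2 first.
- by move=> x xab; apply: ccontB; apply: pcont_ver; [exact: ve|exact: va].
- by move=> x xab; apply: ccontB; apply: pcont_ver; [exact: vb|exact: ve].
by congr cint; apply/funext => y; ring.
Qed.

Lemma rectint_splity f a b c e d : c <= e -> e <= d ->
  on_hor f a b c -> on_hor f a b e -> on_hor f a b d ->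
  on_ver f a c d -> on_ver f b c d ->
  rectint f a b c d = rectint f a b c e + rectint f a b e d.
Proof.
move=> ce ed hc he hd va vb; rewrite /rectint.
rewrite [X in _ + _ * X](cint_split ce ed); last first.
  by move=> x xab; apply: ccontB; apply: pcont_ver; [exact: vb|exact: va].
rewrite [RHS]addrACA -mulrDr; congr (_ + _ * _).
rewrite -cintD; last 2 first.
- by move=> x xab; apply: ccontB; apply: pcont_hor; [exact: hc|exact: he].
- by move=> x xab; apply: ccontB; apply: pcont_hor; [exact: he|exact: hd].
by congr cint; apply/funext => y; ring.
Qed.

(** An affine function has integral 0 over the boundary, so only the remainder counts. On each pair
    of opposite sides the integrand is within 2 M of a constant, [- k * ii * (d - c)] or
    [k * (b - a)], and the contributions of the two constants cancel. *)
Lemma rectint_est f a b c d p k M : a <= b -> c <= d ->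
  (forall x y, a <= x <= b -> c <= y <= d -> pcont f (Complex x y)) ->
  (forall x y, a <= x <= b -> c <= y <= d ->
     cmod (f (Complex x y) - f p - k * (Complex x y - p)) <= M) ->
  cmod (rectint f a b c d) <= 4 * M * ((b - a) + (d - c)).
Proof.
move=> ab cd cont leM.
have cc : c <= c <= d by rewrite lexx.
have dd : c <= d <= d by rewrite cd lexx.
have aa : a <= a <= b by rewrite lexx.
have bb : a <= b <= b by rewrite ab lexx.
have e1 := @cint_est _ (fun x => f (Complex x c) - f (Complex x d)) a b
  (- k * ii * (d - c)%:C%C) (2 * M) ab.
have e2 := @cint_est _ (fun y => f (Complex b y) - f (Complex a y)) c d
  (k * (b - a)%:C%C) (2 * M) cd.
have {}e1 : cmod (cint (fun x => f (Complex x c) - f (Complex x d)) a b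
   - (- k * ii * (d - c)%:C%C) * (b - a)%:C%C) <= 2 * (2 * M) * (b - a).
  apply: e1 => x xab.
    by apply: ccontB; apply: pcont_hor; exact: cont.
  have := leM _ _ xab cc; have := leM _ _ xab dd.
  set A := (X in cmod X) => A1; set B := (X in cmod X) => B1.
  rewrite (_ : _ - _ = B - A); first by rewrite (le_trans (cmodB _ _))//; lra.
  rewrite /A /B (_ : Complex x d = Complex x c + ii * (d - c)%:C%C); first by ring.
  by apply/eqP; rewrite eq_complex /= ; apply/andP; split; apply/eqP; ring.
have {}e2 : cmod (cint (fun y => f (Complex b y) - f (Complex a y)) c d
   - (k * (b - a)%:C%C) * (d - c)%:C%C) <= 2 * (2 * M) * (d - c).
  apply: e2 => x xab.
    by apply: ccontB; apply: pcont_ver; exact: cont.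
  have := leM _ _ aa xab; have := leM _ _ bb xab.
  set A := (X in cmod X) => A1; set B := (X in cmod X) => B1.
  rewrite (_ : _ - _ = A - B); first by rewrite (le_trans (cmodB _ _))//; lra.
  rewrite /A /B (_ : Complex b x = Complex a x + (b - a)%:C%C); first by ring.
  by apply/eqP; rewrite eq_complex /= ; apply/andP; split; apply/eqP; ring.
rewrite /rectint.
move: e1 e2; set I1 := cint _ a b; set I2 := cint _ c d => e1 e2.
rewrite (_ : _ + _ = (I1 - (- k * ii * (d - c)%:C%C) * (b - a)%:C%C) +
   ii * (I2 - (k * (b - a)%:C%C) * (d - c)%:C%C)); last by ring.
rewrite (le_trans (cmodD _ _))// cmodM cmod_i mul1r.
by rewrite (le_trans (lerD e1 e2))//; lra.
Qed.

End Goursat.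

(** * Goursat's lemma for rectangles, by repeated quartering *)

Section GoursatLemma.
Variable R : realType.
Local Notation C := R[i].
Implicit Types (f g : C -> C) (p w : C) (a b c d e x y : R).

Lemma pow2half_split (A : R) (k : nat) : A / 2 ^+ k = A / 2 ^+ k.+1 + A / 2 ^+ k.+1.
Proof. rewrite exprS; field; exact: expf_neq0. Qed.

Lemma rectint_quarter f x y (A B : R) : 0 <= A -> 0 <= B ->
  (forall t u, x <= t <= x + (A + A) -> y <= u <= y + (B + B) ->
    pcont f (Complex t u)) ->
  rectint f x (x + (A + A)) y (y + (B + B)) =
  rectint f x (x + A) y (y + B) + rectint f x (x + A) (y + B) (y + (B + B)) +
  (rectint f (x + A) (x + (A + A)) y (y + B) +
   rectint f (x + A) (x + (A + A)) (y + B) (y + (B + B))).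
Proof.
move=> A0 B0 cont.
have inxy t u : x <= t -> t <= x + (A + A) -> y <= u -> u <= y + (B + B) ->
    pcont f (Complex t u) by move=> ? ? ? ?; apply: cont; apply/andP.
rewrite (@rectint_splitx _ _ _ (x + A));
  [|lra|lra|by move=> t /andP[? ?]; apply: inxy; lra..].
by congr (_ + _); (apply: rectint_splity;
  [lra|lra|by move=> t /andP[? ?]; apply: inxy; lra..]).
Qed.

Lemma cmod_quarter (z1 z2 z3 z4 : C) : [\/ cmod (z1 + z2 + (z3 + z4)) <= 4 * cmod z1,
  cmod (z1 + z2 + (z3 + z4)) <= 4 * cmod z2, cmod (z1 + z2 + (z3 + z4)) <= 4 * cmod z3 |
  cmod (z1 + z2 + (z3 + z4)) <= 4 * cmod z4].
Proof.
have := le_trans (cmodD _ _) (lerD (cmodD z1 z2) (cmodD z3 z4)).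
move: (cmod (z1 + z2 + (z3 + z4))) => s le4.
have [|l1] := leP s (4 * cmod z1); first by constructor 1.
have [|l2] := leP s (4 * cmod z2); first by constructor 2.
have [|l3] := leP s (4 * cmod z3); first by constructor 3.
by constructor 4; lra.
Qed.

Variables (f : C -> C) (a A c B : R).
Hypotheses (A0 : 0 < A) (B0 : 0 < B).
Hypothesis df : forall x y, a <= x <= a + A -> c <= y <= c + B ->
  exists k, cdiff f (Complex x y) k.

Let pc x y : a <= x <= a + A -> c <= y <= c + B -> pcont f (Complex x y).
Proof. by move=> xa yc; have [k /cdiff_pcont] := df xa yc. Qed.

(** [q] is the lower left corner of a rectangle of generation [k], with sides A/2^k and B/2^k. *)
Let F (k : nat) (q : R * R) := rectint f q.1 (q.1 + A / 2 ^+ k) q.2 (q.2 + B / 2 ^+ k).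

Let inside (k : nat) (q : R * R) := [&& a <= q.1, q.1 + A / 2 ^+ k <= a + A,
  c <= q.2 & q.2 + B / 2 ^+ k <= c + B].

Let Ak (k : nat) : 0 < A / 2 ^+ k. Proof. by rewrite divr_gt0// exprn_gt0. Qed.
Let Bk (k : nat) : 0 < B / 2 ^+ k. Proof. by rewrite divr_gt0// exprn_gt0. Qed.

(** A quarter with the largest integral is kept. Containment is recorded coordinate by coordinate,
    for the nested intervals below. *)
Lemma goursat_step (k : nat) q : inside k q -> exists q', [/\ inside k.+1 q',
  q.1 <= q'.1 /\ q'.1 + A / 2 ^+ k.+1 <= q.1 + A / 2 ^+ k,
  q.2 <= q'.2 /\ q'.2 + B / 2 ^+ k.+1 <= q.2 + B / 2 ^+ k &
  cmod (F k q) <= 4 * cmod (F k.+1 q')].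
Proof.
case: q => x y; rewrite /inside /F /= (pow2half_split A k) (pow2half_split B k).
move: (Ak k.+1) (Bk k.+1); move: (A / 2 ^+ k.+1) (B / 2 ^+ k.+1) => A1 B1 A10 B10.
move=> /and4P[ax xa cy yc].
rewrite rectint_quarter ?(ltW A10) ?(ltW B10)//; last first.
  by move=> t u /andP[? ?] /andP[? ?]; apply: pc; apply/andP; split; lra.
pose r u v := rectint f u (u + A1) v (v + B1).
case: (cmod_quarter (r x y) (r x (y + B1)) (r (x + A1) y) (r (x + A1) (y + B1)));
  rewrite /r -!(addrA x A1 A1) -!(addrA y B1 B1) => le;
  [exists (x, y)|exists (x, y + B1)|exists (x + A1, y)|exists (x + A1, y + B1)];
  rewrite /= -?(addrA x A1 A1) -?(addrA y B1 B1);
  by split => //; [apply/and4P; split; lra|split; lra..].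
Qed.

(** If the integral had modulus eta > 0, generation n of the kept rectangles would carry at least
    eta/4^n; differentiability at their common point bounds it by half of that for large n. *)
Lemma goursat_rect : rectint f a (a + A) c (c + B) = 0.
Proof.
apply: contrapT => /eqP; rewrite -cmod_gt0 => eta0.
set eta := cmod _ in eta0.
pose bad (k : nat) q := inside k q /\ eta <= 4 ^+ k * cmod (F k q).
(* The generation is stored with the corner, so that the step is a map of one type into itself and
   can be iterated. *)
have step (kq : {kq : nat * (R * R) | bad kq.1 kq.2}) :
    {kq' : {kq : nat * (R * R) | bad kq.1 kq.2} |
      [/\ (sval kq').1 = (sval kq).1.+1,
      (sval kq).2.1 <= (sval kq').2.1 /\ (sval kq').2.1 + A / 2 ^+ (sval kq).1.+1 <=
         (sval kq).2.1 + A / 2 ^+ (sval kq).1 &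
      (sval kq).2.2 <= (sval kq').2.2 /\ (sval kq').2.2 + B / 2 ^+ (sval kq).1.+1 <=
         (sval kq).2.2 + B / 2 ^+ (sval kq).1]}.
  case: kq => -[k q] [/= ins le]; apply: cid.
  have [q' [i' x' y' le']] := goursat_step ins.
  have bq' : bad k.+1 q'.
    split=> //; apply: (le_trans le); rewrite exprSr -mulrA ler_wpM2l//.
  by exists (exist _ (k.+1, q') bq').
have b0 : bad 0 (a, c).
  rewrite /bad /F /inside /= !expr0 !divr1 mul1r !lexx; split => //.
pose s := fix s n := if n is n'.+1 then sval (step (s n'))
   else exist (fun kq => bad kq.1 kq.2) (0%N, (a, c)) b0.
have sk n : (sval (s n)).1 = n.
  by elim: n => //= n IH; case: (svalP (step (s n))) => -> _ _; rewrite IH.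
pose X n := (sval (s n)).2.1; pose Y n := (sval (s n)).2.2.
have Xs n : X n <= X n.+1 /\ X n.+1 + A / 2 ^+ n.+1 <= X n + A / 2 ^+ n.
  rewrite /X /=; move: (svalP (step (s n))); set q := sval (step _).
  by case => _ + _; rewrite sk.
have Ys n : Y n <= Y n.+1 /\ Y n.+1 + B / 2 ^+ n.+1 <= Y n + B / 2 ^+ n.
  rewrite /Y /=; move: (svalP (step (s n))); set q := sval (step _).
  by case => _ _; rewrite sk.
have sbad n : bad n (X n, Y n).
  by have := svalP (s n); rewrite sk /X /Y; case: (sval _).2.
(* Nested intervals: the supremum of the left ends lies in all of them. *)
have nested (Z : nat -> R) D : 0 < D ->
    (forall n, Z n <= Z n.+1 /\ Z n.+1 + D / 2 ^+ n.+1 <= Z n + D / 2 ^+ n) ->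
    exists z, forall n, Z n <= z <= Z n + D / 2 ^+ n.
  move=> D0 Zs.
  have Dk k : 0 < D / 2 ^+ k by rewrite divr_gt0// exprn_gt0.
  have mono n m : Z n <= Z (n + m)%N /\ Z (n + m)%N + D / 2 ^+ (n + m) <= Z n + D / 2 ^+ n.
    elim: m => [|m [IH1 IH2]]; first by rewrite addn0.
    by rewrite addnS; have [h1 h2] := Zs (n + m)%N; split; lra.
  have ub n m : Z m <= Z n + D / 2 ^+ n.
    have [h1 h2] := mono n (maxn n m - n)%N; have [h3 h4] := mono m (maxn n m - m)%N.
    move: h1 h2 h3 h4; rewrite !subnKC ?leq_maxl ?leq_maxr// => h1 h2 h3 h4.
    by have := Dk (maxn n m); lra.
  exists (sup (range Z)) => n; apply/andP; split.
    apply: ub_le_sup; last by exists n.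
    by exists (Z 0%N + D / 2 ^+ 0) => _ [m _ <-]; exact: ub.
  apply: ge_sup; first by exists (Z 0%N); exists 0%N.
  by move=> _ [m _ <-]; exact: ub.
have [x xP] := nested X A A0 Xs; have [y yP] := nested Y B B0 Ys.
have xa : a <= x <= a + A by have := xP 0%N; rewrite expr0 divr1 /X.
have yc : c <= y <= c + B by have := yP 0%N; rewrite expr0 divr1 /Y.
have [k dfk] := df xa yc.
have S0 : 0 < (A + B) ^+ 2 by rewrite exprn_gt0// addr_gt0.
(* With slope error e the integral at generation n is at most 4 e ((A + B)/2^n)^2; multiplied by 4^n
   this is eta/2 for the present e. *)
have e0 : 0 < eta / (8 * (A + B) ^+ 2) by rewrite divr_gt0// mulr_gt0.
have [d d0 dP] := dfk _ e0.
have [n nP] : exists n, (A + B) / 2 ^+ n < d.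
  have [n nP] : exists n : nat, (A + B) / d < n%:R.
    by exists (Num.truncn ((A + B) / d)).+1; exact: truncnS_gt.
  exists n; rewrite ltr_pdivrMr ?exprn_gt0// mulrC -ltr_pdivrMr//.
  apply: (lt_trans nP); rewrite -natrX ltr_nat; exact: ltn_expl.
have [/and4P[/= i1 i2 i3 i4] le] := sbad n.
have inR t u : X n <= t <= X n + A / 2 ^+ n -> Y n <= u <= Y n + B / 2 ^+ n ->
    a <= t <= a + A /\ c <= u <= c + B.
  move=> /andP[t1 t2] /andP[u1 u2]; split.
    by rewrite (le_trans i1 t1) (le_trans t2 i2).
  by rewrite (le_trans i3 u1) (le_trans u2 i4).
have [An Bn] := (Ak n, Bk n).
have H := @rectint_est _ f (X n) (X n + A / 2 ^+ n) (Y n) (Y n + B / 2 ^+ n)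
   (Complex x y) k (eta / (8 * (A + B) ^+ 2) * ((A + B) / 2 ^+ n)).
have {}H : cmod (rectint f (X n) (X n + A / 2 ^+ n) (Y n) (Y n + B / 2 ^+ n)) <=
    4 * (eta / (8 * (A + B) ^+ 2) * ((A + B) / 2 ^+ n)) * (A / 2 ^+ n + B / 2 ^+ n).
apply: (le_trans (H _ _ _ _)); [by rewrite lerDl ltW|by rewrite lerDl ltW|..].
- by move=> t u tX uY; have [] := inR t u tX uY; exact: pc.
- move=> t u /andP[tX1 tX2] /andP[uY1 uY2].
  have le1 : cmod (Complex t u - Complex x y) <= (A + B) / 2 ^+ n.
    rewrite (le_trans (cmod_le _))//= mulrDl lerD// ler_norml.
      by move: tX1 tX2 (xP n) => t1 t2 /andP[]; move: (A / _) t1 t2 => A1; clear; lra.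
    by move: uY1 uY2 (yP n) => t1 t2 /andP[]; move: (B / _) t1 t2 => B1; clear; lra.
  apply: (le_trans (dP _ (le_lt_trans le1 nP))).
  by rewrite ler_wpM2l// ltW.
- by rewrite !(addrAC _ (_ / _) (- _)) !subrr !add0r.
move: le H; rewrite /F /= -mulrDl.
set I := cmod _ => le1 le2.
have pow : (4 : R) ^+ n = 2 ^+ n * 2 ^+ n.
  by rewrite -exprMn; congr (_ ^+ _); ring.
have : eta <= 4 ^+ n * (4 * (eta / (8 * (A + B) ^+ 2) * ((A + B) / 2 ^+ n)) * ((A + B) / 2 ^+ n)).
  by apply: (le_trans le1); rewrite ler_wpM2l// exprn_ge0.
rewrite [X in _ <= X](_ : _ = eta / 2); last first.
  rewrite pow; field; rewrite expf_neq0// lt0r_neq0//; exact: addr_gt0.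
by move: eta0; lra.
Qed.

End GoursatLemma.

(** * A quotient with a simple pole, integrated over squares about the pole *)

Section SquareContour.
Variable R : realType.
Local Notation C := R[i].
Implicit Types (f g : C -> C) (p k l w : C) (a b c d e x y r s : R).
Local Notation ii := (Complex (0 : R) 1).

Lemma cdiff_cst k p : cdiff (fun=> k) p 0.
Proof.
move=> e e0; exists 1 => // w _.
by rewrite mul0r subrr subr0 cmod0 mulr_ge0 ?cmod_ge0// ltW.
Qed.

Lemma cdiffD f g p k l : cdiff f p k -> cdiff g p l ->
  cdiff (fun w => f w + g w) p (k + l).
Proof.
move=> df dg e e0; have e20 : 0 < e / 2 by rewrite divr_gt0.
have [d d0 dP] := df _ e20; have [d' d'0 d'P] := dg _ e20.
exists (Num.min d d'); first by rewrite lt_min d0.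
move=> w; rewrite lt_min => /andP[/dP le1 /d'P le2].
rewrite (_ : _ - _ = (f w - f p - k * (w - p)) + (g w - g p - l * (w - p))).
  by rewrite (le_trans (cmodD _ _))//; lra.
by ring.
Qed.

Lemma cdiffM f g p k l : cdiff f p k -> cdiff g p l ->
  cdiff (fun w => f w * g w) p (k * g p + f p * l).
Proof.
move=> df dg e e0.
pose D := 1 + cmod (g p) + cmod k + cmod (f p).
have := cmod_ge0 (g p); have := cmod_ge0 k; have := cmod_ge0 (f p) => fp0 k0 gp0.
have D0 : 0 < D by rewrite /D; lra.
have e30 : 0 < e / (3 * D) by rewrite divr_gt0// mulr_gt0.
have [d1 d10 d1P] := df _ e30.
have [d2 d20 d2P] := dg _ e30.
have [d3 d30 d3P] := cdiff_pcont dg e30.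
have [d4 d40 d4P] := cdiff_pcont dg ltr01.
exists (Num.min (Num.min d1 d2) (Num.min d3 d4)); first by rewrite !lt_min d10 d20 d30.
move=> w; rewrite !lt_min => /andP[/andP[/d1P le1 /d2P le2] /andP[/d3P le3 /d4P le4]].
rewrite (_ : _ - _ = (f w - f p - k * (w - p)) * g w + k * (w - p) * (g w - g p)
  + f p * (g w - g p - l * (w - p))); last by ring.
have le5 : cmod (g w) <= D.
  rewrite -(subrK (g p) (g w)) (le_trans (cmodD _ _))// /D; lra.
have wp0 := cmod_ge0 (w - p).
have t1 : cmod ((f w - f p - k * (w - p)) * g w) <= e / 3 * cmod (w - p).
  rewrite cmodM (le_trans (ler_pM _ _ le1 le5)) ?cmod_ge0//.
  rewrite [X in X <= _](_ : _ = e / 3 * cmod (w - p))//; field; exact: lt0r_neq0.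
have t2 : cmod (k * (w - p) * (g w - g p)) <= e / 3 * cmod (w - p).
  rewrite !cmodM; have kD : cmod k <= D by rewrite /D; lra.
  apply: (@le_trans _ _ (D * cmod (w - p) * (e / (3 * D)))).
    by rewrite ler_pM ?mulr_ge0 ?cmod_ge0// ler_wpM2r.
  rewrite [X in X <= _](_ : _ = e / 3 * cmod (w - p))//; field; exact: lt0r_neq0.
have t3 : cmod (f p * (g w - g p - l * (w - p))) <= e / 3 * cmod (w - p).
  rewrite !cmodM; have kD : cmod (f p) <= D by rewrite /D; lra.
  apply: (le_trans (ler_pM _ _ kD le2)); rewrite ?cmod_ge0//.
  rewrite [X in X <= _](_ : _ = e / 3 * cmod (w - p))//; field; exact: lt0r_neq0.
rewrite (le_trans (cmodD _ _))//; have := cmodD ((f w - f p - k * (w - p)) * g w)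
  (k * (w - p) * (g w - g p)).
by lra.
Qed.

Lemma cdiffV p : p != 0 -> cdiff (fun w => w^-1) p (- (p ^+ 2)^-1).
Proof.
move=> p0 e e0; have cp0 : 0 < cmod p by rewrite cmod_gt0.
exists (Num.min (cmod p / 2) (e * cmod p ^+ 3 / 2)).
  by rewrite lt_min !divr_gt0// mulr_gt0// exprn_gt0.
move=> w; rewrite lt_min => /andP[le1 le2].
have wp : cmod p / 2 <= cmod w.
  have := cmodD (p - w) w; rewrite subrK => h.
  by move: le1; rewrite cmodBC; lra.
have w0 : w != 0 by rewrite -cmod_gt0; apply: lt_le_trans wp; rewrite divr_gt0.
rewrite (_ : _ - _ = (w - p) * (w - p) / (w * p ^+ 2)); last by field; apply/andP.
rewrite !cmodM cmodV -mulrA mulrC ler_wpM2r ?cmod_ge0//.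
rewrite cmodM cmodX ler_pdivrMr; last by rewrite mulr_gt0 ?cmod_gt0// exprn_gt0.
rewrite (le_trans (ltW le2))// -!mulrA ler_wpM2l ?(ltW e0)//.
have -> : cmod p * (cmod p * (cmod p / 2)) = cmod p / 2 * cmod p ^+ 2 by ring.
by rewrite ler_wpM2r// exprn_ge0// ltW.
Qed.

Section Square.
Variables (f : C -> C) (s M : R) (k : C).
Hypothesis (s0 : 0 < s).
Hypothesis df : forall w, cmod w < s -> exists k, cdiff f w k.
Hypothesis fM : forall w, cmod w < s -> cmod (f w) <= M.
Hypothesis dk : cdiff f 0 k.
Hypothesis k0 : k != 0.

(* As f w - f 0 ~ k w, the integral of psi along a small square about 0 is close to
   that of 1/w, while |psi| <= 2 M / (|k| |w|^2) bounds it along the largest square.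
   Their equality yields Cauchy's estimate for the derivative k. *)
Let psi w : C := (f w - f 0) / (k * w ^+ 2).

Lemma cdiff_psi w : w != 0 -> cmod w < s -> exists l, cdiff psi w l.
Proof.
move=> w0 ws; have [l dl] := df ws.
have dV := cdiffV w0.
rewrite (_ : psi = fun v => (f v + - f 0) * k^-1 * (v^-1 * v^-1)).
  eexists; exact: cdiffM (cdiffM (cdiffD dl (@cdiff_cst (- f 0) w)) (@cdiff_cst k^-1 w))
    (cdiffM dV dV).
by apply/funext => v; rewrite /psi expr2 !invfM; ring.
Qed.

Lemma Complex_neq0 x y : (0 < `|x|) || (0 < `|y|) -> Complex x y != 0.
Proof. by rewrite eq_complex /= !normr_gt0 negb_and. Qed.

Lemma psi_cont r x y : 0 < r -> r <= s / 4 -> (r <= `|x|) || (r <= `|y|) ->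
  `|x| <= s / 4 -> `|y| <= s / 4 -> exists l, cdiff psi (Complex x y) l.
Proof.
move=> r0 rs xy xs ys; apply: cdiff_psi.
  by apply: Complex_neq0; case/orP: xy => /(lt_le_trans r0) ->//; rewrite orbT.
by apply: (le_lt_trans (cmod_le _)) => /=; lra.
Qed.

(** The region between the two squares is cut into a left and a right strip of full height, then a
    lower and an upper strip between them; Goursat's lemma kills all four, as [psi] is
    differentiable off 0. *)
Lemma square_const r : 0 < r -> r <= s / 4 ->
  rectint psi (- r) r (- r) r =
  rectint psi (- (s / 4)) (s / 4) (- (s / 4)) (s / 4).
Proof.
move=> r0; rewrite le_eqVlt => /predU1P[->//|rs].
have s4 : 0 < s / 4 by rewrite divr_gt0.
have norm x y : - y <= x <= y -> `|x| <= y by rewrite ler_norml.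
have big1 x : r <= x -> r <= `|x|.
  by move=> h; apply: (le_trans h); exact: ler_norm.
have big2 x : x <= - r -> r <= `|x|.
  by move=> h; rewrite -normrN; apply: big1; lra.
have cont x y : (r <= `|x|) || (r <= `|y|) ->
  - (s / 4) <= x <= s / 4 -> - (s / 4) <= y <= s / 4 ->
  exists l, cdiff psi (Complex x y) l.
  by move=> ? /norm ? /norm ?; apply: (@psi_cont r) => //; exact: ltW.
have pc x y : (r <= `|x|) || (r <= `|y|) ->
  - (s / 4) <= x <= s / 4 -> - (s / 4) <= y <= s / 4 -> pcont psi (Complex x y).
  by move=> xy xs ys; have [l /cdiff_pcont] := cont _ _ xy xs ys.
have rr : (r <= `|r|) by exact: big1.
have rNr : (r <= `|- r|) by rewrite normrN.
have sr : (r <= `|s / 4|) by apply: big1; exact: ltW.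
have sNr : (r <= `|- (s / 4)|) by rewrite normrN.
move: (s / 4) s4 rs cont pc sr sNr => {norm} S S0 rs cont pc sr sNr.
have rI : - S <= r <= S by apply/andP; split; lra.
have rNI : - S <= - r <= S by apply/andP; split; lra.
have SI : - S <= S <= S by apply/andP; split; lra.
have SNI : - S <= - S <= S by apply/andP; split; lra.
rewrite [RHS](@rectint_splitx _ _ _ (- r)); [|lra|lra|..]; last 5 first.
- by move=> x xS; apply: pc => //; rewrite sNr orbT.
- by move=> x xS; apply: pc => //; rewrite sr orbT.
- by move=> x xS; apply: pc => //; rewrite sNr.
- by move=> x xS; apply: pc => //; rewrite rNr.
- by move=> x xS; apply: pc => //; rewrite sr.
have -> : rectint psi (- S) (- r) (- S) S = 0.
  rewrite (_ : - r = - S + (S - r)); last by ring.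
  rewrite [X in rectint _ _ _ _ X](_ : S = - S + (S + S)); last by ring.
  apply: goursat_rect; [lra|lra|].
  move=> x y /andP[x1 x2] /andP[y1 y2]; apply: cont.
  - by apply/orP; left; apply: big2; lra.
  - by apply/andP; split; lra.
  - by apply/andP; split; lra.
rewrite add0r [RHS](@rectint_splitx _ _ _ r); [|lra|lra|..]; last 5 first.
- move=> x /andP[x1 x2]; apply: pc => //; first by rewrite sNr orbT.
  by apply/andP; split; lra.
- move=> x /andP[x1 x2]; apply: pc => //; first by rewrite sr orbT.
  by apply/andP; split; lra.
- by move=> x xS; apply: pc => //; rewrite rNr.
- by move=> x xS; apply: pc => //; rewrite rr.
- by move=> x xS; apply: pc => //; rewrite sr.
have -> : rectint psi r S (- S) S = 0.
  rewrite [X in rectint _ _ X _ _](_ : S = r + (S - r)); last by ring.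
  rewrite [X in rectint _ _ _ _ X](_ : S = - S + (S + S)); last by ring.
  apply: goursat_rect; [lra|lra|].
  move=> x y /andP[x1 x2] /andP[y1 y2]; apply: cont.
  - by apply/orP; left; apply: big1; lra.
  - by apply/andP; split; lra.
  - by apply/andP; split; lra.
have xr x : - r <= x <= r -> - S <= x <= S.
  by move=> /andP[? ?]; apply/andP; split; lra.
rewrite addr0 [RHS](@rectint_splity _ _ _ _ _ (- r)); [|lra|lra|..]; last 5 first.
- by move=> x /xr xS; apply: pc => //; rewrite sNr orbT.
- by move=> x /xr xS; apply: pc => //; rewrite rNr orbT.
- by move=> x /xr xS; apply: pc => //; rewrite sr orbT.
- by move=> x xS; apply: pc => //; rewrite rNr.
- by move=> x xS; apply: pc => //; rewrite rr.
have -> : rectint psi (- r) r (- S) (- r) = 0.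
  rewrite [X in rectint _ _ X _ _](_ : r = - r + (r + r)); last by ring.
  rewrite [X in rectint _ _ _ _ X](_ : - r = - S + (S - r)); last by ring.
  apply: goursat_rect; [lra|lra|].
  move=> x y /andP[x1 x2] /andP[y1 y2]; apply: cont.
  - by apply/orP; right; apply: big2; lra.
  - by apply/andP; split; lra.
  - by apply/andP; split; lra.
rewrite add0r [RHS](@rectint_splity _ _ _ _ _ r); [|lra|lra|..]; last 5 first.
- by move=> x /xr xS; apply: pc => //; rewrite rNr orbT.
- by move=> x /xr xS; apply: pc => //; rewrite rr orbT.
- by move=> x /xr xS; apply: pc => //; rewrite sr orbT.
- move=> x /andP[x1 x2]; apply: pc => //; first by rewrite rNr.
  by apply/andP; split; lra.
- move=> x /andP[x1 x2]; apply: pc => //; first by rewrite rr.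
  by apply/andP; split; lra.
have -> : rectint psi (- r) r r S = 0.
  rewrite [X in rectint _ _ X _ _](_ : r = - r + (r + r)); last by ring.
  rewrite [X in rectint _ _ _ _ X](_ : S = r + (S - r)); last by ring.
  apply: goursat_rect; [lra|lra|].
  move=> x y /andP[x1 x2] /andP[y1 y2]; apply: cont.
  - by apply/orP; right; apply: big1; lra.
  - by apply/andP; split; lra.
  - by apply/andP; split; lra.
by rewrite addr0.
Qed.

End Square.
End SquareContour.

(** * Cauchy's estimate for the first derivative *)

Section CauchyEstimate.
Variable R : realType.
Local Notation C := R[i].
Implicit Types (f g : C -> C) (k l w : C) (x y r s : R).
Local Notation ii := (Complex (0 : R) 1).

(** On the square of half-side s/4 one has |psi| <= N = 32 M / (|k| s^2). Each pair of opposite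
    sides contributes at most 2 (2 N) (s/2) = 64 M / (|k| s), while the integral over a small square
    has modulus at least 2; hence 2 <= 2 * 64 M / (|k| s). *)
Lemma cauchy_estimate f s M k : 0 < s ->
  (forall w, cmod w < s -> exists k, cdiff f w k) ->
  (forall w, cmod w < s -> cmod (f w) <= M) ->
  cdiff f 0 k -> cmod k <= 64 * M / s.
Proof.
move=> s0 df fM dk.
have M0 : 0 <= M by apply: le_trans (fM 0 _); rewrite ?cmod_ge0// cmod0.
have [->|k0] := eqVneq k 0; first by rewrite cmod0 divr_ge0 ?mulr_ge0// ltW.
have ck0 : 0 < cmod k by rewrite cmod_gt0.
pose psi w : C := (f w - f 0) / (k * w ^+ 2).
(* The slope error |k|/4 makes psi differ from 1/w by at most 1/(4 r) on the small square. *)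
have [|d d0 dP] := dk (cmod k / 4); first by rewrite divr_gt0.
pose r := Num.min (s / 4) (d / 4).
have r0 : 0 < r by rewrite lt_min !divr_gt0.
have rs : r <= s / 4 by rewrite ge_min lexx.
have rd : r <= d / 4 by rewrite ge_min lexx orbT.
have norm (x y : R) : - y <= x <= y -> `|x| <= y by rewrite ler_norml.
have pc (t x y : R) : 0 < t -> t <= s / 4 -> `|x| <= t -> `|y| <= t ->
    (t <= `|x|) || (t <= `|y|) -> pcont psi (Complex x y).
  move=> t0 ts xt yt xy.
  by have [||l /cdiff_pcont//] := psi_cont k df t0 ts xy; apply: le_trans ts.
have nt (t : R) : 0 < t -> `|t| = t by move=> /ltW/ger0_norm.
have nNt (t : R) : 0 < t -> `|- t| = t by move=> /nt; rewrite normrN.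
have cu (t x : R) : 0 < t -> t <= s / 4 -> - t <= x <= t ->
    ccont (fun x => psi (Complex x (- t)) - psi (Complex x t)) x.
  move=> t0 ts xt; have := norm _ _ xt => xt'.
  by apply: ccontB; apply: pcont_hor; apply: (pc t) => //;
    rewrite ?(nt t)// ?(nNt t)// ?lexx ?orbT//.
have cv (t x : R) : 0 < t -> t <= s / 4 -> - t <= x <= t ->
    ccont (fun y => psi (Complex t y) - psi (Complex (- t) y)) x.
  move=> t0 ts xt; have := norm _ _ xt => xt'.
  by apply: ccontB; apply: pcont_ver; apply: (pc t) => //;
    rewrite ?(nt t)// ?(nNt t)// ?lexx ?orbT//.
have S0 : 0 < s / 4 by rewrite divr_gt0.
have upper : cmod (rectint psi (- (s / 4)) (s / 4) (- (s / 4)) (s / 4)) <=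
    2 * (64 * M / (cmod k * s)).
  pose N := 2 * M / (cmod k * (s / 4) ^+ 2).
  have bd x y : `|x| <= s / 4 -> `|y| <= s / 4 ->
     (s / 4 <= `|x|) || (s / 4 <= `|y|) -> cmod (psi (Complex x y)) <= N.
    move=> xs ys xy; rewrite /psi cmodM cmodV /N.
    have ws : cmod (Complex x y) < s by apply: (le_lt_trans (cmod_le _)) => /=; lra.
    have sw : s / 4 <= cmod (Complex x y).
      by case/orP: xy => h; apply: (le_trans h); [exact: (Re_le_cmod (Complex x y))|
        exact: (Im_le_cmod (Complex x y))].
    apply: ler_pM; rewrite ?cmod_ge0 ?invr_ge0 ?cmod_ge0//.
      apply: (le_trans (cmodB _ _)); have := fM _ ws; have := fM 0; rewrite cmod0 => /(_ s0); lra.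
    rewrite lef_pV2 ?posrE ?mulr_gt0 ?exprn_gt0//.
      rewrite cmodM cmodX; apply: ler_wpM2l; first exact: cmod_ge0.
      by apply: lerXn2r => //; rewrite ?nnegrE ?cmod_ge0// ltW.
    by rewrite cmod_gt0 mulf_neq0// expf_neq0// -cmod_gt0 (lt_le_trans S0).
  have N1 : 2 * (2 * N) * (s / 4 - - (s / 4)) = 64 * M / (cmod k * s).
    by rewrite /N; field; rewrite !lt0r_neq0.
  rewrite /rectint (le_trans (cmodD _ _))// cmodM cmod_i mul1r.
  have l1 : cmod (cint (fun x => psi (Complex x (- (s / 4))) - psi (Complex x (s / 4)))
      (- (s / 4)) (s / 4)) <= 64 * M / (cmod k * s).
    rewrite -N1; apply: cint_le; [lra|by move=> x xt; apply: cu|].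
    move=> x /norm xt; apply: (le_trans (cmodB _ _)).
    by rewrite mulr_natl mulr2n lerD// bd// ?(nNt (s / 4))// ?(nt (s / 4))// ?lexx ?orbT//.
  have l2 : cmod (cint (fun y => psi (Complex (s / 4) y) - psi (Complex (- (s / 4)) y))
      (- (s / 4)) (s / 4)) <= 64 * M / (cmod k * s).
    rewrite -N1; apply: cint_le; [lra|by move=> x xt; apply: cv|].
    move=> x /norm xt; apply: (le_trans (cmodB _ _)).
    by rewrite mulr_natl mulr2n lerD// bd// ?(nNt (s / 4))// ?(nt (s / 4))// ?lexx ?orbT//.
  by rewrite mulr_natl mulr2n lerD.
have near (x y : R) : `|x| <= r -> `|y| <= r -> (r <= `|x|) || (r <= `|y|) ->
    cmod (psi (Complex x y) - (Complex x y)^-1) <= r^-1 / 4.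
  move=> xr yr xy.
  have wd : cmod (Complex x y) < d by apply: (le_lt_trans (cmod_le _)) => /=; lra.
  have rw : r <= cmod (Complex x y).
    by case/orP: xy => h; apply: (le_trans h); [exact: (Re_le_cmod (Complex x y))|
      exact: (Im_le_cmod (Complex x y))].
  have w0 : Complex x y != 0 by rewrite -cmod_gt0 (lt_le_trans r0).
  move: (Complex x y) wd rw w0 => w wd rw w0.
  have := dP w; rewrite subr0 => /(_ wd) le1.
  rewrite /psi (_ : _ - _ = (f w - f 0 - k * w) / (k * w ^+ 2)); last first.
    by field; rewrite w0 k0.
  have cw0 : 0 < cmod w by rewrite cmod_gt0.
  rewrite cmodM cmodV cmodM cmodX.
  apply: (@le_trans _ _ (cmod k / 4 * cmod w / (cmod k * cmod w ^+ 2))).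
    by rewrite ler_wpM2r// invr_ge0 mulr_ge0 ?exprn_ge0// ltW.
  rewrite (_ : _ / (_ * _) = (cmod w)^-1 / 4); last by field; rewrite !lt0r_neq0.
  by rewrite ler_wpM2r// lef_pV2.
(* The right-hand side is, for 1/w, the imaginary part of the difference between the lower and upper
   sides and the real part of that between the right and left sides. *)
have quad (x : R) : - r <= x <= r -> r^-1 <= 2 * r / (x ^+ 2 + r ^+ 2).
  move=> /norm xr; have x2 : x ^+ 2 <= r ^+ 2.
    by rewrite -[x ^+ 2]real_normK ?num_real// lerXn2r ?nnegrE// ltW.
  have q0 : 0 < x ^+ 2 + r ^+ 2 by rewrite ltr_wpDl ?sqr_ge0// exprn_gt0.
  rewrite ler_pdivlMr// mulrC ler_pdivrMr//.
  rewrite -mulrA -expr2; lra.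
have invE (x y : R) : (Complex x y)^-1 =
    Complex (x / (x ^+ 2 + y ^+ 2)) (- (y / (x ^+ 2 + y ^+ 2))) by [].
(* The imaginary part suffices. For either pair of sides the relevant part of the integrand is at
   least 1/r - 2/(4 r) = 1/(2 r), over a length 2 r; each pair gives 1. *)
have lower : 2 <= cmod (rectint psi (- r) r (- r) r).
  apply: le_trans (le_trans (ler_norm _) (Im_le_cmod _)).
  rewrite /rectint ImD.
  have -> : Im (ii * cint (fun y => psi (Complex r y) - psi (Complex (- r) y)) (- r) r) =
    Re (cint (fun y => psi (Complex r y) - psi (Complex (- r) y)) (- r) r).
    by rewrite /= mul0r mul1r add0r.
  have m1 : r^-1 / 2 * (r - - r) = 1 by field; exact: lt0r_neq0.
  rewrite (_ : 2 = 1 + 1 :> R)// -[X in X + _]m1 -[X in _ + X]m1 /=.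
  apply: lerD; apply: rint_ge; try lra.
  - by move=> x xr; apply: ccontIm; apply: cu.
  - move=> x xr; have xr' := norm _ _ xr; have q := quad _ xr.
    have := near x (- r) xr'; have := near x r xr'.
    rewrite (nt r)// (nNt r)// ?lexx orbT => /(_ isT isT) n1 /(_ isT isT) n2.
    have := le_trans (Im_le_cmod _) n1; have := le_trans (Im_le_cmod _) n2.
    rewrite !ImB !invE /= sqrrN opprK mulNr opprK !ler_norml.
    move: q; rewrite -mulrA; lra.
  - by move=> x xr; apply: ccontRe; apply: cv.
  - move=> x xr; have xr' := norm _ _ xr; have q := quad _ xr.
    have := near r x _ xr'; have := near (- r) x _ xr'.
    rewrite (nt r)// (nNt r)// ?lexx => /(_ isT isT) n1 /(_ isT isT) n2.
    have := le_trans (Re_le_cmod _) n1; have := le_trans (Re_le_cmod _) n2.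
    rewrite !ReB !invE /= sqrrN mulNr opprK !ler_norml [r ^+ 2 + _]addrC.
    move: q; rewrite -mulrA; lra.
have := le_trans lower; rewrite (square_const k s0 df r0 rs) => /(_ _ upper).
rewrite -[leLHS]mulr1 ler_pM2l// ler_pdivlMr ?mulr_gt0// mul1r => h.
by rewrite ler_pdivlMr.
Qed.

End CauchyEstimate.

(** * Mean value inequalities on [0, 1], and limits of sequences at speed 1/n *)

Section MeanValue.
Variable R : realType.
Local Notation C := R[i].
Implicit Types (f g : C -> C) (k l w : C).

(** The mean value theorem for [g x - B * x ^+ n.+1], whose derivative is nonpositive on [0, 1]. *)
Lemma real_mvt_pow (g dg : R -> R) (n : nat) (B : R) :
  (forall x : R, 0 <= x <= 1 -> forall e, 0 < e -> exists2 d : R, 0 < d &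
     forall y, `|y - x| < d -> `|g y - g x - dg x * (y - x)| <= e * `|y - x|) ->
  (forall x : R, 0 <= x <= 1 -> dg x <= B * n.+1%:R * x ^+ n) ->
  g 1 - g 0 <= B.
Proof.
move=> dgP dgB.
have der (x : R) : 0 <= x <= 1 -> is_derive x 1 g (dg x).
  move=> x01; suff cv : (fun h => h^-1 *: ((g \o shift x) (h *: 1) - g x)) @ 0^' --> dg x.
    by split; [apply/cvg_ex; exists (dg x)|exact: cvg_lim].
  apply/cvgrPdist_le => /= e e0; have [d d0 dP] := dgP x x01 e e0.
  apply/nbhs_normP; exists d => //= h; rewrite /ball_ /= sub0r normrN => hd h0.
  have := dP (h + x); rewrite addrK => /(_ hd) le.
  rewrite /GRing.scale /= mulr1 distrC.
  have -> : h^-1 * (g (h + x) - g x) - dg x = h^-1 * (g (h + x) - g x - dg x * h).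
    by field.
  by rewrite normrM normfV ler_pdivrMl ?normr_gt0// (mulrC `|h|).
pose v (x : R) := g x - B * x ^+ n.+1.
have derv (x : R) : 0 <= x <= 1 -> is_derive x 1 v (dg x - B * n.+1%:R * x ^+ n).
  move=> /der dx; rewrite /v.
  have -> : (fun x0 => g x0 - B * x0 ^+ n.+1) = g - (B \*: (@id R ^+ n.+1)).
    by apply/funext => y /=; rewrite !fctE.
  apply: is_derive_eq.
  by rewrite /GRing.scale /= mulr1 -mulr_natl mulrA.
have [||c c01] := @MVT R v (fun x => dg x - B * n.+1%:R * x ^+ n) 0 1 ltr01.
- by move=> x; rewrite in_itv /= => /andP[x0 x1]; apply: derv; rewrite !ltW.
- apply: derivable_within_continuous => x; rewrite in_itv /= => x01.
  by case: (derv _ x01).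
move: c01; rewrite in_itv/= => /andP[c0 c1].
have le := dgB c; have {}le := le (introT andP (conj (ltW c0) (ltW c1))).
by rewrite /v expr1n expr0n /= mulr0 mulr1 !subr0 => h; lra.
Qed.

Lemma cdiff_Re f (c : R) x k : cdiff f x%:C%C k -> forall e, 0 < e -> exists2 d : R, 0 < d &
  forall y, `|y - x| < d ->
   `|c * Re (f y%:C%C) - c * Re (f x%:C%C) - c * Re k * (y - x)| <= e * `|y - x|.
Proof.
move=> df e e0; have c0 : 0 < 1 + `|c| by rewrite ltr_pwDl.
have [d d0 dP] := df (e / (1 + `|c|)) (divr_gt0 e0 c0).
exists d => // y yx; have := dP y%:C%C; rewrite -rmorphB cmod_real => /(_ yx) le.
rewrite (_ : _ - _ = c * Re (f y%:C%C - f x%:C%C - k * (y - x)%:C%C)); last first.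
  by rewrite !ReB; case: (k) => k1 k2 /=; ring.
rewrite normrM.
apply: (@le_trans _ _ (`|c| * (e / (1 + `|c|) * `|y - x|))).
  by rewrite ler_wpM2l// (le_trans (Re_le_cmod _)).
rewrite mulrA ler_wpM2r// mulrCA ler_piMr ?(ltW e0)//.
by rewrite ler_pdivrMr// mul1r lerDr.
Qed.

(* The weight x^n is what makes n-fold integration produce a factor 1/n! below. *)
Lemma mvi_pow f n (B : R) :
  (forall x : R, 0 <= x <= 1 ->
     exists2 k, cdiff f x%:C%C k & cmod k <= B * n.+1%:R * x ^+ n) ->
  cmod (f 1 - f 0) <= 2 * B.
Proof.
move=> H.
(* Rotation by c = 1, -1, i, -i reduces the bounds on Re and Im, from both sides, to the real
   inequality. *)
have key (c : C) : cmod c = 1 -> Re (c * (f 1 - f 0)) <= B.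
  move=> c1; pose g := fun w => c * f w.
  have {}H (x : R) : exists k, 0 <= x <= 1 -> cdiff g x%:C%C k /\ cmod k <= B * n.+1%:R * x ^+ n.
    have [x01|] := boolP (0 <= x <= 1); last by exists 0.
    have [k dk kB] := H x x01; exists (c * k) => _; split; last by rewrite cmodM c1 mul1r.
    move=> e e0; have [d d0 dP] := dk e e0; exists d => // w /dP.
    rewrite (_ : g w - _ - _ = c * (f w - f x%:C%C - k * (w - x%:C%C))).
      by rewrite cmodM c1 mul1r.
    by rewrite /g; ring.
  have [dg dgP] := choice H.
  have := @real_mvt_pow (fun x => 1 * Re (g x%:C%C)) (fun x => 1 * Re (dg x)) n B.
  rewrite !mul1r /g rmorph1 rmorph0 mulrBr ReB; apply.
    move=> x /dgP[/cdiff_Re h _]; exact: h.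
  move=> x /dgP[_]; apply: le_trans; rewrite mul1r.
  by apply: le_trans (Re_le_cmod _); exact: ler_norm.
rewrite (le_trans (cmod_le _))// mulr_natl mulr2n lerD//.
  rewrite ler_norml; apply/andP; split.
    have := key (-1); rewrite cmodN cmod1 => /(_ erefl).
    by rewrite mulN1r; case: (_ - _) => a b /=; lra.
  by have := key 1; rewrite cmod1 mul1r => /(_ erefl).
rewrite ler_norml; apply/andP; split.
  have := key (Complex 0 1); rewrite cmod_i => /(_ erefl).
  by case: (_ - _) => a b /=; lra.
have := key (- Complex 0 1); rewrite cmodN cmod_i => /(_ erefl).
by case: (_ - _) => a b /=; lra.
Qed.

Lemma mvi f (B : R) :
  (forall x : R, 0 <= x <= 1 -> exists2 k, cdiff f x%:C%C k & cmod k <= B) ->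
  cmod (f 1 - f 0) <= 2 * B.
Proof.
move=> H; apply: (@mvi_pow f 0 B) => x /H[k dk kB]; exists k => //.
by rewrite expr0 !mulr1.
Qed.

(** Every [u n - A / n.+1%:R] lies below every [u p + A / p.+1%:R]; the supremum of the former is
    the limit, and the rate comes with it. *)
Lemma real_harmonic_cauchy (u : nat -> R) (A : R) :
  (forall n p, `|u n - u p| <= A * (n.+1%:R^-1 + p.+1%:R^-1)) ->
  exists l : R, forall n, `|u n - l| <= A / n.+1%:R.
Proof.
move=> uA; pose S := range (fun n => u n - A / n.+1%:R).
have ub p : ubound S (u p + A / p.+1%:R).
  move=> _ [n _ <-]; have := uA n p; rewrite ler_norml mulrDr => /andP[_] ; move: (A / _) (A / _) => a b; lra.
exists (sup S) => n; have := ub n; move uE : (A / _) => a ubn.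
rewrite ler_norml; apply/andP; split.
  have : sup S <= u n + a; last by lra.
  apply: ge_sup => //.
  by exists (u 0%N - A / 1%:R); exists 0%N.
have : u n - a <= sup S; last by lra.
apply: ub_le_sup; last by exists n => //; rewrite uE.
by exists (u n + a).
Qed.

Lemma harmonic_cauchy (u : nat -> C) (A : R) :
  (forall n p, cmod (u n - u p) <= A * (n.+1%:R^-1 + p.+1%:R^-1)) ->
  exists l, forall n, cmod (u n - l) <= 2 * A / n.+1%:R.
Proof.
move=> uA.
have [|a aP] := @real_harmonic_cauchy (fun n => Re (u n)) A.
  by move=> n p; rewrite -ReB (le_trans (Re_le_cmod _)).
have [|b bP] := @real_harmonic_cauchy (fun n => Im (u n)) A.
  by move=> n p; rewrite -ImB (le_trans (Im_le_cmod _)).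
exists (Complex a b) => n; rewrite (le_trans (cmod_le _))// ReB ImB /=.
by rewrite -mulrA mulr_natl mulr2n lerD.
Qed.

End MeanValue.

(** * Holomorphic functions of several variables *)

Section Several.
Variables (R : realType) (m : nat).
Local Notation C := (CC R).
Local Notation pt := (pt R m).
Local Notation fn := (fn R m).
Implicit Types (f g : fn) (a z h : pt) (l : 'I_m -> C) (U : set pt).

(* Complex differentiability at a with gradient l, for the norm max_j |h_j| on C^m;
   t stands for an upper bound of that norm, which avoids a maximum over 'I_m. *)
Definition hdiff f a l := forall e : R, 0 < e -> exists2 d : R, 0 < d &
  forall h (t : R), (forall j, cmod (h 0 j) <= t) -> 0 <= t -> t < d ->
    cmod (f (a + h) - f a - \sum_j l j * h 0 j) <= e * t.

Definition pdisc a (r : R) : set pt := [set z | forall j, cmod (z 0 j - a 0 j) < r].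

Definition holo U f := forall a, U a -> exists l, hdiff f a l.

Definition dirD f z h : C := \sum_j pderiv j f z * h 0 j.

Lemma coord_le_norm h j : (cmod (h 0 j))%:C%C <= `|h| :> C.
Proof.
rewrite -cmodE real_leNgt ?normr_real//; apply/negP => lt.
have : ball_ [eta Num.norm] 0 `|h 0 j| h by rewrite /ball_ /= sub0r normrN.
rewrite -mx_norm_ball => -[_ /(_ 0 j)].
by rewrite -ball_normE /ball_ /= mxE sub0r normrN ltxx.
Qed.

Lemma norm_le_coord h (t : R) : 0 <= t -> (forall j, cmod (h 0 j) <= t) ->
  `|h| <= t%:C%C :> C.
Proof.
move=> t0 ht; have [h0|] := eqVneq `|h| 0; first by rewrite h0 ler0c.
move=> /mx_norm_neq0[[i j]] /=; rewrite (ord1 i) => hE.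
rewrite (_ : `|h| = `|h 0 j|); last exact: hE.
by rewrite cmodE lecR; exact: ht.
Qed.

Lemma differentiable_hdiff f a : differentiable f a ->
  hdiff f a (fun j => pderiv j f a).
Proof.
move=> df; have [_ /eqaddoP dE] := (diff_locallyP a f).1 df.
move=> e e0.
have eC : 0 < e%:C%C :> C by rewrite ltcR.
have : \forall h \near (0 : pt), `|f (h + a) - (f a + 'd f a h)| <= e%:C%C * `|h|.
  exact: dE.
move=> /nbhs_normP[_ /complex_gt0P[d d0 ->] dP]; exists d => //.
move=> h t ht t0 td; have nh := norm_le_coord t0 ht.
have := dP h; rewrite /= sub0r normrN.
move=> /(_ _)/wrap[|].
  by apply: (le_lt_trans nh); rewrite ltcR.
have -> : 'd f a h = \sum_j pderiv j f a * h 0 j.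
  rewrite [in LHS](row_sum_delta h) linear_sum; apply: eq_bigr => j _.
  by rewrite linearZ /pderiv deriveE// mulrC.
rewrite opprD addrA (addrC h) => le.
rewrite -lecR -cmodE (le_trans le)// rmorphM ler_wpM2l//.
exact: ltW.
Qed.

Lemma hdiff_pderiv f a l j : hdiff f a l -> pderiv j f a = l j.
Proof.
move=> fl; rewrite /pderiv /derive; apply: cvg_lim => //.
apply/cvgrPdist_le => /= _ /complex_gt0P[e e0 ->].
have [d d0 dP] := fl _ e0.
apply/nbhs_normP; exists d%:C%C => /=; first by rewrite ltcR.
move=> w /=; rewrite sub0r normrN cmodE ltcR => wd w0.
have := dP (w *: delta_mx 0 j) (cmod w).
move=> /(_ _ (cmod_ge0 _) wd)/wrap[|].
  move=> i; rewrite !mxE eqxx /=; case: (i == j); rewrite ?mulr1// mulr0 cmod0.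
  exact: cmod_ge0.
rewrite (bigD1 j)//= big1 ?addr0; last first.
  by move=> i ij; rewrite !mxE eqxx /= (negbTE ij) !mulr0.
rewrite !mxE !eqxx mulr1 => le.
rewrite distrC (addrC _ a).
have -> : w^-1 *: (f (a + w *: delta_mx 0 j) - f a) - l j =
   w^-1 * (f (a + w *: delta_mx 0 j) - f a - l j * w).
  by rewrite /GRing.scale /=; field.
rewrite cmodE lecR cmodM cmodV ler_pdivrMl ?cmod_gt0//.
by rewrite (mulrC (cmod w)).
Qed.

End Several.

(** * Rules of differentiation in several variables, and estimates along complex lines *)

Section HoloCalculus.
Variables (R : realType) (m : nat).
Local Notation C := (CC R).
Local Notation pt := (pt R m).
Local Notation fn := (fn R m).
Implicit Types (f g : fn) (a z h : pt) (l : 'I_m -> C) (U : set pt).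

Lemma pdisc_center a (r : R) : 0 < r -> pdisc a r a.
Proof. by move=> r0 j; rewrite subrr cmod0. Qed.

Lemma pdisc_sub a z (r s : R) : pdisc a r z -> pdisc z s `<=` pdisc a (r + s).
Proof.
move=> az y zy j; rewrite -(subrK (z 0 j) (y 0 j)) -addrA.
by rewrite (le_lt_trans (cmodD _ _))// [r + s]addrC ltrD//.
Qed.

Lemma pdisc_le a (r s : R) : r <= s -> pdisc a r `<=` pdisc a s.
Proof. by move=> rs z az j; exact: lt_le_trans (az j) rs. Qed.

Lemma pdiscD a h (t r : R) : (forall j, cmod (h 0 j) <= t) -> t < r -> pdisc a r (a + h).
Proof. by move=> ht tr j; rewrite mxE addrAC subrr add0r (le_lt_trans (ht j)). Qed.

Lemma hdiff_ext f g a l (r : R) : 0 < r -> (forall z, pdisc a r z -> f z = g z) ->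
  hdiff f a l -> hdiff g a l.
Proof.
move=> r0 fg fl e e0; have [d d0 dP] := fl e e0.
exists (Num.min d r); first by rewrite lt_min d0.
move=> h t ht t0; rewrite lt_min => /andP[td tr].
rewrite -fg; last by apply: pdiscD ht tr.
by rewrite -(fg a) ?dP//; exact: pdisc_center.
Qed.

Lemma hdiff_cst (c : C) a : hdiff (fun=> c) a (fun=> 0).
Proof.
move=> e e0; exists 1 => // h t _ t0 _.
rewrite subrr big1 ?subr0 ?cmod0 ?mulr_ge0// ?(ltW e0)// => j _.
by rewrite mul0r.
Qed.

Lemma hdiff_coord j a : hdiff (fun z => z 0 j) a (fun i => (i == j)%:R).
Proof.
move=> e e0; exists 1 => // h t _ t0 _.
rewrite (bigD1 j)//= eqxx mul1r big1; last by move=> i /negbTE ->; rewrite mul0r.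
by rewrite mxE addr0 (addrC (a 0 j)) addrK subrr cmod0 mulr_ge0// ltW.
Qed.

Lemma hdiffD f g a l l' : hdiff f a l -> hdiff g a l' ->
  hdiff (fun z => f z + g z) a (fun j => l j + l' j).
Proof.
move=> fl gl e e0; have e20 : 0 < e / 2 by rewrite divr_gt0.
have [d d0 dP] := fl _ e20; have [d' d'0 d'P] := gl _ e20.
exists (Num.min d d'); first by rewrite lt_min d0.
move=> h t ht t0; rewrite lt_min => /andP[td td'].
have le1 := dP h t ht t0 td; have le2 := d'P h t ht t0 td'.
rewrite (_ : _ - _ = (f (a + h) - f a - \sum_j l j * h 0 j) +
    (g (a + h) - g a - \sum_j l' j * h 0 j)).
  by rewrite (le_trans (cmodD _ _))//; lra.
under eq_bigr do rewrite mulrDl.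
by rewrite big_split /=; ring.
Qed.

Lemma hdiff_lip f a l : hdiff f a l -> exists2 K : R, 0 < K & exists2 d : R, 0 < d &
  forall h (t : R), (forall j, cmod (h 0 j) <= t) -> 0 <= t -> t < d ->
    cmod (f (a + h) - f a) <= K * t.
Proof.
move=> fl; have [d d0 dP] := fl 1 ltr01.
exists (1 + \sum_j cmod (l j)).
  by rewrite ltr_pwDl// sumr_ge0// => j _; exact: cmod_ge0.
exists d => // h t ht t0 td.
rewrite -(subrK (\sum_j l j * h 0 j) (f (a + h) - f a)) (le_trans (cmodD _ _))//.
rewrite mulrDl lerD ?dP// (le_trans (cmod_sum _ _ _))// mulr_suml ler_sum// => j _.
by rewrite cmodM ler_wpM2l// cmod_ge0.
Qed.

Lemma hdiffM f g a l l' : hdiff f a l -> hdiff g a l' ->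
  hdiff (fun z => f z * g z) a (fun j => l j * g a + f a * l' j).
Proof.
move=> fl gl e e0.
have [Kg Kg0 [dg dg0 dgP]] := hdiff_lip gl.
have [Kf Kf0 [df df0 dfP]] := hdiff_lip fl.
pose D := 1 + cmod (g a) + cmod (f a).
have ga0 := cmod_ge0 (g a); have fa0 := cmod_ge0 (f a).
have D0 : 0 < D by rewrite /D; lra.
have e30 : 0 < e / (3 * D) by rewrite divr_gt0// mulr_gt0.
have [d1 d10 d1P] := fl _ e30.
have [d2 d20 d2P] := gl _ e30.
have KK0 : 0 < Kf * Kg by rewrite mulr_gt0.
exists (Num.min (Num.min d1 d2) (Num.min (Num.min df dg) (e / (3 * (Kf * Kg))))).
  by rewrite !lt_min d10 d20 df0 dg0 divr_gt0// mulr_gt0.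
move=> h t ht t0; rewrite !lt_min => /andP[/andP[td1 td2] /andP[/andP[tdf tdg] te]].
have le1 := d1P h t ht t0 td1; have le2 := d2P h t ht t0 td2.
have le3 := dfP h t ht t0 tdf; have le4 := dgP h t ht t0 tdg.
rewrite (_ : _ - _ = (f (a + h) - f a - \sum_j l j * h 0 j) * g a +
    f a * (g (a + h) - g a - \sum_j l' j * h 0 j) +
    (f (a + h) - f a) * (g (a + h) - g a)); last first.
  have -> : \sum_j (l j * g a + f a * l' j) * h 0 j =
      (\sum_j l j * h 0 j) * g a + f a * (\sum_j l' j * h 0 j).
    by rewrite mulr_suml mulr_sumr -big_split; apply: eq_bigr => j _ /=; ring.
  ring.
have t1 : cmod ((f (a + h) - f a - \sum_j l j * h 0 j) * g a) <= e / 3 * t.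
  rewrite cmodM; have gD : cmod (g a) <= D by rewrite /D; lra.
  rewrite (le_trans (ler_pM _ _ le1 gD)) ?cmod_ge0//.
  by rewrite [X in X <= _](_ : _ = e / 3 * t)//; field; exact: lt0r_neq0.
have t2 : cmod (f a * (g (a + h) - g a - \sum_j l' j * h 0 j)) <= e / 3 * t.
  rewrite cmodM; have fD : cmod (f a) <= D by rewrite /D; lra.
  rewrite (le_trans (ler_pM _ _ fD le2)) ?cmod_ge0//.
  by rewrite [X in X <= _](_ : _ = e / 3 * t)//; field; exact: lt0r_neq0.
have t3 : cmod ((f (a + h) - f a) * (g (a + h) - g a)) <= e / 3 * t.
  rewrite cmodM (le_trans (ler_pM _ _ le3 le4)) ?cmod_ge0//.
  rewrite (_ : Kf * t * (Kg * t) = Kf * Kg * t * t); last by ring.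
  rewrite ler_wpM2r// -ler_pdivlMl// (le_trans (ltW te))//.
  by rewrite [X in X <= _](_ : _ = (Kf * Kg)^-1 * (e / 3))//; field; rewrite !lt0r_neq0.
rewrite (le_trans (cmodD _ _))//.
have := cmodD ((f (a + h) - f a - \sum_j l j * h 0 j) * g a)
    (f a * (g (a + h) - g a - \sum_j l' j * h 0 j)).
by lra.
Qed.

Lemma hdiffZ (c : C) f a l : hdiff f a l -> hdiff (fun z => c * f z) a (fun j => c * l j).
Proof.
move=> fl; have := hdiffM (hdiff_cst c a) fl; congr hdiff.
by apply/funext => j; rewrite mul0r add0r.
Qed.

Lemma hdiff_shift f a b l : hdiff f (a + b) l -> hdiff (fun z => f (z + b)) a l.
Proof.
move=> fl e e0; have [d d0 dP] := fl e e0; exists d => // h t ht t0 td.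
by rewrite (addrAC a) dP.
Qed.

Lemma hdiff_tmul f a l zeta : torus zeta -> hdiff f (tmul zeta a) l ->
  hdiff (fun z => f (tmul zeta z)) a (fun j => zeta 0 j * l j).
Proof.
move=> zT fl e e0; have [d d0 dP] := fl e e0; exists d => // h t ht t0 td.
have := dP (tmul zeta h) t _ t0 td.
have -> : tmul zeta a + tmul zeta h = tmul zeta (a + h).
  by apply/rowP => j; rewrite !mxE mulrDr.
rewrite (_ : \sum_j l j * _ = \sum_j zeta 0 j * l j * h 0 j).
  apply => j; rewrite mxE cmodM (_ : cmod (zeta 0 j) = 1) ?mul1r//.
  by apply: complexI; rewrite -cmodE zT.
by apply: eq_bigr => j _; rewrite mxE mulrCA mulrA.
Qed.

Lemma hdiff_line f a h (w : C) l : hdiff f (a + w *: h) l ->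
  cdiff (fun v : R[i] => f (a + (v : C) *: h)) w (\sum_j l j * h 0 j).
Proof.
move=> fl.
(* N bounds all |h_j|; the summand 1 keeps it positive when h = 0. *)
pose N : R := 1 + \sum_j cmod (h 0 j).
have N0 : 0 < N by rewrite ltr_pwDl// sumr_ge0// => j _; exact: cmod_ge0.
have hN j : cmod (h 0 j) <= N.
  rewrite /N (bigD1 j)//= addrCA lerDl addr_ge0// sumr_ge0// => i _.
  exact: cmod_ge0.
move=> e e0; have [d d0 dP] := fl (e / N) (divr_gt0 e0 N0).
exists (d / N); first by rewrite divr_gt0.
move=> v; rewrite ltr_pdivlMr// => vd.
have := dP ((v - w : C) *: h) (cmod (v - w) * N) _ _ vd.
rewrite -(addrA a) -scalerDl (addrC w) subrK.
rewrite (_ : \sum_j l j * ((v - w : C) *: h) 0 j = (\sum_j l j * h 0 j) * (v - w)).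
  move=> /(_ _ _)/le_trans; apply.
  - by move=> j; rewrite mxE cmodM ler_wpM2l// cmod_ge0.
  - by rewrite mulr_ge0 ?cmod_ge0// ltW.
  - by rewrite [X in X <= _](_ : _ = e * cmod (v - w))//; field; exact: lt0r_neq0.
by rewrite mulr_suml; apply: eq_bigr => j _; rewrite mxE mulrCA mulrC.
Qed.

Lemma holo_hdiff U f z : holo U f -> U z -> hdiff f z (fun j => pderiv j f z).
Proof.
move=> fU /fU[l fl]; have := fl; congr hdiff.
by apply/funext => j; rewrite (hdiff_pderiv j fl).
Qed.

Lemma holo_sub U V f : U `<=` V -> holo V f -> holo U f.
Proof. by move=> UV fV z /UV /fV. Qed.

Lemma holo_cst (c : C) U : holo U (fun=> c).
Proof. by move=> a _; exists (fun=> 0); exact: hdiff_cst. Qed.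

Lemma holoD U f g : holo U f -> holo U g -> holo U (fun z => f z + g z).
Proof.
move=> fU gU z Uz; have [l fl] := fU z Uz; have [l' gl] := gU z Uz.
by exists (fun j => l j + l' j); exact: hdiffD.
Qed.

Lemma holoZ U (c : C) f : holo U f -> holo U (fun z => c * f z).
Proof.
move=> fU z Uz; have [l fl] := fU z Uz.
by exists (fun j => c * l j); exact: hdiffZ.
Qed.

Lemma holoM U f g : holo U f -> holo U g -> holo U (fun z => f z * g z).
Proof.
move=> fU gU z Uz; have [l fl] := fU z Uz; have [l' gl] := gU z Uz.
by eexists; exact: hdiffM fl gl.
Qed.

(** Cauchy's estimate on the complex line through [a] in direction [h], of which the disc of radius
    s/t stays in the polydisc. *)
Lemma dirD_le f a h (s t M : R) : 0 < s -> 0 < t -> holo (pdisc a s) f ->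
  (forall z, pdisc a s z -> cmod (f z) <= M) ->
  (forall j, cmod (h 0 j) <= t) -> cmod (dirD f a h) <= 64 * M * t / s.
Proof.
move=> s0 t0 fU fM ht; have st0 : 0 < s / t by rewrite divr_gt0.
have inU (w : C) : cmod w < s / t -> pdisc a s (a + w *: h).
  rewrite ltr_pdivlMr// => wt; apply: pdiscD wt => j.
  by rewrite mxE cmodM ler_wpM2l// cmod_ge0.
rewrite (_ : 64 * M * t / s = 64 * M / (s / t)); last by field; rewrite !lt0r_neq0.
apply: (@cauchy_estimate _ (fun v : R[i] => f (a + (v : C) *: h))) => //.
- move=> w /inU/fU[l fl]; exists (\sum_j l j * h 0 j); exact: hdiff_line.
- by move=> w /inU/fM.
- have H0 : hdiff f (a + (0 : C) *: h) (fun j => pderiv j f a).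
    by rewrite scale0r addr0; exact: (holo_hdiff fU (pdisc_center a s0)).
  exact: (hdiff_line H0).
Qed.

Lemma cmod_delta (i j : 'I_m) : cmod ((delta_mx 0 j : pt) 0 i) <= 1.
Proof. by rewrite !mxE eqxx /=; case: (i == j); rewrite ?cmod1 ?cmod0. Qed.

Lemma sum_delta (l : 'I_m -> C) j : \sum_i l i * (delta_mx 0 j : pt) 0 i = l j.
Proof.
rewrite (bigD1 j)//= big1 ?addr0; first by rewrite mxE !eqxx mulr1.
by move=> i ij; rewrite !mxE eqxx (negbTE ij) /= !mulr0.
Qed.

Lemma pderiv_le j f a (s M : R) : 0 < s -> holo (pdisc a s) f ->
  (forall z, pdisc a s z -> cmod (f z) <= M) -> cmod (pderiv j f a) <= 64 * M / s.
Proof.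
move=> s0 fU fM; have := dirD_le s0 ltr01 fU fM (fun i => cmod_delta i j).
by rewrite mulr1 /dirD sum_delta.
Qed.

Lemma segment_le f a h (B : R) :
  (forall x : R, 0 <= x <= 1 -> exists2 l, hdiff f (a + x%:C%C *: h) l &
     cmod (\sum_j l j * h 0 j) <= B) ->
  cmod (f (a + h) - f a) <= 2 * B.
Proof.
move=> H; have := @mvi _ (fun v : R[i] => f (a + (v : C) *: h)) B.
rewrite scale1r scale0r addr0; apply => x /H[l fl lB].
by exists (\sum_j l j * h 0 j) => //; exact: hdiff_line.
Qed.

End HoloCalculus.

(** * Partial derivatives of holomorphic functions are holomorphic *)

Section SecondOrder.
Variables (R : realType) (m : nat).
Local Notation C := (CC R).
Local Notation pt := (pt R m).
Local Notation fn := (fn R m).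
Implicit Types (f g : fn) (a z h : pt) (l : 'I_m -> C) (U : set pt).

Lemma pdiscDr a z h (r t : R) : pdisc a r z -> (forall j, cmod (h 0 j) <= t) ->
  pdisc a (r + t) (z + h).
Proof.
move=> az ht j; rewrite mxE addrAC (le_lt_trans (cmodD _ _))//.
by rewrite ltr_leD//; exact: az.
Qed.

Lemma hdiffB f g a l l' : hdiff f a l -> hdiff g a l' ->
  hdiff (fun z => f z - g z) a (fun j => l j - l' j).
Proof.
move=> fl gl; have := hdiffD fl (hdiffZ (-1) gl).
rewrite (_ : (fun z => _) = (fun z => f z - g z)).
  by congr hdiff; apply/funext => j; rewrite mulN1r.
by apply/funext => z; rewrite mulN1r.
Qed.

Lemma holoB U f g : holo U f -> holo U g -> holo U (fun z => f z - g z).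
Proof.
move=> fU gU z Uz; have [l fl] := fU z Uz; have [l' gl] := gU z Uz.
by exists (fun j => l j - l' j); exact: hdiffB.
Qed.

Lemma hdiff_lin (c : 'I_m -> C) a : hdiff (fun z => \sum_j c j * z 0 j) a c.
Proof.
move=> e e0; exists 1 => // h t _ t0 _.
rewrite (_ : _ - _ = 0) ?cmod0 ?mulr_ge0// ?(ltW e0)//.
under eq_bigr do rewrite mxE mulrDr.
by rewrite big_split /=; ring.
Qed.

Lemma hdiff_pos f a l : (forall e : R, 0 < e -> exists2 d : R, 0 < d &
  forall h (t : R), (forall j, cmod (h 0 j) <= t) -> 0 < t -> t < d ->
    cmod (f (a + h) - f a - \sum_j l j * h 0 j) <= e * t) -> hdiff f a l.
Proof.
move=> H e e0; have [d d0 dP] := H e e0; exists d => // h t ht.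
rewrite le_eqVlt => /predU1P[t0|]; last exact: dP.
have h0 j : h 0 j = 0.
  by apply/eqP; rewrite -cmod_eq0 eq_le cmod_ge0 t0 ht.
move=> _; rewrite (_ : h = 0); last by apply/rowP => j; rewrite h0 mxE.
rewrite addr0 subrr big1 ?subr0 ?cmod0 -?t0 ?mulr0// => j _.
by rewrite mxE mulr0.
Qed.

Lemma dirD_hdiff f a h l : hdiff f a l -> dirD f a h = \sum_j l j * h 0 j.
Proof. by move=> fl; apply: eq_bigr => j _; rewrite (hdiff_pderiv j fl). Qed.

Lemma bound_ge0 f a (s M : R) : 0 < s ->
  (forall z, pdisc a s z -> cmod (f z) <= M) -> 0 <= M.
Proof. by move=> s0 fM; apply: le_trans (fM a (pdisc_center a s0)); exact: cmod_ge0. Qed.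

(** Two Cauchy estimates give 64 each, taken on radii s/4 and s/2 (factors 4 and 2), and two mean
    value inequalities give 2 each. *)
Let K : R := 64 * 64 * 32.

(** Second derivatives are not yet available. With g equal to f minus its linear part at a, the
    derivative of g at a + x h along h equals that of F z = f(z + x h) - f z at a. F is O(t) by the
    mean value inequality, so Cauchy's estimate for F makes this derivative O(t^2), and integration
    along the segment concludes. *)
Lemma second_order f a h (s t M : R) : 0 < s -> 0 < t -> t <= s / 4 ->
  holo (pdisc a s) f -> (forall z, pdisc a s z -> cmod (f z) <= M) ->
  (forall j, cmod (h 0 j) <= t) ->
  cmod (f (a + h) - f a - dirD f a h) <= K * M * t ^+ 2 / s ^+ 2.
Proof.
move=> s0 t0 ts fU fM ht; have M0 := bound_ge0 s0 fM.
pose c j : C := pderiv j f a.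
pose g : fn := fun z => f z - \sum_j c j * z 0 j.
have hx (x : R) : 0 <= x <= 1 -> forall j, cmod ((x%:C%C *: h : pt) 0 j) <= t.
  move=> /andP[x0 x1] j; rewrite mxE cmodM cmod_real ger0_norm//.
  by rewrite (le_trans _ (ht j))// ler_piMl// cmod_ge0.
have ax (x : R) : 0 <= x <= 1 -> pdisc a s (a + x%:C%C *: h).
  by move=> x01; apply: pdiscD (hx x x01) _; lra.
have := @segment_le _ _ g a h (64 * 64 * 16 * M * t ^+ 2 / s ^+ 2).
have -> : g (a + h) - g a = f (a + h) - f a - dirD f a h.
  rewrite /g /dirD; under eq_bigr do rewrite mxE mulrDr.
  by rewrite big_split /=; ring.
have -> : K * M * t ^+ 2 / s ^+ 2 = 2 * (64 * 64 * 16 * M * t ^+ 2 / s ^+ 2).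
  by rewrite /K; field; exact: lt0r_neq0.
apply => x x01.
exists (fun j => pderiv j f (a + x%:C%C *: h) - c j).
  by apply: hdiffB; [exact: holo_hdiff fU (ax x x01)|exact: hdiff_lin].
pose F : fn := fun z => f (z + x%:C%C *: h) - f z.
have s40 : 0 < s / 4 by rewrite divr_gt0.
have sub z (r : R) : pdisc a (s / 2) z -> r <= s / 2 -> pdisc z r `<=` pdisc a s.
  move=> az rs; apply: subset_trans (pdisc_sub az) _; apply: pdisc_le; lra.
have Fl z : pdisc a (s / 2) z -> hdiff F z (fun j => pderiv j f (z + x%:C%C *: h) - pderiv j f z).
  move=> az; apply: hdiffB.
    apply: hdiff_shift; apply: (holo_hdiff fU); apply: (sub z (s / 2)) => //.
    by apply: pdiscD (hx _ x01) _; lra.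
  apply: (holo_hdiff fU); apply: (sub z (s / 2)) => //.
  by apply: pdisc_center; lra.
have FU : holo (pdisc a (s / 2)) F by move=> z /Fl; exists (fun j => pderiv j f (z + x%:C%C *: h) - pderiv j f z).
have FM z : pdisc a (s / 2) z -> cmod (F z) <= 2 * (64 * M * t / (s / 4)).
  move=> az; apply: segment_le => y y01.
  have xh j : cmod ((y%:C%C *: (x%:C%C *: h) : pt) 0 j) <= t.
    move/andP: y01 => [y0 y1]; rewrite mxE cmodM cmod_real ger0_norm//.
    by rewrite (le_trans _ (hx x x01 j))// ler_piMl// cmod_ge0.
  have inD : pdisc z (s / 2) (z + y%:C%C *: (x%:C%C *: h)) by apply: pdiscD xh _; lra.
  have inD' : pdisc a (s - s / 4) (z + y%:C%C *: (x%:C%C *: h)).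
    by apply: pdisc_le (pdiscDr az xh); lra.
  have inS : pdisc (z + y%:C%C *: (x%:C%C *: h)) (s / 4) `<=` pdisc a s.
    by apply: subset_trans (pdisc_sub inD') _; apply: pdisc_le; lra.
  exists (fun j => pderiv j f (z + y%:C%C *: (x%:C%C *: h))).
    by apply: (holo_hdiff fU); apply: inS; exact: pdisc_center.
  apply: dirD_le => //.
  - exact: holo_sub fU.
  - by move=> w /inS/fM.
  - exact: hx.
have s20 : 0 < s / 2 by rewrite divr_gt0.
have := dirD_le s20 t0 FU FM ht.
rewrite (dirD_hdiff _ (Fl a (pdisc_center a s20))).
rewrite [X in _ <= X](_ : _ = 64 * 64 * 16 * M * t ^+ 2 / s ^+ 2)//.
by field; exact: lt0r_neq0.
Qed.

Lemma le_harmonic (x y D : R) : (forall n : nat, x <= y + D / n.+1%:R) -> x <= y.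
Proof.
move=> H; rewrite leNgt; apply/negP => yx.
have D0 : 0 < D.
  rewrite ltNge; apply/negP => D0; have := H 0%N; rewrite divr1; lra.
have xy0 : 0 < x - y by lra.
have := H (Num.truncn (D / (x - y))); rewrite leNgt => /negP; apply.
rewrite -ltrBrDl ltr_pdivrMr ?ltr0n// mulrC -ltr_pdivrMr//.
exact: truncnS_gt.
Qed.

(* pderiv j f is the uniform limit, at speed 1/n, of the difference quotients of f in
   direction j; by Cauchy's estimate their gradients converge at the same speed, and the
   second-order bound passes to the limit. *)
Lemma pderiv_hdiff j f a (s M : R) : 0 < s -> holo (pdisc a s) f ->
  (forall z, pdisc a s z -> cmod (f z) <= M) -> exists l, hdiff (pderiv j f) a l.
Proof.
move=> s0 fU fM; have M0 := bound_ge0 s0 fM.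
have s20 : 0 < s / 2 by rewrite divr_gt0.
pose g := pderiv j f.
(* [second_order] on radius s/2 accepts increments up to s/8. *)
pose ep (n : nat) : R := s / 8 / n.+1%:R.
have ep0 n : 0 < ep n by rewrite !divr_gt0.
have eps n : ep n <= s / 8.
  by rewrite /ep ler_pdivrMr// ler_peMr ?divr_ge0 ?(ltW s0)// ler1n.
pose ej n : pt := (ep n)%:C%C *: delta_mx 0 j.
have ejn n i : cmod ((ej n : pt) 0 i) <= ep n.
  rewrite !mxE eqxx /= cmodM cmod_real gtr0_norm//.
  by case: (i == j); rewrite /= ?cmod1 ?mulr1// cmod0 mulr0 ltW.
pose q n : fn := fun z => (ep n)^-1%:C%C * (f (z + ej n) - f z).
pose A := K * M / (s / 2) ^+ 2.
have A0 : 0 <= A by rewrite /A /K divr_ge0 ?mulr_ge0 ?exprn_ge0// ltW.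
have sub z : pdisc a (s / 2) z -> pdisc z (s / 2) `<=` pdisc a s.
  by move=> az; apply: subset_trans (pdisc_sub az) _; apply: pdisc_le; lra.
have inU z : pdisc a (s / 2) z -> pdisc a s z.
  by move=> az; apply: (sub z) => //; exact: pdisc_center.
have qg n z : pdisc a (s / 2) z -> cmod (q n z - g z) <= A * ep n.
  move=> az.
  have es : ep n <= s / 2 / 4 by have := eps n; lra.
  have fM' w : pdisc z (s / 2) w -> cmod (f w) <= M by move=> /(sub z az)/fM.
  have := second_order s20 (ep0 n) es (holo_sub (sub z az) fU) fM' (ejn n).
  have -> : dirD f z (ej n) = (ep n)%:C%C * g z.
    rewrite /dirD (bigD1 j)//= big1 ?addr0.
      by rewrite !mxE !eqxx mulr1 mulrC.
    by move=> i ij; rewrite !mxE eqxx (negbTE ij) /= !mulr0.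
  have -> : f (z + ej n) - f z - (ep n)%:C%C * g z = (ep n)%:C%C * (q n z - g z).
    rewrite /q mulrBr mulrA -rmorphM mulfV ?lt0r_neq0// rmorph1 mul1r//.
  rewrite cmodM cmod_real gtr0_norm// => le.
  rewrite -(ler_pM2l (ep0 n)) (le_trans le)//.
  by rewrite /A expr2 [X in X <= _](_ : _ = ep n * (K * M / (s / 2) ^+ 2 * ep n))//; ring.
have gb z : pdisc a (s / 2) z -> cmod (g z) <= 64 * M / (s / 2).
  move=> az.
  apply: (pderiv_le j s20 (holo_sub (sub z az) fU)) => w /(sub z az).
  exact: fM.
pose N := 64 * M / (s / 2) + A * s.
have qb n z : pdisc a (s / 2) z -> cmod (q n z) <= N.
  move=> az; rewrite -(subrK (g z) (q n z)) (le_trans (cmodD _ _))// addrC lerD ?gb//.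
  by rewrite (le_trans (qg n z az))// ler_wpM2l//; have := eps n; lra.
have qU n : holo (pdisc a (s / 2)) (q n).
  apply: holoZ; apply: holoB; last by move=> z /inU/fU.
  move=> z az; have [|l fl] := fU (z + ej n); last by exists l; exact: hdiff_shift.
  apply: (sub z az); apply: pdiscD (ejn n) _; have := eps n; lra.
have [l lP] : exists l : 'I_m -> C, forall k n, cmod (pderiv k (q n) a - l k) <=
    2 * (16 * A) / n.+1%:R.
  suff /choice[l lP] k : exists lk : C, forall n, cmod (pderiv k (q n) a - lk) <=
      2 * (16 * A) / n.+1%:R by exists l.
  apply: harmonic_cauchy => n p.
  have qq z : pdisc a (s / 2) z -> cmod (q n z - q p z) <= A * (ep n + ep p).
    move=> az; rewrite (_ : _ - _ = (q n z - g z) - (q p z - g z)); last first.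
      by rewrite opprB addrA subrK.
    by rewrite (le_trans (cmodB _ _))// mulrDr lerD// qg.
  have := pderiv_le k s20 (holoB (qU n) (qU p)) qq.
  rewrite (hdiff_pderiv k (hdiffB (holo_hdiff (qU n) (pdisc_center a s20))
     (holo_hdiff (qU p) (pdisc_center a s20)))) => h; apply: (le_trans h).
  rewrite /ep [X in X <= _](_ : _ = 16 * A * (n.+1%:R^-1 + p.+1%:R^-1))//.
  have := lt0r_neq0 s0; move: (n.+1%:R^-1) (p.+1%:R^-1) => u v s00.
  by field.
exists l; apply: hdiff_pos => e e0.
pose D := K * N / (s / 2) ^+ 2.
have N0 : 0 <= N by exact: bound_ge0 s20 (qb 0%N).
have D0 : 0 <= D by rewrite /D /K divr_ge0 ?mulr_ge0 ?exprn_ge0// ltW.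
have D10 : 0 < 1 + D by rewrite ltr_pwDl.
(* The first bound is for [second_order]; the second turns the remainder D t^2 into at most e t. *)
exists (Num.min (s / 8) (e / (1 + D))); first by rewrite lt_min !divr_gt0.
move=> h t ht t0; rewrite lt_min => /andP[ts te].
have aD : pdisc a (s / 2) (a + h) by apply: pdiscD ht _; lra.
apply: (@le_trans _ _ (D * t ^+ 2)); last first.
  rewrite expr2 mulrA ler_wpM2r ?(ltW t0)//.
  move: te; rewrite ltr_pdivlMr// mulrDr mulr1 => te.
  by rewrite mulrC; lra.
apply: (@le_harmonic _ _ (2 * A * (s / 8) + \sum_(k < m) 2 * (16 * A) * t)) => n.
have ts4 : t <= s / 2 / 4 by lra.
have := second_order s20 t0 ts4 (qU n) (qb n) ht.
rewrite (_ : K * N * t ^+ 2 / _ = D * t ^+ 2); last by rewrite /D; ring.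
move=> le1.
(* Remainder of [q n], two errors of [q n] against [g], and the error of the gradient: all but the
   first are O(1/n) with h fixed. *)
rewrite (_ : _ - _ = (q n (a + h) - q n a - dirD (q n) a h) -
  (q n (a + h) - g (a + h)) + (q n a - g a) +
  \sum_k (pderiv k (q n) a - l k) * h 0 k); last first.
  have -> : \sum_k (pderiv k (q n) a - l k) * h 0 k =
      dirD (q n) a h - \sum_k l k * h 0 k.
    by rewrite /dirD -sumrB; apply: eq_bigr => k _; rewrite mulrBl.
  have eq6 (x1 x2 x3 x4 x5 x6 : C) : x5 - x6 - x4 =
    (x1 - x2 - x3) - (x1 - x5) + (x2 - x6) + (x3 - x4) by ring.
  exact: eq6.
have l3 : cmod (\sum_k (pderiv k (q n) a - l k) * h 0 k) <=
   (\sum_(k < m) 2 * (16 * A) * t) / n.+1%:R.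
  rewrite (le_trans (cmod_sum _ _ _))// mulr_suml ler_sum// => k _.
  by rewrite cmodM mulrAC ler_pM ?cmod_ge0.
have l1 := qg n _ aD; have l2 := qg n _ (pdisc_center a s20).
have -> : D * t ^+ 2 + (2 * A * (s / 8) + \sum_(k < m) 2 * (16 * A) * t) / n.+1%:R =
  D * t ^+ 2 + A * ep n + A * ep n + (\sum_(k < m) 2 * (16 * A) * t) / n.+1%:R.
  by rewrite /ep mulrDl; move: (n.+1%:R^-1) => u; field.
apply: (le_trans (cmodD _ _)); apply: lerD l3.
apply: (le_trans (cmodD _ _)); apply: lerD l2.
by apply: (le_trans (cmodB _ _)); exact: lerD le1 l1.
Qed.

End SecondOrder.

(** * Polydisc neighbourhoods, iterated derivatives, and vanishing along a line *)

Section Identity.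
Variables (R : realType) (m : nat).
Local Notation C := (CC R).
Local Notation pt := (pt R m).
Local Notation fn := (fn R m).
Local Notation mi := (mi m).
Implicit Types (f g : fn) (a z h : pt) (U : set pt) (s : seq 'I_m).

Definition opn U := forall a, U a -> exists2 r : R, 0 < r & pdisc a r `<=` U.

Lemma pdisc_opn a (r : R) : opn (pdisc a r).
Proof.
move=> z az.
(* The default value 1 keeps the radius positive when m = 0. *)
pose r' := \big[Num.min/1]_(j < m) (r - cmod (z 0 j - a 0 j)).
exists r'.
  by apply: lt_bigmin => // j _; rewrite subr_gt0; exact: az.
move=> y zy j; have := zy j.
have : r' <= r - cmod (z 0 j - a 0 j) by apply: bigmin_le_cond.
move=> h1 h2; rewrite -(subrK (z 0 j) (y 0 j)) -addrA.
by rewrite (le_lt_trans (cmodD _ _))//; lra.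
Qed.

Lemma pdisc_nbhs a (r : R) : 0 < r -> nbhs a (pdisc a r).
Proof.
move=> r0; apply/(@nbhs_normP C ('rV[C]_m : normedModType C) a); exists r%:C%C; first by rewrite /= ltcR.
move=> z /= az j; rewrite -ltcR (le_lt_trans _ az)//.
by have := coord_le_norm (a - z) j; rewrite !mxE cmodBC.
Qed.

Lemma nbhs_pdisc a (A : set pt) : nbhs a A -> exists2 r : R, 0 < r & pdisc a r `<=` A.
Proof.
move=> /nbhs_normP[_ /complex_gt0P[d d0 ->] dA].
exists (d / 2); first by rewrite divr_gt0.
move=> z az; apply: dA => /=; rewrite -normrN opprB.
apply: (@le_lt_trans _ _ (d / 2)%:C%C); last by rewrite ltcR; lra.
apply: norm_le_coord; first by rewrite divr_ge0// ltW.
by move=> j; have := az j; rewrite !mxE => /ltW.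
Qed.

Lemma open_opn (A : set pt) : open A -> opn A.
Proof. by rewrite openE => oA a /oA/nbhs_pdisc. Qed.

Lemma opn_open (A : set pt) : opn A -> open A.
Proof.
move=> oA; rewrite openE => a /oA[r r0 rA].
exact: filterS rA (pdisc_nbhs a r0).
Qed.

Lemma hdiff_bounded f a l : hdiff f a l -> exists2 r : R, 0 < r &
  exists M : R, forall z, pdisc a r z -> cmod (f z) <= M.
Proof.
move=> /hdiff_lip[K K0 [d d0 dP]]; exists (d / 2); first by rewrite divr_gt0.
exists (K * (d / 2) + cmod (f a)) => z az.
rewrite -(subrK (f a) (f z)) (le_trans (cmodD _ _))// lerD2r.
have := dP (z - a) (d / 2); rewrite (addrC a) subrK; apply; last 2 first.
- by rewrite divr_ge0// ltW.
- by lra.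
- by move=> j; have := az j; rewrite !mxE => /ltW.
Qed.

Lemma holo_bounded U f a : opn U -> holo U f -> U a -> exists2 r : R, 0 < r &
  pdisc a r `<=` U /\ exists M : R, forall z, pdisc a r z -> cmod (f z) <= M.
Proof.
move=> oU fU Ua; have [r r0 rU] := oU a Ua; have [l fl] := fU a Ua.
have [r' r'0 [M fM]] := hdiff_bounded fl.
exists (Num.min r r'); first by rewrite lt_min r0.
split.
  by apply: subset_trans rU; apply: pdisc_le; rewrite ge_min lexx.
by exists M => z az; apply: fM; apply: pdisc_le az; rewrite ge_min lexx orbT.
Qed.

Lemma holo_pderiv U f j : opn U -> holo U f -> holo U (pderiv j f).
Proof.
move=> oU fU a Ua; have [r r0 [rU [M fM]]] := holo_bounded oU fU Ua.
exact: pderiv_hdiff r0 (holo_sub rU fU) fM.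
Qed.

Lemma pderiv_ext U f g j : opn U -> holo U f -> (forall z, U z -> f z = g z) ->
  forall z, U z -> pderiv j f z = pderiv j g z.
Proof.
move=> oU fU fg z Uz; have [r r0 rU] := oU z Uz; have [l fl] := fU z Uz.
have gl : hdiff g z l by apply: hdiff_ext r0 _ fl => y /rU/fg.
by rewrite (hdiff_pderiv j fl) (hdiff_pderiv j gl).
Qed.

Lemma holo_ext U f g : opn U -> (forall z, U z -> f z = g z) -> holo U f -> holo U g.
Proof.
move=> oU fg fU z Uz; have [r r0 rU] := oU z Uz; have [l fl] := fU z Uz.
by exists l; apply: hdiff_ext r0 _ fl => y /rU/fg.
Qed.

(** Derivatives indexed by the list of their directions, so that proofs go by induction on the list;
    [Dn n] is the case of n j copies of each j. *)
Definition Dseq s f : fn := foldr (@pderiv R m) f s.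

Lemma holo_Dseq U f s : opn U -> holo U f -> holo U (Dseq s f).
Proof. by move=> oU fU; elim: s => //= j s IH; exact: holo_pderiv. Qed.

Lemma Dseq_ext U f g s : opn U -> holo U f -> (forall z, U z -> f z = g z) ->
  forall z, U z -> Dseq s f z = Dseq s g z.
Proof.
move=> oU fU fg; elim: s => [|j s IH]; first exact: fg.
exact: (@pderiv_ext U (Dseq s f) (Dseq s g) j oU (holo_Dseq s oU fU) IH).
Qed.

Lemma DseqD U f g s : opn U -> holo U f -> holo U g ->
  forall z, U z -> Dseq s (fun z => f z + g z) z = Dseq s f z + Dseq s g z.
Proof.
move=> oU fU gU; elim: s => [//|j s IH z Uz].
apply: (etrans (@pderiv_ext U _ _ j oU (holo_Dseq s oU (holoD fU gU)) IH z Uz)).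
have fl := holo_hdiff (holo_Dseq s oU fU) Uz; have gl := holo_hdiff (holo_Dseq s oU gU) Uz.
exact: (hdiff_pderiv j (hdiffD fl gl)).
Qed.

Lemma DseqZ U (c : C) f s : opn U -> holo U f ->
  forall z, U z -> Dseq s (fun z => c * f z) z = c * Dseq s f z.
Proof.
move=> oU fU; elim: s => [//|j s IH z Uz].
apply: (etrans (@pderiv_ext U _ _ j oU (holo_Dseq s oU (holoZ c fU)) IH z Uz)).
have fl := holo_hdiff (holo_Dseq s oU fU) Uz.
exact: (hdiff_pderiv j (hdiffZ c fl)).
Qed.

Lemma Dseq0 s z : Dseq s (fun=> 0) z = 0.
Proof.
have -> : Dseq s (fun=> 0) = (fun=> 0); last by [].
elim: s => //= j s ->; apply/funext => y.
exact: (hdiff_pderiv j (hdiff_cst 0 y)).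
Qed.

Lemma Dseq_tmul U f s zeta : opn U -> holo U f -> torus zeta ->
  (forall z, U z -> U (tmul zeta z)) -> forall z, U z ->
  Dseq s (fun z => f (tmul zeta z)) z = (\prod_(j <- s) zeta 0 j) * Dseq s f (tmul zeta z).
Proof.
move=> oU fU zT zU.
have hT g : holo U g -> holo U (fun z => g (tmul zeta z)).
  move=> gU z Uz; have [l gl] := gU _ (zU _ Uz).
  by exists (fun j => zeta 0 j * l j); exact: hdiff_tmul.
elim: s => [z _|j s IH z Uz]; first by rewrite big_nil mul1r.
apply: (etrans (@pderiv_ext U _ _ j oU (holo_Dseq s oU (hT f fU)) IH z Uz)).
have fl := holo_hdiff (holo_Dseq s oU fU) (zU z Uz).
rewrite (hdiff_pderiv j (hdiffZ _ (hdiff_tmul zT fl))) big_cons.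
by rewrite mulrA [_ * zeta 0 j]mulrC.
Qed.

(** Every derivative costs a layer of width eta and a factor 64/eta. *)
Lemma Dseq_le s f a (r eta M : R) : 0 < eta -> holo (pdisc a r) f ->
  (forall z, pdisc a r z -> cmod (f z) <= M) ->
  forall z, pdisc a (r - (size s)%:R * eta) z ->
    cmod (Dseq s f z) <= M * (64 / eta) ^+ size s.
Proof.
move=> eta0 fU fM; elim: s => [z|j s IH z az].
  by rewrite mul0r subr0 expr0 mulr1; exact: fM.
have sub : pdisc z eta `<=` pdisc a (r - (size s)%:R * eta).
  apply: subset_trans (pdisc_sub az) _; apply: pdisc_le.
  by rewrite /= -natr1; lra.
have subr : pdisc a (r - (size s)%:R * eta) `<=` pdisc a r.
  by apply: pdisc_le; rewrite gerBl mulr_ge0// ltW.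
have H1 : holo (pdisc z eta) (Dseq s f).
  apply: holo_sub (holo_Dseq s (@pdisc_opn a r) fU).
  exact: subset_trans sub subr.
have H2 y : pdisc z eta y -> cmod (Dseq s f y) <= M * (64 / eta) ^+ size s.
  by move=> /sub/IH.
apply: (le_trans (@pderiv_le R m j (Dseq s f) z eta _ eta0 H1 H2)).
by rewrite [size (j :: s)]/= exprS le_eqVlt; apply/orP; left; apply/eqP; ring.
Qed.

(** The bound obtained in [line_vanish] is a power of 256 e |w| / r; this radius makes the base at
    most 1/4. *)
Definition vrad (r : R) : R := r / (64 * 16 * expR 1).

Lemma vrad_gt0 (r : R) : 0 < r -> 0 < vrad r.
Proof. by move=> r0; rewrite /vrad divr_gt0// mulr_gt0// expR_gt0. Qed.

Lemma vrad_le (r : R) : 0 < r -> vrad r <= r / 8.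
Proof.
move=> r0; have e0 := expR_gt0 (1 : R).
have e1 : 1 <= expR 1 :> R by rewrite -expR0 ler_expR.
rewrite ler_wpM2l ?(ltW r0)// lef_pV2 ?posrE ?mulr_gt0//; lra.
Qed.

(** p^p / p! is one term of the exponential series of e^p. *)
Lemma natpow_le (p : nat) : p%:R ^+ p <= p`!%:R * expR 1 ^+ p :> R.
Proof.
case: p => [|p]; first by rewrite !expr0 fact0 mulr1.
have := @expR_ge1Dxn R p.+1%:R p (ler0n _ _).
rewrite -[X in expR X]mulr1 -(expRM_natl p.+1 1) => h.
rewrite mulrC -ler_pdivrMr ?ltr0n ?fact_gt0//.
by apply: le_trans h; rewrite lerDr.
Qed.

(* By Cauchy's estimate iterated p times with radius r/(2p), the p-th derivative of g along
   the line is at most M (128 p / r)^p; integrating back p times from z gives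
   |g| <= M (256 |w| / r)^p p^p / p!, and p^p <= p! e^p makes this tend to 0. *)
Lemma line_vanish g a z k (r M : R) : 0 < r -> holo (pdisc a r) g ->
  (forall y, pdisc a r y -> cmod (g y) <= M) -> pdisc a (r / 4) z ->
  (forall p, Dseq (nseq p k) g z = 0) ->
  forall w : C, cmod w < vrad r -> g (z + w *: delta_mx 0 k) = 0.
Proof.
move=> r0 gU gM az gz w wr.
have M0 := bound_ge0 r0 gM.
have rr := vrad_le r0.
have kw (v : C) i : cmod ((v *: delta_mx 0 k : pt) 0 i) <= cmod v.
  rewrite !mxE eqxx /= cmodM; case: (i == k); first by rewrite cmod1 mulr1.
  by rewrite cmod0 mulr0 cmod_ge0.
have inr (v : C) : cmod v <= cmod w -> pdisc a (r / 2) (z + v *: delta_mx 0 k).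
  by move=> vw; apply: pdisc_le (pdiscDr az (kw v)); lra.
have inr' (v : C) : cmod v <= cmod w -> pdisc a r (z + v *: delta_mx 0 k).
  by move=> /inr; apply: pdisc_le; lra.
apply/eqP; rewrite -cmod_eq0 eq_le cmod_ge0 andbT.
apply: (@le_harmonic _ _ _ M) => n; rewrite add0r.
pose p := n.+1.
pose B := M * (64 / (r / (2 * p%:R))) ^+ p.
have B0 : 0 <= B.
  by rewrite mulr_ge0 ?exprn_ge0 ?divr_ge0 ?mulr_ge0 ?ler0n// ltW.
(* i integrations back from the p-th derivative, which [B] bounds by [Dseq_le] with eta = r/(2p).
   The constants of integration vanish at z, and each mean value inequality costs a factor 2. *)
have key i : (i <= p)%N -> forall v : C, cmod v <= cmod w ->
    cmod (Dseq (nseq (p - i) k) g (z + v *: delta_mx 0 k)) <=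
    2 ^+ i * cmod v ^+ i / i`!%:R * B.
  elim: i => [_ v vw|i IH ip v vw].
    rewrite subn0 !expr0 mulr1 fact0 divr1 mul1r /B.
    have eta0 : 0 < r / (2 * p%:R) by rewrite divr_gt0// mulr_gt0// ltr0n.
    have := @Dseq_le (nseq p k) g a r (r / (2 * p%:R)) M eta0 gU gM (z + v *: delta_mx 0 k).
    rewrite size_nseq; apply.
    apply: pdisc_le (inr v vw); rewrite le_eqVlt; apply/orP; left; apply/eqP.
    by field; rewrite pnatr_eq0.
  have {}IH := IH (ltnW ip).
  have := @mvi_pow R (fun x : R[i] => Dseq (nseq (p - i.+1) k) g (z + (x : C) *: (v *: delta_mx 0 k))) i
    (2 ^+ i * cmod v ^+ i.+1 / i.+1`!%:R * B).
  rewrite scale1r scale0r addr0 gz subr0.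
  have -> : 2 * (2 ^+ i * cmod v ^+ i.+1 / i.+1`!%:R * B) =
     2 ^+ i.+1 * cmod v ^+ i.+1 / i.+1`!%:R * B by rewrite [2 ^+ i.+1]exprS; ring.
  apply => x /andP[x0 x1].
  have xv : cmod ((x%:C%C : C) * v) <= cmod w.
    by rewrite cmodM cmod_real ger0_norm// (le_trans _ vw)// ler_piMl// cmod_ge0.
  exists (pderiv k (Dseq (nseq (p - i.+1) k) g) (z + (x%:C%C : C) *: (v *: delta_mx 0 k)) * v).
    have xin : pdisc a r (z + (x%:C%C : C) *: (v *: delta_mx 0 k)).
      by rewrite scalerA; exact: inr'.
    have H := hdiff_line (holo_hdiff (holo_Dseq (nseq (p - i.+1) k) (@pdisc_opn a r) gU) xin).
    move: H; rewrite (bigD1 k)//= big1 ?addr0; first by rewrite !mxE !eqxx mulr1.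
    by move=> j jk; rewrite !mxE eqxx (negbTE jk) /= !mulr0.
  rewrite cmodM scalerA; have := IH _ xv.
  rewrite (_ : (p - i)%N = (p - i.+1).+1) /=; last by rewrite subnSK.
  move=> le1.
  apply: (le_trans (ler_wpM2r (cmod_ge0 v) le1)).
  rewrite cmodM cmod_real (ger0_norm x0) factS natrM exprSr exprMn le_eqVlt.
  apply/orP; left; apply/eqP; field.
  by rewrite pnatr_eq0 -lt0n fact_gt0 /= lt0r_neq0// ltr_pwDl// ler0n.
have := key p (leqnn p) w (lexx _); rewrite subnn /= => /le_trans; apply.
have e0 := expR_gt0 (1 : R).
have fp0 : 0 < p`!%:R :> R by rewrite ltr0n fact_gt0.
rewrite /B mulrCA ler_wpM2l//.
have -> : 2 ^+ p * cmod w ^+ p / p`!%:R * (64 / (r / (2 * p%:R))) ^+ p =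
   ((64 * 4) * cmod w / r) ^+ p * (p%:R ^+ p / p`!%:R).
  rewrite (_ : 64 / (r / (2 * p%:R)) = (64 * 2) / r * p%:R); last first.
    by field; rewrite pnatr_eq0 lt0r_neq0.
  rewrite (_ : (64 * 4) * cmod w / r = 2 * cmod w * ((64 * 2) / r)); last by field; exact: lt0r_neq0.
  by rewrite !exprMn; ring.
apply: (@le_trans _ _ (((64 * 4) * cmod w / r) ^+ p * expR 1 ^+ p)).
  rewrite ler_wpM2l ?exprn_ge0 ?divr_ge0 ?mulr_ge0 ?cmod_ge0 ?(ltW r0)//.
  by rewrite ler_pdivrMr// mulrC natpow_le.
rewrite -exprMn.
apply: (@le_trans _ _ ((4^-1) ^+ p)).
  apply: lerXn2r; rewrite ?nnegrE ?invr_ge0 ?mulr_ge0 ?cmod_ge0 ?invr_ge0 ?(ltW e0) ?(ltW r0)//.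
  move: wr; rewrite /vrad ltr_pdivlMr ?mulr_gt0// => wr.
  rewrite mulrAC ler_pdivrMr//; lra.
rewrite exprVn lef_pV2 ?posrE ?exprn_gt0 ?ltr0n// -natrX ler_nat.
exact: ltnW (ltn_expl _ _).
Qed.

Lemma foldr_Dseq (n : mi) (s : seq 'I_m) f :
  foldr (fun j g => iter (n j) (@pderiv R m j) g) f s =
  Dseq (flatten [seq nseq (n j) j | j <- s]) f.
Proof.
have iterE j p (g : fn) : iter p (@pderiv R m j) g = Dseq (nseq p j) g.
  by elim: p => [//|p IH]; rewrite iterS IH.
elim: s => [//|j s IH]; rewrite [LHS]/= IH iterE /Dseq.
by rewrite [flatten _]/= foldr_cat.
Qed.

End Identity.

(** * Taylor coefficients, the identity theorem, and monomials *)

Section Taylor.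
Variables (R : realType) (m : nat).
Local Notation C := (CC R).
Local Notation pt := (pt R m).
Local Notation fn := (fn R m).
Local Notation mi := (mi m).
Implicit Types (f g : fn) (a z h : pt) (U : set pt) (s : seq 'I_m) (n k : mi).

Definition dseq n s : seq 'I_m := flatten [seq nseq (n j) j | j <- s].

(* The coordinates listed in s are moved off a one after the other, all derivatives in the
   remaining directions being carried along. *)
Lemma vanish_list f a (r M : R) s : 0 < r -> holo (pdisc a r) f ->
  (forall z, pdisc a r z -> cmod (f z) <= M) -> uniq s ->
  forall z y, pdisc a (vrad (r / 2)) z -> pdisc a (vrad (r / 2)) y ->
  (forall j, j \in s -> z 0 j = a 0 j) -> (forall j, j \notin s -> y 0 j = z 0 j) ->
  (forall n, Dseq (dseq n s) f z = 0) -> f y = 0.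
Proof.
move=> r0 fU fM; have r20 : 0 < r / 2 by rewrite divr_gt0.
have v0 := vrad_gt0 r20; have v1 := vrad_le r20.
elim: s => [_ z y az ay _ yz dz|j s IH /= /andP[js us] z y az ay zs ys dz].
  rewrite (_ : y = z); first exact: (dz [ffun=> 0%N]).
  by apply/rowP => j; apply: yz.
pose z' : pt := z + (y 0 j - a 0 j) *: delta_mx 0 j.
have z'E i : z' 0 i = if i == j then y 0 j else z 0 i.
  rewrite !mxE eqxx /=; case: eqP => [->|_]; last by rewrite mulr0 addr0.
  by rewrite mulr1 zs ?mem_head// addrC subrK.
apply: (IH us z' y) => //.
- by move=> i; rewrite z'E; case: eqP => [->|_]; [exact: ay|exact: az].
- move=> i si; rewrite z'E; case: eqP => [ij|_]; first by rewrite -ij si in js.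
  by apply: zs; rewrite inE si orbT.
- move=> i si; rewrite z'E; case: eqP => [->//|/eqP ij].
  by apply: ys; rewrite inE negb_or ij.
move=> n; pose L := dseq n s.
have [M' gM] : exists M' : R, forall y, pdisc a (r / 2) y -> cmod (Dseq L f y) <= M'.
  pose eta := r / 2 / (size L).+1%:R.
  have eta0 : 0 < eta by rewrite divr_gt0.
  exists (M * (64 / eta) ^+ size L) => w aw.
  apply: (@Dseq_le _ _ L f a r eta M) => //; apply: pdisc_le aw.
  have : (size L)%:R * eta <= r / 2; last by lra.
  rewrite /eta mulrCA ler_piMr ?(ltW r20)// ler_pdivrMr ?ltr0n// mul1r ler_nat.
  exact: leqnSn.
have gU : holo (pdisc a (r / 2)) (Dseq L f).
  by apply: holo_sub (holo_Dseq L (@pdisc_opn _ _ a r) fU); apply: pdisc_le; lra.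
have az4 : pdisc a (r / 2 / 4) z by apply: pdisc_le az; lra.
apply: (line_vanish r20 gU gM az4 _ (ay j)) => p.
(* As j is not in s, the derivatives prescribed by n along s and the p derivatives along j fit in
   one multi-index. *)
pose n' : mi := [ffun i => if i == j then p else n i].
have := dz n'; rewrite /dseq /= !ffunE eqxx /Dseq foldr_cat.
rewrite (_ : [seq nseq (n' i) i | i <- s] = [seq nseq (n i) i | i <- s])//.
apply/eq_in_map => i si; rewrite ffunE; case: eqP => // ij.
by rewrite -ij si in js.
Qed.

Lemma Dn_Dseq n f z : Dn n f z = Dseq (dseq n (enum 'I_m)) f z.
Proof. by rewrite /Dn foldr_Dseq. Qed.

Lemma vanish_near f a (r M : R) : 0 < r -> holo (pdisc a r) f ->
  (forall z, pdisc a r z -> cmod (f z) <= M) -> (forall n, Dn n f a = 0) ->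
  forall y, pdisc a (vrad (r / 2)) y -> f y = 0.
Proof.
move=> r0 fU fM fa y ay.
have r20 : 0 < r / 2 by rewrite divr_gt0.
apply: (vanish_list r0 fU fM (enum_uniq 'I_m) (pdisc_center a (vrad_gt0 r20)) ay) => //.
- by move=> j; rewrite mem_enum.
- by move=> n; rewrite -Dn_Dseq.
Qed.

Lemma Dn_zero_near f a (r : R) n : 0 < r -> (forall y, pdisc a r y -> f y = 0) ->
  Dn n f a = 0.
Proof.
move=> r0 f0; rewrite Dn_Dseq.
rewrite -(@Dseq_ext _ _ (pdisc a r) (fun=> 0) f _ (@pdisc_opn _ _ a r)).
- exact: Dseq0.
- exact: holo_cst.
- by move=> z /f0.
- exact: pdisc_center.
Qed.

(** The points near which f vanishes form a nonempty subset of U, open and closed in U. Closedness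
    rests on the radius in [vanish_near] depending only on the polydisc where f is bounded, not on
    the point. *)
Lemma identity_theorem U f a : opn U -> connected U -> holo U f -> U a ->
  (exists2 r : R, 0 < r & forall y, pdisc a r y -> f y = 0) ->
  forall z, U z -> f z = 0.
Proof.
move=> oU cU fU Ua fa.
pose zero z := exists2 r : R, 0 < r & pdisc z r `<=` U `&` [set y | f y = 0].
have zeroE : [set z | zero z] = U.
  apply: cU.
  - have [r r0 f0] := fa; have [r' r'0 aU] := oU a Ua.
    exists a; exists (Num.min r r'); first by rewrite lt_min r0.
    move=> y ay; split.
      by apply: aU; apply: pdisc_le ay; rewrite ge_min lexx orbT.
    by apply: f0; apply: pdisc_le ay; rewrite ge_min lexx.
  - exists [set z | zero z].
      apply: opn_open => z [r r0 zr]; exists (r / 2); first by rewrite divr_gt0.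
      move=> y zy; exists (r / 2); first by rewrite divr_gt0.
      by apply: subset_trans zr; have := @pdisc_sub _ _ _ _ _ (r / 2) zy; rewrite -splitr.
    apply/seteqP; split=> [z [r r0 zr]|z [_ //]].
    by split; [have [] := zr _ (pdisc_center z r0)|exists r].
  - exists (closure [set z | zero z]); first exact: closed_closure.
    apply/seteqP; split=> [z zz|z [Uz zz]].
      split; last exact: subset_closure.
      by case: zz => r r0 zr; have [] := zr _ (pdisc_center z r0).
    have [r r0 [rU [M fM]]] := holo_bounded oU fU Uz.
    have r20 : 0 < r / 2 by rewrite divr_gt0.
    have r40 : 0 < r / 2 / 2 by rewrite divr_gt0.
    have v0 := vrad_gt0 r40; have v1 := vrad_le r40.
    have v20 : 0 < vrad (r / 2 / 2) / 2 by rewrite divr_gt0.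
    (* b is chosen within half the radius on which f will vanish around b, so that this polydisc
       contains a neighbourhood of z. *)
    have [b [[rb rb0 br] zb]] := zz _ (pdisc_nbhs z v20).
    have bz : pdisc b (vrad (r / 2 / 2) / 2) z.
      by move=> j; rewrite cmodBC; exact: zb.
    have zb2 : pdisc z (r / 2) b by apply: pdisc_le zb; lra.
    have sub : pdisc b (r / 2) `<=` pdisc z r.
      by have := @pdisc_sub _ _ _ _ _ (r / 2) zb2; rewrite -splitr.
    have f0 : forall y, pdisc b (vrad (r / 2 / 2)) y -> f y = 0.
      apply: (@vanish_near f b (r / 2) M r20).
      - by apply: holo_sub fU; apply: subset_trans rU.
      - by move=> y /sub/fM.
      - by move=> n; apply: Dn_zero_near rb0 _ => y /br[].
    exists (vrad (r / 2 / 2) / 2) => // y zy; split.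
      by apply: rU; apply: pdisc_le zy; lra.
    by apply: f0; have := @pdisc_sub _ _ _ _ _ (vrad (r / 2 / 2) / 2) bz; rewrite -splitr; apply.
by move=> z; rewrite -zeroE => -[r r0 zr]; have [] := zr _ (pdisc_center z r0).
Qed.

Definition mfact n : C := (\prod_(j < m) (n j)`!)%:R.

Lemma mfact_neq0 n : mfact n != 0.
Proof.
rewrite /mfact pnatr_eq0 -lt0n; apply: prodn_gt0 => j; exact: fact_gt0.
Qed.

Section TaylorRules.
Variable U : set pt.
Hypotheses (oU : opn U) (U0 : U 0).

Lemma taylor_ext f g n : holo U f -> (forall z, U z -> f z = g z) ->
  taylor_coef f n = taylor_coef g n.
Proof.
by move=> fU fg; rewrite /taylor_coef !Dn_Dseq (Dseq_ext _ oU fU fg).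
Qed.

Lemma taylorD f g n : holo U f -> holo U g ->
  taylor_coef (fun z => f z + g z) n = taylor_coef f n + taylor_coef g n.
Proof. by move=> fU gU; rewrite /taylor_coef !Dn_Dseq (DseqD _ oU fU gU)// mulrDl. Qed.

Lemma taylorZ (c : C) f n : holo U f ->
  taylor_coef (fun z => c * f z) n = c * taylor_coef f n.
Proof. by move=> fU; rewrite /taylor_coef !Dn_Dseq (DseqZ _ _ oU fU)// mulrA. Qed.

Lemma taylor_eq0 f : connected U -> holo U f -> (forall n, taylor_coef f n = 0) ->
  forall z, U z -> f z = 0.
Proof.
move=> cU fU f0; apply: (identity_theorem oU cU fU U0).
have [r r0 [rU [M fM]]] := holo_bounded oU fU U0.
exists (vrad (r / 2)); first by rewrite vrad_gt0// divr_gt0.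
apply: (vanish_near r0 (holo_sub rU fU) fM) => n.
have := f0 n; rewrite /taylor_coef => /eqP; rewrite mulf_eq0 invr_eq0.
by rewrite (negbTE (mfact_neq0 n)) orbF => /eqP.
Qed.

Lemma prod_dseq n (z : pt) : \prod_(j <- dseq n (enum 'I_m)) z 0 j = monom z n.
Proof.
rewrite /monom /dseq big_flatten /= big_map /index_enum -enumT.
by apply: eq_bigr => j _; rewrite big_nseq iter_mulr_1.
Qed.

Lemma tmul0 zeta : tmul zeta (0 : pt) = 0.
Proof. by apply/rowP => j; rewrite !mxE mulr0. Qed.

Lemma taylor_tmul f n zeta : holo U f -> torus zeta ->
  (forall z, U z -> U (tmul zeta z)) ->
  taylor_coef (fun z => f (tmul zeta z)) n = monom zeta n * taylor_coef f n.
Proof.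
move=> fU zT zU; rewrite /taylor_coef !Dn_Dseq (Dseq_tmul _ oU fU zT zU)//.
by rewrite prod_dseq tmul0 mulrA.
Qed.

End TaylorRules.

Lemma taylor_le (r : R) n : 0 < r -> exists2 K : R, 0 <= K & forall f (M : R),
  holo (pdisc 0 r) f -> (forall z, pdisc 0 r z -> cmod (f z) <= M) ->
  cmod (taylor_coef f n) <= K * M.
Proof.
(* With one more layer than derivatives, the polydisc left by [Dseq_le] still has positive
   radius. *)
move=> r0; pose L := dseq n (enum 'I_m); pose eta := r / (size L).+1%:R.
have eta0 : 0 < eta by rewrite divr_gt0.
exists ((64 / eta) ^+ size L / cmod (mfact n)).
  by rewrite divr_ge0 ?cmod_ge0// exprn_ge0// divr_ge0// ltW.
move=> f M fU fM; rewrite /taylor_coef Dn_Dseq cmodM cmodV mulrAC ler_wpM2r//.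
  by rewrite invr_ge0 cmod_ge0.
rewrite mulrC; apply: (@Dseq_le _ _ L f 0 r eta M) => //.
apply: pdisc_center; rewrite /eta subr_gt0 mulrCA gtr_pMr//.
by rewrite ltr_pdivrMr ?ltr0n// mul1r ltr_nat.
Qed.

Lemma hdiff_pow j (p : nat) a :
  hdiff (fun z => z 0 j ^+ p) a (fun i => (i == j)%:R * (p%:R * a 0 j ^+ p.-1)).
Proof.
elim: p => [|p IH].
  have := hdiff_cst 1 a; congr hdiff.
  by apply/funext => i; rewrite mul0r mulr0.
have := hdiffM (hdiff_coord j a) IH.
rewrite (_ : (fun z => _) = (fun z : pt => z 0 j ^+ p.+1)); last first.
  by apply/funext => z; rewrite exprS.
congr hdiff; apply/funext => i; case: (i == j); rewrite ?mul0r ?mulr0 ?addr0//= !mul1r.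
case: p {IH} => [|p]; first by rewrite mul0r mulr0 addr0 expr0 mulr1.
by rewrite -[in RHS]natr1 mulrDl mul1r addrC mulrCA -exprS.
Qed.

Lemma hdiff_prod_without j n s a : j \notin s ->
  exists2 l : 'I_m -> C, hdiff (fun z => \prod_(i <- s) z 0 i ^+ n i) a l & l j = 0.
Proof.
elim: s => [_|i s IH].
  exists (fun=> 0); last by [].
  rewrite (_ : (fun z : pt => _) = fun=> 1); first exact: hdiff_cst.
  by apply/funext => z; rewrite big_nil.
rewrite inE negb_or => /andP[ji js]; have [l sl lj] := IH js.
have := hdiffM (hdiff_pow i (n i) a) sl; set l' := (X in hdiff _ _ X) => H.
exists l'; last by rewrite /l' lj (negbTE ji) !mul0r mulr0 addr0.
rewrite (_ : (fun z : pt => _) = (fun z => z 0 i ^+ n i * \prod_(i <- s) z 0 i ^+ n i))//.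
by apply/funext => z; rewrite big_cons.
Qed.

Lemma hdiff_monom_coord n j a : exists2 l : 'I_m -> C, hdiff (fun z => monom z n) a l &
  l j = (n j)%:R * monom a [ffun i => (n i - (i == j))%N].
Proof.
have [l sl lj] := @hdiff_prod_without j n [seq i <- enum 'I_m | i != j] a
  ltac:(by rewrite mem_filter eqxx).
have := hdiffM (hdiff_pow j (n j) a) sl; set l' := (X in hdiff _ _ X) => H.
have monE (k : mi) z : (forall i, i != j -> k i = n i) ->
    monom z k = z 0 j ^+ k j * \prod_(i <- [seq i <- enum 'I_m | i != j]) z 0 i ^+ n i.
  move=> kn; rewrite /monom (bigD1 j)//= big_filter big_enum_cond /=.
  by congr (_ * _); apply: eq_big => [i|i /kn ->].
exists l'.
  rewrite (_ : (fun z => _) = (fun z : pt =>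
    z 0 j ^+ n j * \prod_(i <- [seq i <- enum 'I_m | i != j]) z 0 i ^+ n i))//.
  by apply/funext => z; rewrite (monE n).
rewrite /l' lj mulr0 addr0 eqxx mul1r monE ?ffunE ?eqxx ?subn1 ?mulrA//.
by move=> i ij; rewrite ffunE (negbTE ij) subn0.
Qed.

Lemma monom_add n j z : z 0 j * monom z n = monom z (mi_addeps n j).
Proof.
rewrite /monom (bigD1 j)//= mulrA -exprS [RHS](bigD1 j)//= ffunE eqxx addn1.
by congr (_ * _); apply: eq_bigr => i ij; rewrite ffunE (negbTE ij) addn0.
Qed.

Lemma holo_prod s n U : holo U (fun z => \prod_(i <- s) z 0 i ^+ n i).
Proof.
elim: s => [|i s IH].
  rewrite (_ : (fun z => _) = (fun=> 1 : C)); first exact: holo_cst.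
  by apply/funext => z; rewrite big_nil.
rewrite (_ : (fun z => _) = (fun z : pt => z 0 i ^+ n i * \prod_(i <- s) z 0 i ^+ n i)).
  apply: holoM => // a _; eexists; exact: hdiff_pow.
by apply/funext => z; rewrite big_cons.
Qed.

Lemma holo_monom n U : holo U (fun z => monom z n).
Proof. exact: holo_prod. Qed.

(** The falling factorial vanishes once a variable is differentiated more often than its exponent,
    so truncated subtraction does no harm. *)
Lemma Dseq_monom k s : Dseq s (fun z => monom z k) = (fun z =>
  (\prod_(j < m) (k j) ^_ (count_mem j s))%:R *
    monom z [ffun j => (k j - count_mem j s)%N]).
Proof.
elim: s => [|j s IH].
  apply/funext => z; rewrite big1 ?mul1r//=.
  by congr monom; apply/ffunP => i; rewrite ffunE subn0.
have -> : Dseq (j :: s) (fun z => monom z k) = pderiv j (Dseq s (fun z => monom z k)) by [].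
rewrite IH; apply/funext => z.
have [l nl lj] := hdiff_monom_coord [ffun j => (k j - count_mem j s)%N] j z.
rewrite (hdiff_pderiv j (hdiffZ _ nl)) lj ffunE mulrA -natrM.
congr (_%:R * _).
  rewrite (bigD1 j)//= [RHS](bigD1 j)//= eqxx add1n ffactnSr mulnAC.
  congr (_ * _)%N; apply: eq_bigr => i ij.
  by rewrite eq_sym (negbTE ij).
congr monom; apply/ffunP => i; rewrite !ffunE /= -subnDA addnC.
by rewrite [j == i]eq_sym.
Qed.

Lemma count_dseq n j : count_mem j (dseq n (enum 'I_m)) = n j.
Proof.
rewrite /dseq count_flatten -map_comp sumnE big_map big_enum /=.
rewrite (bigD1 j)//= count_nseq /= eqxx mul1n big1 ?addn0// => i ij.
by rewrite count_nseq /= (negbTE ij).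
Qed.

Lemma taylor_monom k n : taylor_coef (fun z => monom z k) n = (n == k)%:R.
Proof.
rewrite /taylor_coef Dn_Dseq Dseq_monom.
have [->|/eqP nk] := eqVneq n k.
  rewrite (_ : monom _ _ = 1) ?mulr1.
    under eq_bigr do rewrite count_dseq ffactnn.
    by rewrite divff//; exact: (mfact_neq0 k).
  by rewrite /monom big1// => j _; rewrite ffunE count_dseq subnn expr0.
have [j jnk] : exists j, n j != k j.
  apply: contrapT => /forallNP H; apply: nk; apply/ffunP => j; apply/eqP.
  by have /negP := H j; rewrite negbK.
rewrite (_ : _ * monom _ _ = 0) ?mul0r//.
move: jnk; rewrite neq_ltn => /orP[nk1|kn].
  rewrite [X in _ * X](_ : _ = 0) ?mulr0// /monom (bigD1 j)//= ffunE count_dseq mxE.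
  by rewrite expr0n subn_eq0 leqNgt nk1 /= mul0r.
by rewrite (bigD1 j)//= count_dseq ffact_small// mul0n mul0r.
Qed.

End Taylor.

(** * Hilbert spaces of functions *)

Section Hilbert.
Variables (R : realType) (m : nat) (Om : set (pt R m)).
Variables (H : set (fn R m)) (ip : fn R m -> fn R m -> CC R).
Hypothesis HH : hilbert_fun_space Om H ip.
Local Notation C := (CC R).
Local Notation pt := (pt R m).
Local Notation fn := (fn R m).
Local Notation mi := (mi m).
Implicit Types (f g h : fn).

(* The squared norm, as a real number. *)
Definition nsq f : R := Re (ip f f).

Lemma H_off f z : H f -> ~ Om z -> f z = 0.
Proof. by move=> Hf; case: HH => h _ _ _; exact: h. Qed.

Lemma H_0 : H (fun=> 0).
Proof. by case: HH => _ []. Qed.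

Lemma H_D f g : H f -> H g -> H (fun z => f z + g z).
Proof. by case: HH => _ [_ + _] _ _; exact. Qed.

Lemma H_Z (a : C) f : H f -> H (fun z => a * f z).
Proof. by case: HH => _ [_ _ +] _ _; exact. Qed.

Lemma subE f g : (fun z => f z - g z) = (fun z => f z + (-1 * g z)).
Proof. by apply/funext => z; rewrite mulN1r. Qed.

Lemma H_B f g : H f -> H g -> H (fun z => f z - g z).
Proof. by move=> Hf Hg; rewrite subE; apply: H_D => //; exact: H_Z. Qed.

Lemma ipDl f g h : H f -> H g -> H h ->
  ip (fun z => f z + g z) h = ip f h + ip g h.
Proof. by case: HH => _ _ [+ _ _ _ _] _; exact. Qed.

Lemma ipZl (a : C) f g : H f -> H g -> ip (fun z => a * f z) g = a * ip f g.
Proof. by case: HH => _ _ [_ + _ _ _] _; exact. Qed.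

Lemma ipC f g : H f -> H g -> ip g f = conjc (ip f g).
Proof. by case: HH => _ _ [_ _ + _ _] _; exact. Qed.

Lemma ipE f : H f -> ip f f = (nsq f)%:C%C.
Proof.
case: HH => _ _ [_ _ _ + _] _ => /[apply].
by rewrite lecE /nsq /= => /andP[/eqP h _]; case: (ip f f) h => a b /= ->.
Qed.

Lemma nsq_ge0 f : H f -> 0 <= nsq f.
Proof.
move=> Hf; rewrite -lecR -ipE//.
by case: HH => _ _ [_ _ _ + _] _; exact.
Qed.

Lemma nsq_eq0 f : H f -> nsq f = 0 -> f = (fun=> 0).
Proof.
move=> Hf f0; case: HH => _ _ [_ _ _ _ +] _; apply => //.
by rewrite ipE// f0.
Qed.

Lemma ipBl f g h : H f -> H g -> H h ->
  ip (fun z => f z - g z) h = ip f h - ip g h.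
Proof.
by move=> Hf Hg Hh; rewrite subE ipDl//; [rewrite ipZl// mulN1r|exact: H_Z].
Qed.

Lemma ipDr f g h : H f -> H g -> H h ->
  ip h (fun z => f z + g z) = ip h f + ip h g.
Proof.
move=> Hf Hg Hh; rewrite (ipC _ Hh); last exact: H_D.
by rewrite ipDl// rmorphD /= -!ipC.
Qed.

Lemma ipZr (a : C) f g : H f -> H g -> ip f (fun z => a * g z) = conjc a * ip f g.
Proof.
move=> Hf Hg; rewrite (ipC _ Hf); last exact: H_Z.
by rewrite ipZl// rmorphM /= -ipC.
Qed.

Lemma ipBr f g h : H f -> H g -> H h ->
  ip h (fun z => f z - g z) = ip h f - ip h g.
Proof.
move=> Hf Hg Hh; rewrite (ipC _ Hh); last exact: H_B.
by rewrite ipBl// rmorphB /= -!ipC.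
Qed.

Lemma ip0l f : H f -> ip (fun=> 0) f = 0.
Proof.
move=> Hf; rewrite (_ : (fun=> 0) = (fun z => 0 * f z)); first by rewrite ipZl// mul0r.
by apply/funext => z; rewrite mul0r.
Qed.

Lemma nsqZ (a : C) f : H f -> nsq (fun z => a * f z) = cmod a ^+ 2 * nsq f.
Proof.
move=> Hf; have Ha := H_Z a Hf; apply: complexI; rewrite -ipE// ipZl// ipZr//.
by rewrite mulrA mul_conjc ipE// [RHS]rmorphM.
Qed.

Lemma nsqBC f g : H f -> H g -> nsq (fun z => f z - g z) = nsq (fun z => g z - f z).
Proof.
move=> Hf Hg; rewrite (_ : (fun z => f z - g z) = (fun z => -1 * (g z - f z))).
  by rewrite nsqZ ?cmodN ?cmod1 ?expr1n ?mul1r//; exact: H_B.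
by apply/funext => z; rewrite mulN1r opprB.
Qed.

Lemma parallelogram f g : H f -> H g ->
  nsq (fun z => f z - g z) + nsq (fun z => f z + g z) = 2 * nsq f + 2 * nsq g.
Proof.
move=> Hf Hg; have HB := H_B Hf Hg; have HD := H_D Hf Hg.
apply: complexI; rewrite !rmorphD !rmorphM /= -!ipE// ipBl// ipDl//.
rewrite !ipBr// !ipDr// rmorphMn rmorph1; ring.
Qed.

Lemma nsqD_le f g : H f -> H g ->
  nsq (fun z => f z + g z) <= 2 * nsq f + 2 * nsq g.
Proof.
by move=> Hf Hg; rewrite -parallelogram// lerDr nsq_ge0//; exact: H_B.
Qed.

Lemma nsqB_le f g h : H f -> H g -> H h ->
  nsq (fun z => f z - g z) <= 2 * nsq (fun z => f z - h z) + 2 * nsq (fun z => h z - g z).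
Proof.
move=> Hf Hg Hh; have := nsqD_le (H_B Hf Hh) (H_B Hh Hg).
rewrite (_ : (fun z => f z - h z + (h z - g z)) = (fun z => f z - g z))//.
by apply/funext => z; rewrite addrA subrK.
Qed.

(** Pythagoras for projection on the line of g: it gives Cauchy-Schwarz and, in [projection],
    controls inner products with near-minimisers. *)
Lemma nsq_sub_proj f g : H f -> H g -> 0 < nsq g ->
  nsq (fun z => f z - ip f g / (nsq g)%:C%C * g z) = nsq f - cmod (ip f g) ^+ 2 / nsq g.
Proof.
move=> Hf Hg g0; have n0 : (nsq g)%:C%C != 0 :> C by exact: complexR_neq0.
set c := ip f g / _; have HcG : H (fun z => c * g z) by exact: H_Z.
have HB := H_B Hf HcG.
have cE : conjc c = conjc (ip f g) / (nsq g)%:C%C.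
  rewrite /c rmorphM fmorphV /=; congr (_ * _^-1).
  exact: conjc_real.
apply: complexI; rewrite -ipE// ipBl// !ipBr// !ipZl// !ipZr// cE (ipC Hf Hg).
have -> : (nsq f - cmod (ip f g) ^+ 2 / nsq g)%:C%C =
    (nsq f)%:C%C - ip f g * conjc (ip f g) / (nsq g)%:C%C :> C.
  by rewrite mul_conjc rmorphB; congr (_ - _); rewrite rmorphM fmorphV.
rewrite (ipE Hf) (ipE Hg).
by rewrite /c; field.
Qed.

Lemma cauchy_schwarz f g : H f -> H g -> cmod (ip f g) ^+ 2 <= nsq f * nsq g.
Proof.
move=> Hf Hg; have := nsq_ge0 Hg; rewrite le_eqVlt => /predU1P[g0|g0].
  rewrite (nsq_eq0 Hg (esym g0)) ipC ?ip0l// ?conjc0 ?cmod0 ?expr0n/=; last exact: H_0.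
  by rewrite mulr_ge0// nsq_ge0//; exact: H_0.
have := @nsq_ge0 (fun z => f z - ip f g / (nsq g)%:C%C * g z).
rewrite nsq_sub_proj// => h; rewrite -ler_pdivrMr// -subr_ge0; apply: h.
by apply: H_B => //; exact: H_Z.
Qed.

(* Completeness only for sequences with ||u k - u l||^2 <= A (1/(k+1) + 1/(l+1)), the form
   in which all Cauchy sequences occur here. *)
Lemma H_complete (u : nat -> fn) (A : R) : (forall k, H (u k)) ->
  (forall k l, nsq (fun z => u k z - u l z) <= A * (k.+1%:R^-1 + l.+1%:R^-1)) ->
  exists2 f, H f & forall e : R, 0 < e -> exists K : nat, forall k : nat, (K <= k)%N ->
    nsq (fun z => u k z - f z) < e.
Proof.
move=> Hu uA; case: HH => _ _ _ /(_ u Hu)[|f Hf fu].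
  move=> _ /complex_gt0P[e e0 ->].
  have A1 : 0 < 2 * (`|A| + 1) by rewrite mulr_gt0// ltr_wpDl.
  have Ae : 0 < e / (2 * (`|A| + 1)) by rewrite divr_gt0.
  exists (Num.truncn (e / (2 * (`|A| + 1)))^-1) => k l Kk Kl.
  rewrite ipE; last exact: H_B.
  rewrite ltcR (le_lt_trans (uA k l))//.
  have := invS_lt Ae Kk; have := invS_lt Ae Kl; rewrite !ltr_pdivlMr//.
  have kp : 0 <= k.+1%:R^-1 :> R by rewrite invr_ge0.
  have lp : 0 <= l.+1%:R^-1 :> R by rewrite invr_ge0.
  have := ler_norm A; move: kp lp; move: (k.+1%:R^-1) (l.+1%:R^-1) `|A| => x y B.
  by nra.
exists f => // e e0; have eC : 0 < e%:C%C :> C by rewrite ltcR.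
have [K KP] := fu _ eC; exists K => k /KP.
by rewrite ipE ?ltcR//; exact: H_B.
Qed.

Definition lsubspace (S : fn -> Prop) := [/\ S (fun=> 0),
  (forall f g, S f -> S g -> S (fun z => f z + g z)),
  (forall (a : C) f, S f -> S (fun z => a * f z)) & (forall f, S f -> H f)].

Lemma lsubspaceB S f g : lsubspace S -> S f -> S g -> S (fun z => f z - g z).
Proof. by move=> [_ SD SZ _] Sf Sg; rewrite subE; apply: SD => //; exact: SZ. Qed.

(** [S] need not be closed, so p is only a limit of elements of [S], namely of a minimising sequence
    for the distance to f. *)
Lemma projection S f : lsubspace S -> H f -> exists2 p, H p &
  (forall e : R, 0 < e -> exists2 s, S s & nsq (fun z => p z - s z) < e) /\
  (forall s, S s -> ip (fun z => f z - p z) s = 0).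
Proof.
move=> SS Hf; have [S0 SD SZ SH] := SS.
pose D := [set nsq (fun z => f z - s z) | s in S].
have Dlb : lbound D 0.
  by move=> _ [s Ss <-]; apply: nsq_ge0; apply: H_B => //; exact: SH.
have D0 : D !=set0 by exists (nsq (fun z => f z - 0)); exists (fun=> 0).
pose d := inf D.
have dle s : S s -> d <= nsq (fun z => f z - s z).
  by move=> Ss; apply: ge_inf; [exists 0|exists s].
have [s sP] : exists s : nat -> fn, forall k, S (s k) /\
    nsq (fun z => f z - s k z) < d + k.+1%:R^-1.
  suff /choice[s sP] k : exists s, S s /\ nsq (fun z => f z - s z) < d + k.+1%:R^-1.
    by exists s.
  have [_ [s Ss <-] lt] := @inf_adherent R D k.+1%:R^-1 ltac:(by rewrite invr_gt0)
    (conj D0 (ex_intro _ 0 Dlb)).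
  by exists s.
have Ss k : S (s k) by case: (sP k).
have Hs k : H (s k) by apply: SH.
have [||p Hp pP] := @H_complete s 2.
- exact: Hs.
- move=> k l.
  (* The midpoint of s k and s l is a competitor, so the parallelogram law makes a minimising
     sequence Cauchy. *)
  have := parallelogram (H_B Hf (Hs k)) (H_B Hf (Hs l)).
  rewrite (_ : (fun z => f z - s k z - (f z - s l z)) = (fun z => s l z - s k z)); last first.
    by apply/funext => z; rewrite opprB addrC addrA subrK.
  rewrite (_ : (fun z => f z - s k z + (f z - s l z)) =
      (fun z => 2 * (f z - 2^-1 * (s k z + s l z)))); last first.
    by apply/funext => z; field.
  have Sm : S (fun z => 2^-1 * (s k z + s l z)) by apply: SZ; exact: SD.
  rewrite nsqZ; last by apply: H_B => //; exact: SH.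
  have -> : cmod (2 : C) = 2.
    by rewrite -[2 : C](rmorph_nat (real_complex R) 2) cmod_real ger0_norm.
  rewrite nsqBC//; have := dle _ Sm; have [_] := sP k; have [_] := sP l.
  move: (nsq _) (nsq _) (nsq _) (nsq _) (k.+1%:R^-1) (l.+1%:R^-1) => a b c e x y.
  by lra.
exists p => //; split.
  move=> e /pP[K KP]; exists (s K) => //.
  by rewrite nsqBC//; exact: KP.
move=> t St; have Ht := SH _ St.
apply/eqP; rewrite -cmod_eq0 -sqrf_eq0 eq_le sqr_ge0 andbT.
have [t0|t0] := eqVneq (nsq t) 0.
  have := cauchy_schwarz (H_B Hf Hp) Ht; by rewrite t0 mulr0.
have {}t0 : 0 < nsq t by rewrite lt0r t0 nsq_ge0.
rewrite leNgt; apply/negP => q0.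
set q := cmod _ ^+ 2 in q0.
have e0 : 0 < q / (4 * nsq t) by rewrite divr_gt0// mulr_gt0.
have [K KP] := pP _ e0.
pose k := maxn K (Num.truncn (q / (4 * nsq t))^-1).
have l1 := KP k (leq_maxl _ _).
have l2 : k.+1%:R^-1 < q / (4 * nsq t).
  by apply: invS_lt => //; exact: leq_maxr.
(* Adding to s k the projection of f - s k on t lowers the squared distance by |<f - s k, t>|^2 /
   ||t||^2, and only 1/(k+1) is left to gain. *)
have l3 : cmod (ip (fun z => f z - s k z) t) ^+ 2 <= nsq t * k.+1%:R^-1.
  have := nsq_sub_proj (H_B Hf (Hs k)) Ht t0.
  set c := ip _ t / _.
  rewrite (_ : (fun z => f z - s k z - c * t z) = (fun z => f z - (s k z + c * t z))); last first.
    by apply/funext => z; rewrite opprD addrA.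
  have /dle : S (fun z => s k z + c * t z) by apply: SD => //; exact: SZ.
  have [_] := sP k.
  move=> h1 h2 h3; rewrite h3 in h2; rewrite -ler_pdivrMl//; move: h1 h2.
  by rewrite (mulrC (nsq t)^-1); move: (_ / nsq t) (k.+1%:R^-1) => x y; lra.
have l4 := cauchy_schwarz (H_B (Hs k) Hp) Ht.
have := sqr_cmodD (ip (fun z => f z - s k z) t) (ip (fun z => s k z - p z) t).
rewrite -ipDl//; [|exact: H_B..].
rewrite (_ : (fun z => f z - s k z + (s k z - p z)) = (fun z => f z - p z)); last first.
  by apply/funext => z; rewrite addrA subrK.
rewrite -/q; have b1 : nsq t * k.+1%:R^-1 < q / 4.
  by rewrite mulrC -ltr_pdivlMr// -mulrA -invfM.
have b2 : nsq (fun z => s k z - p z) * nsq t < q / 4.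
  by rewrite -ltr_pdivlMr// -mulrA -invfM.
move: (le_lt_trans l3 b1) (le_lt_trans l4 b2).
set x := cmod (ip _ t) ^+ 2; set y := cmod (ip _ t) ^+ 2.
by move: x y => x y; lra.
Qed.

Lemma lsubspace_dense S f : lsubspace S ->
  (forall g, H g -> (forall s, S s -> ip g s = 0) -> g = (fun=> 0)) ->
  H f -> forall e : R, 0 < e -> exists2 s, S s & nsq (fun z => f z - s z) < e.
Proof.
move=> SS Sc Hf; have [p Hp [pS fp]] := projection SS Hf.
have : (fun z => f z - p z) = (fun=> 0) by apply: Sc fp; exact: H_B.
move=> fp0; rewrite (_ : f = p)//; apply/funext => z.
by apply/eqP; rewrite -subr_eq0; have := congr1 (@^~ z) fp0 => /= ->.
Qed.

Lemma riesz (L : fn -> C) (B : R) :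
  (forall f g, H f -> H g -> L (fun z => f z + g z) = L f + L g) ->
  (forall (a : C) f, H f -> L (fun z => a * f z) = a * L f) ->
  (forall f, H f -> cmod (L f) ^+ 2 <= B * nsq f) ->
  exists2 g, H g & forall f, H f -> L f = ip f g.
Proof.
move=> LD LZ LB.
have LB' f g : H f -> H g -> L (fun z => f z - g z) = L f - L g.
  by move=> Hf Hg; rewrite subE LD//; [rewrite LZ// mulN1r|exact: H_Z].
have L00 f : H f -> L (fun=> 0) = 0.
  move=> Hf; rewrite (_ : (fun=> 0) = (fun z => 0 * f z)); first by rewrite LZ// mul0r.
  by apply/funext => z; rewrite mul0r.
have [L0|/existsNP[f0]] := pselect (forall f, H f -> L f = 0).
  exists (fun=> 0); first exact: H_0.
  move=> f Hf; rewrite L0// (ipC H_0 Hf) ip0l// conjc0//.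
move=> /not_implyP[Hf0 /eqP Lf0].
pose S f := H f /\ L f = 0.
have SS : lsubspace S.
  split.
  - by split; [exact: H_0|exact: L00 Hf0].
  - by move=> f g [Hf f0'] [Hg g0]; split; [exact: H_D|rewrite LD// f0' g0 addr0].
  - by move=> a f [Hf f0']; split; [exact: H_Z|rewrite LZ// f0' mulr0].
  - by move=> f [].
have [p Hp [pS fp]] := projection SS Hf0.
(* The kernel of L is closed because L is bounded: p is a limit of zeros of L. *)
have Lp : L p = 0.
  apply/eqP; rewrite -cmod_eq0 -sqrf_eq0 eq_le sqr_ge0 andbT.
  rewrite leNgt; apply/negP => q0.
  have B0 : 0 < `|B| + 1 by rewrite ltr_wpDl.
  have [s [Hs Ls] sP] := pS (cmod (L p) ^+ 2 / (`|B| + 1)) (divr_gt0 q0 B0).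
  have := LB _ (H_B Hp Hs); rewrite LB'// Ls subr0.
  move: sP; rewrite ltr_pdivlMr//; have := ler_norm B.
  have := nsq_ge0 (H_B Hp Hs); move: (nsq _) (cmod _ ^+ 2) `|B| => x y b.
  by nra.
pose g0 : fn := fun z => f0 z - p z.
have Hg0 : H g0 by exact: H_B.
have Lg0 : L g0 = L f0 by rewrite /g0 LB'// Lp subr0.
have n0 : 0 < nsq g0.
  rewrite lt0r nsq_ge0// andbT; apply/eqP => /(nsq_eq0 Hg0) g00.
  by move/eqP: Lf0; apply; rewrite -Lg0 g00; exact: L00 Hf0.
have n0C : (nsq g0)%:C%C != 0 :> C by exact: complexR_neq0.
exists (fun z => conjc (L f0) / (nsq g0)%:C%C * g0 z); first exact: H_Z.
move=> f Hf; rewrite ipZr//.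
have -> : conjc (conjc (L f0) / (nsq g0)%:C%C) = L f0 / (nsq g0)%:C%C.
  rewrite rmorphM fmorphV /=; congr (_ * _^-1); first exact: conjcK.
  exact: conjc_real.
have Sf : S (fun z => f z - L f / L f0 * g0 z).
  split; first by apply: H_B => //; exact: H_Z.
  rewrite LB'//; last exact: H_Z.
  by rewrite LZ// Lg0 divfK// subrr.
have := fp _ Sf; rewrite -/g0 ipBr//; last exact: H_Z.
rewrite ipZr// (ipE Hg0) => /eqP; rewrite subr_eq0 => /eqP e1.
have -> : ip f g0 = L f / L f0 * (nsq g0)%:C%C.
  rewrite (ipC Hg0 Hf) e1 rmorphM; congr (_ * _); first exact: conjcK.
  exact: conjc_real.
by field; rewrite n0C Lf0.
Qed.

End Hilbert.

(** * Unordered sums over sets of multi-indices *)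

Section Usum.
Variables (R : realType) (m : nat).
Local Notation C := (CC R).
Local Notation mi := (mi m).
Implicit Types (D L : set mi) (a b : mi -> C) (F : {fset mi}).

Lemma has_usumP D a (s : C) : has_usum D a s <-> forall e : R, 0 < e ->
  exists F0 : {fset mi}, [set` F0] `<=` D /\
    forall F, [set` F0] `<=` [set` F] -> [set` F] `<=` D ->
      cmod (\sum_(i <- F) a i - s) < e.
Proof.
split=> [sa e e0|sa e /complex_gt0P[r r0 ->]].
  have [|F0 [F0D F0P]] := sa e%:C%C; first by rewrite ltcR.
  by exists F0; split=> // F F0F FD; have := F0P F F0F FD; rewrite cmodE ltcR.
have [F0 [F0D F0P]] := sa r r0; exists F0; split => // F F0F FD.
by rewrite cmodE ltcR; exact: F0P.
Qed.

Lemma fsetU_sub D F F' : [set` F] `<=` D -> [set` F'] `<=` D ->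
  [set` (F `|` F')%fset] `<=` D.
Proof. by move=> FD F'D x /=; rewrite inE => /orP[/FD|/F'D]. Qed.

Lemma has_usum_unique D a (s s' : C) : has_usum D a s -> has_usum D a s' -> s = s'.
Proof.
move=> /has_usumP sa /has_usumP sa'; apply/eqP; rewrite -subr_eq0 -cmod_eq0.
rewrite eq_le cmod_ge0 andbT leNgt; apply/negP => e0.
have e20 : 0 < cmod (s - s') / 2 by rewrite divr_gt0.
have [F0 [F0D F0P]] := sa _ e20; have [F1 [F1D F1P]] := sa' _ e20.
have UD := fsetU_sub F0D F1D.
have := F0P (F0 `|` F1)%fset; have := F1P (F0 `|` F1)%fset.
move=> /(_ _ UD)/wrap[]; first by move=> x /= xF; rewrite inE xF orbT.
move=> h1 /(_ _ UD)/wrap[]; first by move=> x /= xF; rewrite inE xF.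
move: h1; set x := \sum_(_ <- _) _ => h1 h2.
have := cmodD (s - x) (x - s'); rewrite addrA subrK (cmodBC s x).
by lra.
Qed.

Lemma has_usum_eq D a b (s : C) : (forall n, D n -> a n = b n) ->
  has_usum D a s -> has_usum D b s.
Proof.
move=> ab sa e e0; have [F0 [F0D F0P]] := sa e e0; exists F0; split => // F F0F FD.
rewrite -(eq_big_seq _ (fun i iF => ab i (FD i iF))); exact: F0P.
Qed.

Lemma has_usum0 D : has_usum D (fun=> 0 : C) 0.
Proof.
move=> e e0; exists fset0; split; first by move=> x /=; rewrite inE.
by move=> F _ _; rewrite big1// subrr normr0.
Qed.

Lemma has_usum_widen L D a (s : C) : L `<=` D -> (forall n, ~ L n -> a n = 0) ->
  has_usum L a s -> has_usum D a s.
Proof.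
move=> LD a0 sa e e0; have [F0 [F0L F0P]] := sa e e0; exists F0; split.
  exact: subset_trans F0L LD.
move=> F F0F FD; pose F' := [fset x in F | `[< L x >]]%fset.
have -> : \sum_(i <- F) a i = \sum_(i <- F') a i.
  rewrite (big_fsetID _ (fun x => `[< L x >]))/= -[RHS]addr0.
  congr (_ + _); rewrite big_seq big1// => i.
  by rewrite !inE /= => /andP[_ /asboolP/a0].
apply: F0P => x /=.
  by move=> xF; rewrite !inE /=; apply/andP; split; [exact: F0F|apply/asboolP; exact: F0L].
by rewrite !inE /= => /andP[_ /asboolP].
Qed.

(** For the polarisation under (3): adding a multiple of z^n to f alters a single term of the norm
    series. *)
Lemma has_usum_delta D a (s t : C) n : D n -> has_usum D a s ->
  has_usum D (fun k => a k + (if k == n then t else 0)) (s + t).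
Proof.
move=> Dn sa e e0; have [F0 [F0D F0P]] := sa e e0.
exists (n |` F0)%fset; split; first by move=> x /=; rewrite !inE => /orP[/eqP->|/F0D].
move=> F F0F FD.
have nF : n \in F by apply: F0F; rewrite /= !inE eqxx.
have tE : \sum_(i <- F) (if i == n then t else 0) = t.
  by rewrite (bigD1_seq n) ?fset_uniq//= eqxx big1 ?addr0// => i /negbTE ->.
rewrite big_split /= tE opprD addrACA subrr addr0; apply: F0P => // x xF.
by apply: F0F; rewrite /= !inE (xF : x \in F0) orbT.
Qed.

End Usum.

(** * Orthogonal systems: partial Fourier sums, Parseval, Riesz-Fischer *)

Section Orthogonal.
Variables (R : realType) (m : nat) (Om : set (pt R m)).
Variables (H : set (fn R m)) (ip : fn R m -> fn R m -> CC R).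
Hypothesis HH : hilbert_fun_space Om H ip.
Local Notation C := (CC R).
Local Notation pt := (pt R m).
Local Notation fn := (fn R m).
Local Notation mi := (mi m).
Local Notation nsq := (nsq ip).
Implicit Types (f g h : fn) (F G : {fset mi}).

(** Lists may repeat indices, which makes the sum of two combinations a concatenation. *)
Definition lincomb (I : Type) (v : I -> fn) (s : seq (C * I)) : fn :=
  fun z => \sum_(p <- s) p.1 * v p.2 z.

Lemma lincomb_cons (I : Type) (v : I -> fn) (p : C * I) s :
  lincomb v (p :: s) = (fun z => p.1 * v p.2 z + lincomb v s z).
Proof. by apply/funext => z; rewrite /lincomb big_cons. Qed.

Lemma lincomb_nil (I : Type) (v : I -> fn) : lincomb v [::] = (fun=> 0).
Proof. by apply/funext => z; rewrite /lincomb big_nil. Qed.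

Definition spanned (I : eqType) (v : I -> fn) (P : I -> Prop) f :=
  exists2 s : seq (C * I), (forall p, p \in s -> P p.2) & f = lincomb v s.

Lemma H_lincomb (I : eqType) (v : I -> fn) (s : seq (C * I)) :
  (forall p, p \in s -> H (v p.2)) -> H (lincomb v s).
Proof.
elim: s => [_|p s IH Hv]; first by rewrite lincomb_nil; exact: (H_0 HH).
rewrite lincomb_cons; apply: (H_D HH); last first.
  by apply: IH => q qs; apply: Hv; rewrite inE qs orbT.
by apply: (H_Z HH); apply: Hv; rewrite mem_head.
Qed.

Lemma ip_lincombl (I : eqType) (v : I -> fn) (s : seq (C * I)) g :
  H g -> (forall p, p \in s -> H (v p.2)) ->
  ip (lincomb v s) g = \sum_(p <- s) p.1 * ip (v p.2) g.
Proof.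
move=> Hg; elim: s => [_|p s IH Hv]; first by rewrite lincomb_nil big_nil (ip0l HH).
have Hp : H (v p.2) by apply: Hv; rewrite mem_head.
have Hs q : q \in s -> H (v q.2) by move=> qs; apply: Hv; rewrite inE qs orbT.
rewrite lincomb_cons big_cons (ipDl HH)//; last 2 first.
- exact: (H_Z HH).
- exact: H_lincomb.
by rewrite (ipZl HH)// IH.
Qed.

Lemma lsubspace_spanned (I : eqType) (v : I -> fn) (P : I -> Prop) :
  (forall i, P i -> H (v i)) -> lsubspace H (spanned v P).
Proof.
move=> Hv; split.
- by exists [::] => //; rewrite lincomb_nil.
- move=> _ _ [s sP ->] [t tP ->]; exists (s ++ t).
    by move=> p; rewrite mem_cat => /orP[/sP|/tP].
  by apply/funext => z; rewrite /lincomb big_cat.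
- move=> a _ [s sP ->]; exists [seq (a * p.1, p.2) | p <- s].
    by move=> _ /mapP[p /sP ps ->].
  apply/funext => z; rewrite /lincomb big_map mulr_sumr.
  by apply: eq_bigr => p _; rewrite mulrA.
- by move=> _ [s sP ->]; apply: H_lincomb => p /sP/Hv.
Qed.

Variables (e : mi -> fn) (L : set mi).
Hypothesis He : forall n, L n -> H (e n).
Hypothesis eo : forall n k, L n -> L k -> n <> k -> ip (e n) (e k) = 0.
Hypothesis e_neq0 : forall n, L n -> e n <> (fun=> 0).

Lemma nsq_e_gt0 n : L n -> 0 < nsq (e n).
Proof.
move=> Ln; have Hn := He Ln; rewrite lt0r (nsq_ge0 HH)// andbT.
by apply/eqP => /(nsq_eq0 HH Hn); exact: e_neq0.
Qed.

Lemma nsq_e_neq0 n : L n -> (nsq (e n))%:C%C != 0 :> C.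
Proof. by move=> /nsq_e_gt0/complexR_neq0. Qed.

(** Indexed by finite sets, to match the nets in [has_usum]. *)
Definition fincomb (c : mi -> C) (F : {fset mi}) : fn := fun z => \sum_(n <- F) c n * e n z.

Lemma fincombE c F : fincomb c F = lincomb e [seq (c n, n) | n <- F].
Proof. by apply/funext => z; rewrite /lincomb big_map. Qed.

Lemma H_fincomb c F : [set` F] `<=` L -> H (fincomb c F).
Proof.
by move=> FL; rewrite fincombE; apply: H_lincomb => _ /mapP[n /FL/He Hn ->].
Qed.

Lemma ip_fincombl c F g : [set` F] `<=` L -> H g ->
  ip (fincomb c F) g = \sum_(n <- F) c n * ip (e n) g.
Proof.
move=> FL Hg; rewrite fincombE ip_lincombl//; first by rewrite big_map.
by move=> _ /mapP[n /FL/He Hn ->].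
Qed.

Lemma ip_fincomb_e c F k : [set` F] `<=` L -> L k ->
  ip (fincomb c F) (e k) = if k \in F then c k * (nsq (e k))%:C%C else 0.
Proof.
move=> FL Lk; rewrite ip_fincombl//; last exact: He.
case: ifPn => kF.
  rewrite (bigD1_seq k) ?fset_uniq//= big_seq_cond big1 ?addr0.
    by rewrite (ipE HH)//; exact: He.
  move=> n /andP[nF /eqP nk]; rewrite eo ?mulr0//; exact: FL.
rewrite big_seq big1// => n nF; rewrite eo ?mulr0//; first exact: FL.
by move=> nk; rewrite -nk nF in kF.
Qed.

Definition fourier_coef f n : C := ip f (e n) / (nsq (e n))%:C%C.

(** A partial Fourier sum is orthogonal to the remainder. *)
Lemma nsq_sub_fincomb f F : H f -> [set` F] `<=` L ->
  nsq (fun z => f z - fincomb (fourier_coef f) F z) <= nsq f.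
Proof.
move=> Hf FL; set P := fincomb _ _; have HP : H P by exact: H_fincomb.
have Hd := H_B HH Hf HP.
have orth : ip P (fun z => f z - P z) = 0.
  rewrite ip_fincombl// big_seq big1// => n nF; have Ln := FL n nF; have Hn := He Ln.
  rewrite (ipC HH Hd Hn) (ipBl HH Hf HP Hn) ip_fincomb_e// nF /fourier_coef.
  by rewrite divfK ?nsq_e_neq0// subrr conjc0 mulr0.
have orth' : ip (fun z => f z - P z) P = 0 by rewrite (ipC HH HP Hd) orth conjc0.
have fE : f = (fun z => (f z - P z) + P z) by apply/funext => z; rewrite subrK.
rewrite -lecR -!(ipE HH)// [in leRHS]fE.
have HdP : H (fun z => f z - P z + P z) by rewrite -fE.
rewrite (ipDl HH Hd HP HdP) !(ipDr HH Hd HP) ?orth ?orth' // add0r addr0.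
by rewrite lerDl (ipE HH HP) ler0c (nsq_ge0 HH).
Qed.

(** Partial Fourier sums reproduce a finite combination as soon as they contain its indices; this
    supplies the initial set [F0] for [has_usum]. *)
Lemma fincomb_spanned s : spanned e L s -> exists F0 : {fset mi}, [set` F0] `<=` L /\
    forall F, [set` F0] `<=` [set` F] -> [set` F] `<=` L -> fincomb (fourier_coef s) F = s.
Proof.
move=> [t tL ->] {s}; elim: t tL => [_|[a k] t IH tL].
  exists fset0; split; first by move=> x /=; rewrite inE.
  move=> F _ FL; rewrite lincomb_nil; apply/funext => z.
  rewrite /fincomb big_seq big1// => n /FL Ln.
  by rewrite /fourier_coef (ip0l HH (He Ln)) !mul0r.
have Lk : L k by apply: (tL (a, k)); rewrite mem_head.
have tL' q : q \in t -> L q.2 by move=> qt; apply: tL; rewrite inE qt orbT.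
have Ht : H (lincomb e t) by apply: H_lincomb => q /tL'/He.
have Hk := He Lk.
have [F0 [F0L F0P]] := IH tL'.
exists (k |` F0)%fset; split; first by move=> x /=; rewrite !inE => /orP[/eqP->|/F0L].
move=> F F0F FL.
have kF : k \in F by apply: F0F; rewrite /= !inE eqxx.
rewrite lincomb_cons /= -[in RHS](F0P F _ FL); last first.
  by move=> x xF; apply: F0F; rewrite /= !inE (xF : x \in F0) orbT.
apply/funext => z; rewrite /fincomb.
rewrite (bigD1_seq k) ?fset_uniq//= [in RHS](bigD1_seq k) ?fset_uniq//= addrA; congr (_ + _).
  rewrite /fourier_coef (ipDl HH (H_Z HH a Hk) Ht Hk) (ipZl HH a Hk Hk) (ipE HH Hk).
  by field; exact: nsq_e_neq0.
rewrite big_seq_cond [in RHS]big_seq_cond; apply: eq_bigr => n /andP[/FL Ln /eqP nk].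
rewrite /fourier_coef (ipDl HH (H_Z HH a Hk) Ht (He Ln)) (ipZl HH a Hk (He Ln)).
by rewrite eo ?mulr0 ?add0r// => kn; exact: nk.
Qed.

Hypothesis complete : forall f, H f -> (forall n, L n -> ip f (e n) = 0) -> f = (fun=> 0).

(** Let s be a finite combination close to f, and P the partial Fourier sum over a set containing
    the indices of s. As P s = s, f - P f = (f - s) - P (f - s) has norm at most ||f - s||;
    Cauchy-Schwarz against g concludes. *)
Lemma parseval f g : H f -> H g ->
  has_usum L (fun n => fourier_coef f n * ip (e n) g) (ip f g).
Proof.
move=> Hf Hg; apply/has_usumP => eps eps0.
have g10 : 0 < nsq g + 1 by rewrite ltr_wpDl// (nsq_ge0 HH).
(* The added 1 covers g = 0. *)
have d0 : 0 < eps ^+ 2 / (nsq g + 1) by rewrite divr_gt0// exprn_gt0.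
have SS := lsubspace_spanned He.
have [|s Ss sP] := lsubspace_dense HH SS _ Hf d0.
  move=> h Hh hS; apply: complete => // n Ln; apply: hS.
  exists [:: (1, n)]; first by move=> p; rewrite inE => /eqP ->.
  by apply/funext => z; rewrite /lincomb big_seq1 mul1r.
have Hs : H s by case: SS => _ _ _; exact.
have [F0 [F0L F0P]] := fincomb_spanned Ss; exists F0; split => // F F0F FL.
have HPf := H_fincomb (fourier_coef f) FL; have HPs := H_fincomb (fourier_coef s) FL.
rewrite -ip_fincombl// -(ipBl HH)//.
have Hd := H_B HH HPf Hf.
have Hfs := H_B HH Hf Hs.
have : nsq (fun z => fincomb (fourier_coef f) F z - f z) <= nsq (fun z => f z - s z).
  rewrite (nsqBC HH HPf Hf); apply: le_trans (nsq_sub_fincomb Hfs FL).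
  rewrite le_eqVlt; apply/orP; left; apply/eqP; congr nsq; apply/funext => z.
  have -> : fincomb (fourier_coef (fun z => f z - s z)) F z = fincomb (fourier_coef f) F z - fincomb (fourier_coef s) F z.
    rewrite /fincomb -sumrB big_seq [in RHS]big_seq; apply: eq_bigr => n /FL Ln.
    by rewrite /fourier_coef (ipBl HH Hf Hs (He Ln)) !mulrBl.
  by rewrite F0P// opprB addrA subrK.
move=> le1; have := cauchy_schwarz HH Hd Hg.
move=> le2; rewrite -(@ltr_pXn2r _ 2)// ?nnegrE ?cmod_ge0 ?(ltW eps0)//.
apply: (le_lt_trans le2); apply: (@le_lt_trans _ _ (nsq (fun z => f z - s z) * nsq g)).
  by rewrite ler_wpM2r// (nsq_ge0 HH).
apply: (@le_lt_trans _ _ (nsq (fun z => f z - s z) * (nsq g + 1))).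
  by rewrite ler_wpM2l ?(nsq_ge0 HH)// lerDl.
by rewrite -ltr_pdivlMr.
Qed.

Lemma nsq_fincomb c F : [set` F] `<=` L ->
  (nsq (fincomb c F))%:C%C = \sum_(n <- F) `|c n| ^+ 2 * (nsq (e n))%:C%C :> C.
Proof.
move=> FL; have HF := H_fincomb c FL; rewrite -(ipE HH HF) ip_fincombl//.
rewrite big_seq [RHS]big_seq; apply: eq_bigr => n nF; have Ln := FL n nF.
rewrite (ipC HH HF (He Ln)) ip_fincomb_e// nF rmorphM sqr_normc mulrA.
by congr (_ * _); exact: conjc_real.
Qed.

Lemma nsq_fincombB c F G : [set` F] `<=` [set` G] -> [set` G] `<=` L ->
  (nsq (fun z => fincomb c G z - fincomb c F z))%:C%C =
   \sum_(n <- G) `|c n| ^+ 2 * (nsq (e n))%:C%C -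
   \sum_(n <- F) `|c n| ^+ 2 * (nsq (e n))%:C%C :> C.
Proof.
move=> FG GL.
have GFL : [set` (G `\` F)%fset] `<=` L.
  by move=> x /=; rewrite inE => /andP[_ xG]; exact: GL.
have split_sum (T : zmodType) (v : mi -> T) :
    \sum_(n <- G) v n - \sum_(n <- F) v n = \sum_(n <- (G `\` F)%fset) v n.
  rewrite (big_fsetID _ (fun x => x \in F)) /= addrC.
  rewrite (_ : [fset x in G | x \in F]%fset = F); last first.
    apply/fsetP => x; rewrite !inE /=; apply/andP/idP => [[]//|xF].
    by split=> //; exact: FG.
  rewrite addrK; apply: eq_fbigl => x; rewrite !inE /=.
  by rewrite andbC.
rewrite split_sum -nsq_fincomb//; congr (_ %:C)%C; congr nsq.
by apply/funext => z; rewrite /fincomb split_sum.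
Qed.

(** Finite sets F k whose tails are O(1/(k+1)) give partial sums u k. The F k need not be nested, so
    u k and u l are compared through the union of their index sets. *)
Lemma riesz_fischer (c : mi -> C) (s : C) :
  has_usum L (fun n => `|c n| ^+ 2 * (nsq (e n))%:C%C) s ->
  exists2 f, H f & forall n, L n -> ip f (e n) = c n * (nsq (e n))%:C%C.
Proof.
move=> /has_usumP sc; pose w n : C := `|c n| ^+ 2 * (nsq (e n))%:C%C.
have [F FP] : exists F : nat -> {fset mi}, forall k, [set` F k] `<=` L /\
    forall G : {fset mi}, [set` F k] `<=` [set` G] -> [set` G] `<=` L ->
      cmod (\sum_(i <- G) w i - s) < k.+1%:R^-1.
  suff /choice[F FP] k : exists F : {fset mi}, [set` F] `<=` L /\
    forall G : {fset mi}, [set` F] `<=` [set` G] -> [set` G] `<=` L ->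
      cmod (\sum_(i <- G) w i - s) < k.+1%:R^-1 by exists F.
  by apply: sc; rewrite invr_gt0.
have FL k : [set` F k] `<=` L by case: (FP k).
have tail k (G : {fset mi}) : [set` F k] `<=` [set` G] -> [set` G] `<=` L ->
    nsq (fun z => fincomb c G z - fincomb c (F k) z) <= 2 * k.+1%:R^-1.
  move=> FG GL; have [_ Fk] := FP k.
  have h1 := Fk G FG GL; have h2 := Fk (F k) (fun x xF => xF) (FL k).
  have HB := H_B HH (H_fincomb c GL) (H_fincomb c (FL k)).
  rewrite -[leLHS]ger0_norm ?(nsq_ge0 HH)// -cmod_real nsq_fincombB//.
  have := cmodB (\sum_(i <- G) w i - s) (\sum_(i <- F k) w i - s).
  by rewrite opprB addrA subrK; move: h1 h2; move: (k.+1%:R^-1) => x; lra.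
pose u k := fincomb c (F k).
have Hu k : H (u k) by exact: H_fincomb.
have [|f Hf fu] := @H_complete _ _ _ _ _ HH u 4 Hu.
  move=> k l; pose G := (F k `|` F l)%fset.
  have GL : [set` G] `<=` L by exact: fsetU_sub.
  have kG := tail k G; have lG := tail l G.
  have {}kG := kG (fun x (xF : x \in F k) => ltac:(by rewrite /= inE xF)) GL.
  have {}lG := lG (fun x (xF : x \in F l) => ltac:(by rewrite /= inE xF orbT)) GL.
  have := nsqB_le HH (Hu k) (Hu l) (H_fincomb c GL).
  rewrite (nsqBC HH (Hu k) (H_fincomb c GL)).
  by move: kG lG; rewrite -/(u k) -/(u l);
    move: (k.+1%:R^-1) (l.+1%:R^-1) => x y; lra.
exists f => // n Ln; have Hn := He Ln.
apply/eqP; rewrite -subr_eq0 -cmod_eq0 -sqrf_eq0 eq_le sqr_ge0 andbT.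
rewrite leNgt; apply/negP; set q := cmod _ ^+ 2 => q0.
have n0 := nsq_e_gt0 Ln.
have e0 : 0 < q / (8 * nsq (e n)) by rewrite divr_gt0// mulr_gt0.
have [K KP] := fu _ e0.
pose k := maxn K (Num.truncn (q / (8 * nsq (e n)))^-1).
have l1 := KP k (leq_maxl _ _).
have l2 : k.+1%:R^-1 < q / (8 * nsq (e n)).
  by apply: invS_lt => //; exact: leq_maxr.
(* n need not belong to F k; adding it changes u k by no more than the tail allows. *)
have l3 : cmod (c n * (nsq (e n))%:C%C - ip (u k) (e n)) ^+ 2 <=
    2 * k.+1%:R^-1 * nsq (e n).
  pose G := (n |` F k)%fset.
  have GL : [set` G] `<=` L by move=> x /=; rewrite !inE => /orP[/eqP->|/FL].
  have nG : n \in G by rewrite !inE eqxx.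
  have FG : [set` F k] `<=` [set` G] by move=> x /= xF; rewrite !inE xF orbT.
  have := cauchy_schwarz HH (H_B HH (H_fincomb c GL) (Hu k)) Hn.
  rewrite (ipBl HH (H_fincomb c GL) (Hu k) Hn) (ip_fincomb_e c GL Ln) nG.
  move=> h; apply: (le_trans h); rewrite ler_wpM2r ?(ltW n0)//.
  exact: tail.
have l4 := cauchy_schwarz HH (H_B HH (Hu k) Hf) Hn.
rewrite (ipBl HH (Hu k) Hf Hn) in l4.
have := sqr_cmodD (c n * (nsq (e n))%:C%C - ip (u k) (e n)) (ip (u k) (e n) - ip f (e n)).
rewrite addrA subrK cmodBC -/q.
have b1 : 2 * k.+1%:R^-1 * nsq (e n) < q / 4.
  move: l2; rewrite ltr_pdivlMr ?mulr_gt0//; move: (k.+1%:R^-1) (nsq (e n)) => x y; lra.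
have b2 : nsq (fun z => u k z - f z) * nsq (e n) < q / 8.
  by rewrite -ltr_pdivlMr// -mulrA -invfM.
move: (le_lt_trans l3 b1) (le_lt_trans l4 b2).
set x := cmod (_ - ip (u k) _) ^+ 2; set y := cmod (ip (u k) _ - _) ^+ 2.
by move: x y => x y; lra.
Qed.

End Orthogonal.

(** * Torus-invariant reproducing kernels *)

Section Setting.
Variables (R : realType) (m : nat).
Local Notation C := (CC R).
Local Notation pt := (pt R m).
Local Notation fn := (fn R m).
Local Notation mi := (mi m).

Lemma square_compact (r : R) :
  compact [set w : C | - r <= Re w <= r /\ - r <= Im w <= r].
Proof.
pose g (p : R * R) : C := Complex p.1 p.2.
rewrite (_ : mkset _ = g @` (`[- r, r]%classic `*` `[- r, r]%classic)).
  apply: continuous_compact; last by apply: compact_setX; exact: segment_compact.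
  apply: continuous_subspaceT => -[x y].
  apply/cvgrPdist_le => /= eps /complex_gt0P[e e0 ->].
  have e20 : 0 < e / 2 by rewrite divr_gt0.
  near=> p; rewrite cmodE lecR (le_trans (cmod_le _))// ReB ImB /= [leRHS]splitr.
  apply: lerD; near: p.
    have : fst @ (x, y) --> x by exact: cvg_fst.
    by move=> /cvgrPdist_le/(_ _ e20).
  have : snd @ (x, y) --> y by exact: cvg_snd.
  by move=> /cvgrPdist_le/(_ _ e20).
apply/seteqP; split=> [w [/= h1 h2]|_ [[x y] [/= h1 h2] <-]].
  by exists (Re w, Im w) => /=; [rewrite !in_itv|case: (w)].
by move: h1 h2; rewrite !in_itv.
Unshelve. all: by end_near. Qed.

Lemma polysquare_compact (r : R) :
  compact [set z : pt | forall j, - r <= Re (z 0 j) <= r /\ - r <= Im (z 0 j) <= r].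
Proof.
exact: (@rV_compact C m (fun=> _) (fun=> @square_compact r)).
Qed.

(** Continuity of the inclusion is stated for compact sets, the Taylor estimates for open polydiscs.
    A product of closed squares lies between the two: |w| <= |Re w| + |Im w| <= 2 r < 3 r. *)
Lemma pdisc_compact_sub (r : R) : 0 < r -> exists K : set pt,
  [/\ compact K, pdisc 0 r `<=` K & K `<=` pdisc 0 (3 * r)].
Proof.
move=> r0.
exists [set z : pt | forall j, - r <= Re (z 0 j) <= r /\ - r <= Im (z 0 j) <= r].
split; first exact: polysquare_compact.
- move=> z zr j; have := zr j; rewrite mxE subr0 => /ltW zj.
  by split; rewrite -ler_norml (le_trans _ zj)// ?Re_le_cmod// Im_le_cmod.
- move=> z zr j; rewrite mxE subr0 (le_lt_trans (cmod_le _))//.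
  by have [] := zr j; rewrite -!ler_norml; lra.
Qed.

Variables (Om : set pt) (H : set fn) (ip : fn -> fn -> C) (kappa : pt -> pt -> C).
Hypotheses (hR : reinhardt_domain Om) (O0 : Om 0).
Hypothesis HH : hilbert_fun_space Om H ip.
Hypothesis rk : reproducing_kernel Om H ip kappa.
Hypothesis ci : coord_invariant H.
Hypothesis hc : hol_cont_incl Om H ip.
Local Notation nsq := (nsq ip).
Implicit Types (f g h : fn) (z w : pt) (n k : mi) (zeta : pt).

Lemma Om_opn : opn Om.
Proof. by case: hR => /open_opn. Qed.

Lemma Om_connected : connected Om.
Proof. by case: hR. Qed.

Lemma Om_tmul zeta z : torus zeta -> Om z -> Om (tmul zeta z).
Proof. by case: hR => _ _ _; exact. Qed.

Lemma H_holo f : H f -> holo Om f.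
Proof.
case: hc => + _ Hf z Oz => /(_ f Hf z Oz)/differentiable_hdiff fz.
by exists (fun j => pderiv j f z).
Qed.

Lemma restr_in g z : Om z -> restr Om g z = g z.
Proof. by rewrite /restr => /asboolP ->. Qed.

Lemma restr_out g z : ~ Om z -> restr Om g z = 0.
Proof. by rewrite /restr => /asboolPn/negbTE ->. Qed.

Lemma eq_on_Om f g : H f -> H g -> (forall z, Om z -> f z = g z) -> f = g.
Proof.
move=> Hf Hg fg; apply/funext => z; have [/fg//|nz] := pselect (Om z).
by rewrite (H_off HH Hf nz) (H_off HH Hg nz).
Qed.

Definition kerf w : fn := restr Om (fun z => kappa z w).

Lemma H_kerf w : Om w -> H (kerf w).
Proof. by move=> /rk[]. Qed.

Lemma kerf_eval w f : Om w -> H f -> f w = ip f (kerf w).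
Proof. by move=> /rk[_]; exact. Qed.

Lemma kerfE z w : Om z -> kappa z w = kerf w z.
Proof. by move=> Oz; rewrite /kerf restr_in. Qed.

(* Members of H vanish outside Om, whence the restriction. *)
Definition zmon n : fn := restr Om (fun z => monom z n).

Lemma holo_zmon n : holo Om (zmon n).
Proof.
apply: (holo_ext Om_opn _ (@holo_monom _ _ n Om)) => z Oz.
by rewrite /zmon restr_in.
Qed.

Lemma taylor_zmon k n : taylor_coef (zmon k) n = (n == k)%:R.
Proof.
rewrite -(taylor_monom R k n); apply: (taylor_ext Om_opn O0 _ (@holo_zmon k)) => z Oz.
by rewrite /zmon restr_in.
Qed.

Lemma zmon_neq0 n : zmon n <> (fun=> 0).
Proof.
move=> e0; have := taylor_zmon n n; rewrite eqxx e0 /taylor_coef Dn_Dseq Dseq0 mul0r.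
by move=> /esym/eqP; rewrite oner_eq0.
Qed.

Lemma H_zmon_add n j : H (zmon n) -> H (zmon (mi_addeps n j)).
Proof.
move=> Hn; rewrite (_ : zmon _ = (fun z => z 0 j * zmon n z)); first exact: ci.
apply/funext => z; have [Oz|nz] := pselect (Om z).
  by rewrite /zmon !restr_in// monom_add.
by rewrite /zmon !restr_out// mulr0.
Qed.

Lemma sup_bound (r : R) : 0 < r -> pdisc 0 (3 * r) `<=` Om ->
  exists2 c : R, 0 <= c & forall f, H f -> forall z, pdisc 0 r z ->
    cmod (f z) <= Num.sqrt (c * nsq f).
Proof.
move=> r0 rOm; have [K [cK rK Kr]] := pdisc_compact_sub r0.
have [_ /(_ K cK (subset_trans Kr rOm))[c cP]] := hc.
(* [c] is a complex number, but the order of [R[i]] compares real parts and the squared norm is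
   real. *)
exists `|Re c| => // f Hf z zr.
have -> : cmod (f z) = Num.sqrt (cmod (f z) ^+ 2).
  by rewrite sqrtr_sqr ger0_norm ?cmod_ge0.
rewrite ler_wsqrtr//.
have := cP f Hf z (rK z zr); rewrite cmodE -rmorphXn (ipE HH Hf) lecE => /andP[_].
rewrite /= [X in X <= _ -> _](_ : _ = cmod (f z) ^+ 2)//.
have -> : Re (c * (nsq f)%:C%C) = Re c * nsq f.
  by case: (c) => a b /=; rewrite mulr0 subr0.
move=> h; apply: (le_trans h); rewrite ler_wpM2r ?(nsq_ge0 HH)//; exact: ler_norm.
Qed.

Lemma taylor_bounded n : exists B : R, forall f, H f ->
  cmod (taylor_coef f n) ^+ 2 <= B * nsq f.
Proof.
have [r r0 rOm] := Om_opn O0.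
have r30 : 0 < r / 3 by rewrite divr_gt0.
have [|c c0 cP] := @sup_bound (r / 3) r30.
  by rewrite mulrC divfK.
have [K K0 KP] := @taylor_le R m (r / 3) n r30.
exists (K ^+ 2 * c) => f Hf.
have fU : holo (pdisc 0 (r / 3)) f.
  apply: holo_sub (H_holo Hf); apply: subset_trans rOm; apply: pdisc_le; lra.
have := KP f _ fU (cP f Hf) => h.
rewrite -mulrA -[c * _]sqr_sqrtr ?mulr_ge0 ?(nsq_ge0 HH)// -exprMn.
by rewrite lerXn2r ?nnegrE ?cmod_ge0 ?mulr_ge0 ?sqrtr_ge0.
Qed.

Lemma taylor_riesz n : exists2 g, H g & forall f, H f -> taylor_coef f n = ip f g.
Proof.
have [B BP] := taylor_bounded n.
apply: (riesz HH (L := fun f => taylor_coef f n) _ _ BP).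
- by move=> f g /H_holo fU /H_holo gU; exact: (taylorD Om_opn O0).
- by move=> a f /H_holo fU; exact: (taylorZ Om_opn O0).
Qed.

Lemma H_taylor_eq f g : H f -> holo Om g ->
  (forall n, taylor_coef f n = taylor_coef g n) -> forall z, Om z -> f z = g z.
Proof.
move=> Hf gU fg z Oz; apply/eqP; rewrite -subr_eq0; apply/eqP.
rewrite -mulN1r.
have mgU := holoZ (-1) gU.
apply: (taylor_eq0 Om_opn O0 Om_connected (holoD (H_holo Hf) mgU)) => // n.
by rewrite (taylorD Om_opn O0 n (H_holo Hf) mgU) (taylorZ Om_opn O0 _ n gU) fg mulN1r subrr.
Qed.

Lemma ip_ext f g : H f -> H g -> (forall h, H h -> ip h f = ip h g) -> f = g.
Proof.
move=> Hf Hg fg; have HB := H_B HH Hf Hg.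
have : (fun z => f z - g z) = (fun=> 0).
  apply: (nsq_eq0 HH HB); apply: complexI.
  by rewrite -(ipE HH HB) (ipBr HH Hf Hg HB) fg// subrr.
move=> e0; apply/funext => z; apply/eqP; rewrite -subr_eq0.
by have := congr1 (@^~ z) e0 => /= ->.
Qed.

(** * The torus action: equivalence of (1) and (2), and (4) from (2) *)

Definition tinv zeta : pt := \row_j (zeta 0 j)^-1.

Lemma torus_neq0 zeta j : torus zeta -> zeta 0 j != 0.
Proof. by move=> /(_ j) zj; rewrite -normr_eq0 zj oner_eq0. Qed.

Lemma torus_inv zeta : torus zeta -> torus (tinv zeta).
Proof. by move=> zT j; rewrite mxE normfV zT invr1. Qed.

Lemma tmulK zeta z : torus zeta -> tmul (tinv zeta) (tmul zeta z) = z.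
Proof. by move=> zT; apply/rowP => j; rewrite !mxE mulKf// torus_neq0. Qed.

Lemma tmulVK zeta z : torus zeta -> tmul zeta (tmul (tinv zeta) z) = z.
Proof. by move=> zT; apply/rowP => j; rewrite !mxE mulVKf// torus_neq0. Qed.

Lemma Om_tmul_inv zeta z : torus zeta -> Om (tmul zeta z) -> Om z.
Proof. by move=> zT /(Om_tmul (torus_inv zT)); rewrite tmulK. Qed.

Lemma torus_conj zeta j : torus zeta -> conjc (zeta 0 j) = (zeta 0 j)^-1.
Proof.
move=> zT; have := sqr_normc (zeta 0 j); rewrite (zT j) expr1n => e1.
by apply: (mulfI (torus_neq0 j zT)); rewrite divff ?torus_neq0.
Qed.

Lemma monom_tmul zeta z n : monom (tmul zeta z) n = monom zeta n * monom z n.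
Proof.
by rewrite /monom -big_split; apply: eq_bigr => j _; rewrite mxE exprMn.
Qed.

Lemma monom_tinv zeta n : torus zeta -> monom (tinv zeta) n = conjc (monom zeta n).
Proof.
move=> zT; rewrite /monom rmorph_prod; apply: eq_bigr => j _.
by rewrite mxE rmorphXn /= -torus_conj.
Qed.

(* f |-> f(zeta .) sends kernel functions to kernel functions and preserves their inner
   products; it extends isometrically to H because point evaluations are bounded. *)
Lemma cond1_imp_cond2 : cond1 Om kappa -> cond2 H ip.
Proof.
move=> c1 zeta zT; have zT' := torus_inv zT.
pose U f : fn := fun z => f (tmul zeta z).
have Uk w : Om w -> U (kerf w) = kerf (tmul (tinv zeta) w).
  move=> Ow; have Ow' := Om_tmul zT' Ow; apply/funext => z; rewrite /U /kerf.
  have [Oz|nz] := pselect (Om z); last first.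
    by rewrite !restr_out// => /(Om_tmul_inv zT).
  rewrite !restr_in//; last exact: Om_tmul.
  by rewrite -[in LHS](tmulVK w zT) c1.
have Hv w : Om w -> H (U (kerf w)) by move=> Ow; rewrite Uk//; apply: H_kerf; exact: Om_tmul.
pose S := spanned kerf Om.
have SS : lsubspace H S := lsubspace_spanned HH H_kerf.
have US s : S s -> H (U s).
  move=> [t tP ->]; rewrite (_ : U _ = lincomb (U \o kerf) t)//.
  by apply: (H_lincomb HH) => p /tP/Hv.
(* For s the kernel function at w this is evaluation: U s is the kernel function at zeta^-1 w, and
   (U f)(zeta^-1 w) = f w. Only s has to be a finite combination, as f gets approximated
   afterwards. *)
have iso f s : H f -> H (U f) -> S s -> ip (U f) (U s) = ip f s.
  move=> Hf HUf [t tP ->] {s}; elim: t tP => [_|p t IH tP].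
    rewrite (_ : U (lincomb kerf [::]) = (fun=> 0)); last by apply/funext => z; rewrite /U lincomb_nil.
    rewrite lincomb_nil (ipC HH (H_0 HH) HUf) (ipC HH (H_0 HH) Hf).
    by rewrite !(ip0l HH).
  have Op : Om p.2 by apply: tP; rewrite mem_head.
  have tP' q : q \in t -> Om q.2 by move=> qt; apply: tP; rewrite inE qt orbT.
  have Ht : S (lincomb kerf t) by exists t.
  have Ht' : H (lincomb kerf t) by case: SS => _ _ _; exact.
  rewrite (_ : U (lincomb kerf (p :: t)) = (fun z => p.1 * U (kerf p.2) z + U (lincomb kerf t) z)); last first.
    by apply/funext => z; rewrite /U lincomb_cons.
  rewrite lincomb_cons (ipDr HH (H_Z HH _ (H_kerf Op)) Ht' Hf).
  rewrite (ipDr HH (H_Z HH _ (Hv _ Op)) (US _ Ht) HUf) IH//.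
  rewrite (ipZr HH _ Hf (H_kerf Op)) (ipZr HH _ HUf (Hv _ Op)); congr (_ * _ + _).
  rewrite Uk// -kerf_eval//; last exact: Om_tmul.
  by rewrite /U tmulVK// kerf_eval.
have nsqU s : S s -> nsq (U s) = nsq s.
  move=> Ss; have Hs : H s by case: SS => _ _ _; exact.
  by apply: complexI; rewrite -(ipE HH Hs) -(ipE HH (US _ Ss)) iso//; exact: US.
have approx f : H f -> H (U f) /\ forall e : R, 0 < e -> exists2 s, S s &
    nsq (fun z => f z - s z) < e /\ nsq (fun z => U f z - U s z) < e.
  move=> Hf.
  have [s sP] : exists s : nat -> fn, forall k : nat, S (s k) /\
      nsq (fun z => f z - s k z) < k.+1%:R^-1.
    suff /choice[s sP] (k : nat) : exists s, S s /\ nsq (fun z => f z - s z) < k.+1%:R^-1.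
      by exists s.
    have [||s Ss sP] := @lsubspace_dense _ _ _ _ _ HH S f SS _ Hf k.+1%:R^-1.
    - move=> g Hg gS; apply: (eq_on_Om Hg (H_0 HH)) => z Oz.
      rewrite (kerf_eval Oz Hg); apply: gS; exists [:: (1, z)].
        by move=> p; rewrite inE => /eqP ->.
      by apply/funext => y; rewrite /lincomb big_seq1 mul1r.
    - by rewrite invr_gt0.
    - by exists s.
  have Ss (k : nat) : S (s k) by case: (sP k).
  have Hs (k : nat) : H (s k) by case: SS => _ _ _; exact.
  have HUs (k : nat) : H (U (s k)) by exact: US.
  have [|g Hg gP] := @H_complete _ _ _ _ _ HH (fun k : nat => U (s k)) 2 HUs.
    move=> k l; rewrite [leLHS](nsqU (fun z => s k z - s l z)); last first.
      exact: (lsubspaceB SS).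
    have := nsqB_le HH (Hs k) (Hs l) Hf; rewrite (nsqBC HH (Hs k) Hf).
    have [_] := sP k; have [_] := sP l.
    move: (nsq _) (nsq _) (nsq _) (k.+1%:R^-1) (l.+1%:R^-1) => a b c x y; lra.
  (* Convergence in H implies pointwise convergence, so the limit g of the U (s k) agrees with U f
     on Om. *)
  have gE : U f = g.
    apply/funext => z; have [Oz|nz] := pselect (Om z); last first.
      by rewrite (H_off HH Hg nz) /U (H_off HH Hf)// => /(Om_tmul_inv zT).
    have Oz' := Om_tmul zT Oz.
    apply/eqP; rewrite -subr_eq0 -cmod_eq0 -sqrf_eq0 eq_le sqr_ge0 andbT.
    rewrite leNgt; apply/negP; set q := cmod _ ^+ 2 => q0.
    (* A common bound for evaluation at z and at zeta z, positive thanks to the 1. *)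
    pose N := 1 + nsq (kerf z) + nsq (kerf (tmul zeta z)).
    have N1 := nsq_ge0 HH (H_kerf Oz); have N2 := nsq_ge0 HH (H_kerf Oz').
    have N0 : 0 < N by rewrite /N; lra.
    have e0 : 0 < q / (4 * N) by rewrite divr_gt0// mulr_gt0.
    have [K KP] := gP _ e0.
    pose k := maxn K (Num.truncn (q / (4 * N))^-1).
    have l1 := KP k (leq_maxl _ _).
    have l2 : k.+1%:R^-1 < q / (4 * N).
      by apply: invS_lt => //; exact: leq_maxr.
    have [_ l3] := sP k; have {}l3 := lt_trans l3 l2.
    have Hd1 := H_B HH Hf (Hs k); have Hd2 := H_B HH (HUs k) Hg.
    have c1' := cauchy_schwarz HH Hd1 (H_kerf Oz').
    have c2' := cauchy_schwarz HH Hd2 (H_kerf Oz).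
    rewrite -(kerf_eval Oz' Hd1) in c1'; rewrite -(kerf_eval Oz Hd2) in c2'.
    have := sqr_cmodD (f (tmul zeta z) - s k (tmul zeta z)) (U (s k) z - g z).
    rewrite [U (s k) z]/U addrA subrK -/(U f z) -/q.
    have m1 : nsq (fun z => f z - s k z) * nsq (kerf (tmul zeta z)) <= q / (4 * N) * N.
      apply: ler_pM (nsq_ge0 HH Hd1) N2 (ltW l3) _.
      by rewrite /N addrC lerDl addr_ge0.
    have m2 : nsq (fun z => U (s k) z - g z) * nsq (kerf z) < q / (4 * N) * N.
      apply: (@le_lt_trans _ _ (q / (4 * N) * nsq (kerf z))).
        by rewrite ler_wpM2r// ltW.
      by rewrite ltr_pM2l// /N -addrA addrCA ltrDl ltr_pwDl.
    have eqN : q / (4 * N) * N = q / 4 by field; exact: lt0r_neq0.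
    rewrite eqN in m1 m2.
    move: (le_trans c1' m1) (le_lt_trans c2' m2); rewrite [U (s k) z]/U.
    set x := cmod _ ^+ 2; set y := cmod _ ^+ 2; move: x y => x y; lra.
  rewrite gE; split=> // e e0.
  have [K KP] := gP e e0.
  pose k := maxn K (Num.truncn e^-1).
  exists (s k); first exact: Ss.
  have l2 : k.+1%:R^-1 < e.
    by apply: invS_lt => //; exact: leq_maxr.
  have [_ l3] := sP k; split; first exact: lt_trans l2.
  rewrite (nsqBC HH Hg (HUs k)); exact: KP (leq_maxl _ _).
split; first by move=> f /approx[].
move=> f g Hf Hg; rewrite -/(U f) -/(U g).
have [HUf _] := approx f Hf; have [HUg gP] := approx g Hg.
apply/eqP; rewrite -subr_eq0 -cmod_eq0 -sqrf_eq0 eq_le sqr_ge0 andbT.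
rewrite leNgt; apply/negP; set q := cmod _ ^+ 2 => q0.
pose N := 1 + nsq f + nsq (U f).
have N1 := nsq_ge0 HH Hf; have N2 := nsq_ge0 HH HUf.
have N0 : 0 < N by rewrite /N; lra.
have e0 : 0 < q / (4 * N) by rewrite divr_gt0// mulr_gt0.
have [s Ss [s1 s2]] := gP _ e0.
have Hs : H s by case: SS => _ _ _; exact.
have HUs := US s Ss.
have Hd1 := H_B HH Hg Hs; have Hd2 := H_B HH HUg HUs.
have c1' := cauchy_schwarz HH Hf Hd1.
have c2' := cauchy_schwarz HH HUf Hd2.
rewrite (ipBr HH Hg Hs Hf) in c1'; rewrite (ipBr HH HUg HUs HUf) in c2'.
have := sqr_cmodD (ip (U f) (U g) - ip (U f) (U s)) (- (ip f g - ip f s)).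
rewrite cmodN (iso f s Hf HUf Ss).
rewrite (_ : _ - _ + - _ = ip (U f) (U g) - ip f g) -/q; last by rewrite opprB addrA subrK.
rewrite (iso f s Hf HUf Ss) in c2'.
have m1 : nsq f * nsq (fun z => g z - s z) < q / 4.
  apply: (@le_lt_trans _ _ (nsq f * (q / (4 * N)))).
    by rewrite ler_wpM2l// ltW.
  apply: (@lt_le_trans _ _ (N * (q / (4 * N)))).
    by rewrite ltr_pM2r//; move: N1 N2; rewrite /N; lra.
  by rewrite le_eqVlt; apply/orP; left; apply/eqP; field; exact: lt0r_neq0.
have m2 : nsq (U f) * nsq (fun z => U g z - U s z) < q / 4.
  apply: (@le_lt_trans _ _ (nsq (U f) * (q / (4 * N)))).
    by rewrite ler_wpM2l// ltW.
  apply: (@lt_le_trans _ _ (N * (q / (4 * N)))).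
    by rewrite ltr_pM2r//; move: N1 N2; rewrite /N; lra.
  by rewrite le_eqVlt; apply/orP; left; apply/eqP; field; exact: lt0r_neq0.
move: (le_lt_trans c1' m1) (le_lt_trans c2' m2).
set x := cmod _ ^+ 2; set y := cmod _ ^+ 2; move: x y => x y; lra.
Qed.

(** The rotated kernel function reproduces values at w: its inner product with f is that of
    f(zeta^-1 .) with the kernel function at zeta w, which is f w. *)
Lemma cond2_imp_cond1 : cond2 H ip -> cond1 Om kappa.
Proof.
move=> c2 zeta zT z w Oz Ow; have zT' := torus_inv zT.
have [HT ipT] := c2 zeta zT; have [HT' _] := c2 _ zT'.
have Ozw := Om_tmul zT Ow; have Ozz := Om_tmul zT Oz.
rewrite kerfE// kerfE//.
suff <- : (fun z => kerf (tmul zeta w) (tmul zeta z)) = kerf w by [].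
apply: ip_ext; [exact/HT/H_kerf|exact: H_kerf|] => f Hf.
have fE : f = (fun z => f (tmul (tinv zeta) (tmul zeta z))).
  by apply/funext => y; rewrite tmulK.
rewrite [in LHS]fE (ipT (fun z => f (tmul (tinv zeta) z)))//; [|exact: HT'|exact: H_kerf].
by rewrite -kerf_eval//; [rewrite tmulK// kerf_eval|exact: HT'].
Qed.

(** Where k and n differ, say at j, take a root of -1 of order |k j - n j| in that coordinate and 1
    elsewhere: the two powers then differ by the factor -1. *)
Lemma torus_separates k n : k <> n -> exists2 zeta : pt, torus zeta & monom zeta k != monom zeta n.
Proof.
move=> kn; have [j jkn] : exists j, k j != n j.
  apply: contrapT => /forallNP h; apply: kn; apply/ffunP => j; apply/eqP.
  by have /negP := h j; rewrite negbK.
suff [u u1 ukn] : exists2 u : C, `|u| = 1 & u ^+ k j != u ^+ n j.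
  exists (\row_i (if i == j then u else 1)).
    by move=> i; rewrite mxE; case: eqP; rewrite ?normr1.
  have mE (p : mi) : monom (\row_i (if i == j then u else 1) : pt) p = u ^+ p j.
    rewrite /monom (bigD1 j)//= mxE eqxx big1 ?mulr1// => i /negbTE ij.
    by rewrite mxE ij expr1n.
  by rewrite !mE.
pose d := (maxn (k j) (n j) - minn (k j) (n j))%N.
have d0 : (0 < d)%N by move: jkn; rewrite subn_gt0 /maxn /minn; case: (ltngtP (k j) (n j)) => h.
exists (d.-root (-1 : R[i])).
  have := @norm_rootC R[i] d (-1); rewrite normrN1 => ->; exact: rootC1.
set u := d.-root _; have ud : u ^+ d = -1 by exact: rootCK.
have u0 : u != 0.
  apply/eqP => u0; move: ud; rewrite u0 expr0n (gtn_eqF d0) => /esym/eqP.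
  by rewrite oppr_eq0 oner_eq0.
have ne : u ^+ maxn (k j) (n j) != u ^+ minn (k j) (n j).
  rewrite -(subnK (leq_trans (geq_minl (k j) (n j)) (leq_maxl (k j) (n j)))) exprD -/d ud.
  rewrite mulN1r eq_sym -subr_eq0 opprK -mulr2n mulrn_eq0 /=.
  exact: expf_neq0.
by move: ne; rewrite /maxn /minn; case: ltnP => // _; rewrite eq_sym.
Qed.

Lemma ip_zmon_riesz n k g : (forall f, H f -> taylor_coef f n = ip f g) -> H (zmon k) ->
  ip (zmon k) g = (n == k)%:R.
Proof. by move=> gP Hk'; rewrite -gP// taylor_zmon. Qed.

Lemma cond2_imp_cond4 : cond2 H ip -> cond4 Om H ip [set n | H (zmon n)].
Proof.
move=> c2.
have gP n : exists g, H g /\ (forall f, H f -> taylor_coef f n = ip f g) /\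
    exists c : C, g = (fun z => c * zmon n z).
  have [g Hg gP] := taylor_riesz n; exists g; split => //; split => //.
  (* Uniqueness in Riesz' theorem makes g homogeneous of degree n. *)
  have ghom zeta : torus zeta -> (fun z => g (tmul zeta z)) = (fun z => monom zeta n * g z).
    move=> zT; have zT' := torus_inv zT.
    have [HT ipT] := c2 zeta zT; have [HT' _] := c2 _ zT'.
    apply: ip_ext; [exact: HT|exact: (H_Z HH)|] => f Hf.
    have fE : f = (fun z => f (tmul (tinv zeta) (tmul zeta z))).
      by apply/funext => y; rewrite tmulK.
    rewrite [in LHS]fE (ipT (fun z => f (tmul (tinv zeta) z)))//; last exact: HT'.
    rewrite -gP; last exact: HT'.
    rewrite (taylor_tmul Om_opn O0 n (H_holo Hf) zT'); last by move=> z; exact: Om_tmul.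
    by rewrite (ipZr HH _ Hf Hg) gP// monom_tinv.
  (* Comparing Taylor coefficients in the homogeneity relation gives (zeta^k - zeta^n) a_k(g) =
     0. *)
  have g0 k : k <> n -> taylor_coef g k = 0.
    move=> kn; have [zeta zT ne] := torus_separates kn.
    have := taylor_tmul Om_opn O0 k (H_holo Hg) zT (fun z => Om_tmul zT).
    rewrite ghom// (taylorZ Om_opn O0 _ k (H_holo Hg)) => /eqP.
    by rewrite -subr_eq0 -mulrBl mulf_eq0 subr_eq0 eq_sym (negbTE ne) => /eqP.
  exists (taylor_coef g n).
  apply/funext => z; have [Oz|nz] := pselect (Om z); last first.
    by rewrite (H_off HH Hg nz) /zmon restr_out// mulr0.
  have eU := holoZ (taylor_coef g n) (@holo_zmon n).
  apply: (H_taylor_eq Hg eU) Oz => k.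
  rewrite (taylorZ Om_opn O0 _ k (@holo_zmon n)) taylor_zmon.
  have [->|/eqP kn] := eqVneq k n; first by rewrite mulr1.
  by rewrite g0// mulr0.
split.
- by move=> n /= Hn j; exact: H_zmon_add.
- by [].
- move=> n n' /= Hn Hn' nn'.
  have [g [Hg [gn' [c gc]]]] := gP n'.
  (* The n'-th coefficient is 0 on z^n and 1 on z^n'; the latter shows c <> 0. *)
  have := ip_zmon_riesz gn' Hn; rewrite gc (ipZr HH _ Hn Hn').
  have := ip_zmon_riesz gn' Hn'; rewrite gc (ipZr HH _ Hn' Hn') eqxx => c1.
  have c0 : conjc c != 0.
    by apply/eqP => c0; move: c1; rewrite c0 mul0r => /esym/eqP; rewrite oner_eq0.
  have /negbTE -> : n' != n by apply/eqP => e; apply: nn'; rewrite e.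
  by move=> /eqP; rewrite mulf_eq0 (negbTE c0) => /eqP.
- move=> f Hf fn; apply: (eq_on_Om Hf (H_0 HH)).
  apply: (H_taylor_eq Hf (@holo_cst _ _ 0 Om)) => n.
  rewrite [RHS]/taylor_coef Dn_Dseq Dseq0 mul0r.
  have [g [Hg [gn [c gc]]]] := gP n; rewrite gn//.
  (* Either the n-th coefficient vanishes on all of H, or z^n is a multiple of g and lies in H,
     where f is orthogonal to it. *)
  have [c0|c0] := eqVneq c 0.
    rewrite (_ : g = (fun=> 0)); first by rewrite (ipC HH (H_0 HH) Hf) (ip0l HH) ?conjc0.
    by rewrite gc; apply/funext => z; rewrite c0 mul0r.
  have Hn : H (zmon n).
    rewrite (_ : zmon n = (fun z => c^-1 * g z)); first exact: (H_Z HH).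
    by apply/funext => z; rewrite gc mulKf.
  by rewrite gc (ipZr HH _ Hf Hn) (fn n Hn) mulr0.
Qed.

(** * Consequences of (4), the return from (5) to (1), and the equivalence of (3) and (4) *)

Lemma H_zmon L n : cond4 Om H ip L -> L n -> H (zmon n).
Proof. by case=> _ + _ _; exact. Qed.

Lemma cond4_orth L n k : cond4 Om H ip L -> L n -> L k -> n <> k -> ip (zmon n) (zmon k) = 0.
Proof. by case=> _ _ + _; exact. Qed.

Lemma cond4_complete L f : cond4 Om H ip L -> H f ->
  (forall n, L n -> ip f (zmon n) = 0) -> f = (fun=> 0).
Proof. by case=> _ _ _; exact. Qed.

Lemma ip_zmon_kerf n w : Om w -> H (zmon n) -> ip (zmon n) (kerf w) = monom w n.
Proof. by move=> Ow Hn; rewrite -kerf_eval// /zmon restr_in. Qed.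

(** Parseval for the kernel functions at w and z, with <z^n, kerf w> = w^n. *)
Lemma cond4_imp_cond5 L : cond4 Om H ip L -> cond5 Om kappa L (fun n => (nsq (zmon n))^-1).
Proof.
move=> c4; have He n := @H_zmon L n c4.
have n0 n (Ln : L n) := nsq_e_gt0 HH He (fun n _ => @zmon_neq0 n) Ln.
split; [by case: c4|by move=> n /n0; rewrite invr_gt0|].
move=> z w Oz Ow; rewrite kerfE// (kerf_eval Oz (H_kerf Ow)).
have := parseval HH He (fun n k => @cond4_orth L n k c4) (fun n _ => @zmon_neq0 n)
  (fun f => @cond4_complete L f c4) (H_kerf Ow) (H_kerf Oz).
apply: has_usum_eq => n Ln; have Hn := He n Ln.
rewrite /fourier_coef (ipC HH Hn (H_kerf Ow)) !ip_zmon_kerf// (fmorphV (real_complex R)).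
have eq3 (x y v : C) : x * y * v = y * v * x by ring.
exact: eq3.
Qed.

(** Each term is invariant, since zeta^n times its conjugate is 1, and unordered sums are unique. *)
Lemma cond5_imp_cond1 L alpha : cond5 Om kappa L alpha -> cond1 Om kappa.
Proof.
move=> [_ _ c5] zeta zT z w Oz Ow.
apply: (has_usum_unique (c5 _ _ (Om_tmul zT Oz) (Om_tmul zT Ow))).
apply: has_usum_eq (c5 z w Oz Ow) => n Ln.
rewrite !monom_tmul rmorphM; have z1 : monom zeta n * conjc (monom zeta n) = 1.
  rewrite -monom_tinv// /monom -big_split big1// => j _.
  by rewrite /= mxE -exprMn divff ?expr1n// torus_neq0.
have eq5 (al x y a b : C) : a * b = 1 -> al * x * y = al * (a * x) * (b * y).
  move=> ab; rewrite (_ : al * (a * x) * (b * y) = a * b * (al * x * y)); last by ring.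
  by rewrite ab mul1r.
exact: eq5 z1.
Qed.

(** The Riesz representative of the n-th coefficient is identified by its inner products with the
    basis: z^n / ||z^n||^2 for n in L, and 0 otherwise. *)
Lemma cond4_taylor L f n : cond4 Om H ip L -> H f ->
  taylor_coef f n = if `[< L n >] then ip f (zmon n) / (nsq (zmon n))%:C%C else 0.
Proof.
move=> c4 Hf; have He k := @H_zmon L k c4.
have [g Hg gP] := taylor_riesz n; rewrite gP//.
case: asboolP => Ln; last first.
  rewrite (_ : g = (fun=> 0)); first by rewrite (ipC HH (H_0 HH) Hf) (ip0l HH)// conjc0.
  apply: (cond4_complete c4 Hg) => k Lk; have Hk' := He k Lk.
  rewrite (ipC HH Hk' Hg) (ip_zmon_riesz gP Hk').
  have [nk|_] := eqVneq n k; first by rewrite nk in Ln.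
  exact: conjc0.
have Hn := He n Ln.
have n0 := nsq_e_neq0 HH He (fun n _ => @zmon_neq0 n) Ln.
set c : C := (nsq (zmon n))%:C%C in n0 *.
have HZ := H_Z HH c^-1 Hn.
have -> : g = (fun z => c^-1 * zmon n z).
  have HB := H_B HH Hg HZ.
  have : (fun z => g z - c^-1 * zmon n z) = (fun=> 0).
    apply: (cond4_complete c4 HB) => k Lk; have Hk' := He k Lk.
    rewrite (ipBl HH Hg HZ Hk') (ipZl HH _ Hn Hk') (ipC HH Hk' Hg) (ip_zmon_riesz gP Hk').
    have [<-|/eqP nk] := eqVneq n k.
      by rewrite (ipE HH Hn) mulVf// conjc1 subrr.
    by rewrite (cond4_orth c4 Ln Lk nk) mulr0 conjc0 subrr.
  move=> e0; apply/funext => z; apply/eqP; rewrite -subr_eq0.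
  by have := congr1 (@^~ z) e0 => /= ->.
rewrite (ipZr HH _ Hf Hn) mulrC; congr (_ * _).
rewrite fmorphV; congr (_^-1); exact: conjc_real.
Qed.

(** If z^n were in H with n outside L, its n-th Taylor coefficient would be both 1 and 0. *)
Lemma cond4_unique L n : cond4 Om H ip L -> L n <-> H (zmon n).
Proof.
move=> c4; split; first exact: H_zmon.
move=> Hn; apply: contrapT => nL.
have := cond4_taylor n c4 Hn; rewrite taylor_zmon eqxx; case: asboolP => // _.
by move=> /eqP; rewrite oner_eq0.
Qed.

Lemma has_usum_restrict (D L : set mi) (a : mi -> C) (s : C) : L `<=` D ->
  (forall n, ~ L n -> a n = 0) -> has_usum D a s -> has_usum L a s.
Proof.
move=> LD a0 sa e e0; have [F0 [F0D F0P]] := sa e e0.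
pose F1 := [fset x in F0 | `[< L x >]]%fset.
exists F1; split; first by move=> x /=; rewrite !inE /= => /andP[_ /asboolP].
move=> F F1F FL.
have -> : \sum_(i <- F) a i = \sum_(i <- (F `|` F0)%fset) a i.
  rewrite [RHS](big_fsetID _ (fun x => x \in F))/= -[LHS]addr0; congr (_ + _).
    by apply: eq_fbigl => x; rewrite !inE /= andbC; case: (x \in F).
  rewrite big_seq big1// => x; rewrite !inE /= => /andP[/orP[->//|xF0] xF].
  apply: a0 => Lx; move/negP: xF; apply; apply: F1F.
  by rewrite /= !inE /= xF0; exact/asboolP.
apply: F0P; first by move=> x /= xF0; rewrite inE xF0 orbT.
by apply: fsetU_sub => //; exact: subset_trans LD.
Qed.

Lemma cond4_imp_cond3 L : cond4 Om H ip L ->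
  cond3 H ip (fun n => if `[< L n >] then Num.sqrt (nsq (zmon n)) else 1) L.
Proof.
move=> c4; have He n := @H_zmon L n c4.
have n0 n (Ln : L n) := nsq_e_gt0 HH He (fun n _ => @zmon_neq0 n) Ln.
(* beta n = ||z^n|| on L. The value 1 elsewhere only ensures positivity, the coefficients being 0
   there. *)
set beta := fun n => _.
have beta2 n : L n -> (real_complex R (beta n) : C) ^+ 2 = (nsq (zmon n))%:C%C.
  move=> Ln; rewrite /beta; case: asboolP => // _.
  by rewrite -rmorphXn sqr_sqrtr// ltW// n0.
split.
- move=> n; rewrite /beta; case: asboolP => // Ln.
  by rewrite sqrtr_gt0 n0.
- by case: c4.
- move=> f Hf; have t0 n : ~ L n -> taylor_coef f n = 0.
    by move=> nL; rewrite (cond4_taylor n c4 Hf); case: asboolP.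
  split => //.
  apply: (@has_usum_widen _ _ L) => //.
    by move=> n /t0 ->; rewrite normr0 expr0n mul0r.
  have := parseval HH He (fun n k => @cond4_orth L n k c4) (fun n _ => @zmon_neq0 n)
    (fun f => @cond4_complete L f c4) Hf Hf.
  apply: has_usum_eq => n Ln; have Hn := He n Ln.
  rewrite (cond4_taylor n c4 Hf); case: asboolP => // _.
  rewrite beta2// sqr_normc /fourier_coef (ipC HH Hf Hn).
  have c0 := nsq_e_neq0 HH He (fun n _ => @zmon_neq0 n) Ln.
  rewrite [X in _ = _ * X * _](_ : _ = conjc (ip f (zmon n)) / (nsq (zmon n))%:C%C).
    by field.
  by rewrite rmorphM fmorphV; congr (_ * _^-1); exact: conjc_real.
- move=> a a0 [s sa].
  have [|f Hf fP] := riesz_fischer HH He (fun n k => @cond4_orth L n k c4)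
     (fun n _ => @zmon_neq0 n) (c := a) (s := s).
    have := @has_usum_restrict setT L _ s (fun _ _ => I) _ sa.
    move=> h; apply: has_usum_eq (h _); last by move=> n /a0 ->; rewrite normr0 expr0n mul0r.
    by move=> n Ln; rewrite beta2.
  exists f => // n; rewrite (cond4_taylor n c4 Hf); case: asboolP => Ln; last by rewrite a0.
  rewrite fP// mulfK//.
  exact: (nsq_e_neq0 HH He (fun n _ => @zmon_neq0 n) Ln).
Qed.

(** The surjectivity half of (3) yields an element of H with the Taylor series of z^n, which is z^n
    by the identity theorem; the norm half yields the inner products. *)
Lemma cond3_imp_cond4 beta L : cond3 H ip beta L -> cond4 Om H ip L.
Proof.
move=> [b0 indL c3a c3b].
have b2 n : (real_complex R (beta n) : C) ^+ 2 != 0.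
  exact: expf_neq0 (complexR_neq0 (b0 n)).
have He n : L n -> H (zmon n).
  move=> Ln; have [||f Hf fP] := c3b (fun k => (k == n)%:R : C).
  - by move=> k kL; case: eqP => // kn; rewrite kn in kL.
  - exists (0 + (real_complex R (beta n) : C) ^+ 2).
    have := @has_usum_delta R m setT (fun=> 0) 0 ((real_complex R (beta n) : C) ^+ 2) n I
      (@has_usum0 R m setT).
    apply: has_usum_eq => k _; rewrite add0r; case: eqP => [->|_].
      by rewrite normr1 expr1n mul1r.
    by rewrite normr0 expr0n mul0r.
  rewrite (_ : zmon n = f)//; apply/funext => z.
  have [Oz|nz] := pselect (Om z); last by rewrite (H_off HH Hf nz) /zmon restr_out.
  apply/esym; apply: (H_taylor_eq Hf (@holo_zmon n)) Oz => k.
  by rewrite fP taylor_zmon.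
(* (3) only gives norms: the inner product with z^n is recovered by polarisation. *)
have key f n (c : C) : H f -> L n ->
    ip (fun z => f z + c * zmon n z) (fun z => f z + c * zmon n z) =
    ip f f + (`|taylor_coef f n + c| ^+ 2 - `|taylor_coef f n| ^+ 2) *
      (real_complex R (beta n) : C) ^+ 2.
  move=> Hf Ln; have Hn := He n Ln.
  have Hg := H_D HH Hf (H_Z HH c Hn).
  have [_ sg] := c3a _ Hg; have [_ sf] := c3a _ Hf.
  apply: (has_usum_unique sg).
  have := has_usum_delta ((`|taylor_coef f n + c| ^+ 2 - `|taylor_coef f n| ^+ 2) *
      (real_complex R (beta n) : C) ^+ 2) (I : setT n) sf.
  apply: has_usum_eq => k _.
  rewrite (taylorD Om_opn O0 k (H_holo Hf) (holoZ c (@holo_zmon n))).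
  rewrite (taylorZ Om_opn O0 c k (@holo_zmon n)) taylor_zmon.
  have [->|_] := eqVneq k n; first by rewrite mulr1 mulrBl addrC subrK.
  by rewrite mulr0 !addr0.
have ipn f n : H f -> L n ->
    ip f (zmon n) = taylor_coef f n * (real_complex R (beta n) : C) ^+ 2.
  move=> Hf Ln; have Hn := He n Ln.
  set a := taylor_coef f n; set b := _ ^+ 2.
  have nn : ip (zmon n) (zmon n) = b.
    have := key (fun=> 0) n 1 (H_0 HH) Ln.
    rewrite (_ : (fun z => _) = zmon n); last by apply/funext => z; rewrite add0r mul1r.
    rewrite (ip0l HH (H_0 HH)) /taylor_coef Dn_Dseq Dseq0 mul0r !add0r normr1 normr0.
    by rewrite expr1n expr0n subr0 mul1r.
  have ex (c : C) : conjc c * ip f (zmon n) + c * conjc (ip f (zmon n)) =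
      (conjc c * a + c * conjc a) * b.
    have := key f n c Hf Ln; have HcE := H_Z HH c Hn; have Hg := H_D HH Hf HcE.
    rewrite (ipDl HH Hf HcE Hg) !(ipDr HH Hf HcE)// !(ipZl HH c Hn)// !(ipZr HH c)//.
    rewrite nn (ipC HH Hf Hn) -/a -/b !sqr_normc rmorphD.
    rewrite -addrA => /addrI.
    set x := ip f (zmon n); set cc := conjc c; set aa := conjc a => e1.
    apply: (@addIr _ (c * (cc * b))).
    rewrite -addrA e1; ring.
  (* c = 1 gives the sum of <f, z^n> and its conjugate, c = i their difference. *)
  have e1 := ex 1; have e2 := ex (Complex 0 1).
  rewrite !conjc1 !mul1r in e1.
  have ci' : conjc (Complex 0 1 : C) = - Complex 0 1 :> C.
    by apply/eqP; rewrite eq_complex /= oppr0 !eqxx.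
  rewrite ci' in e2.
  have i0 : (Complex 0 1 : C) != 0 by rewrite -cmod_gt0 cmod_i.
  have e3 : ip f (zmon n) - conjc (ip f (zmon n)) = (a - conjc a) * b.
    apply: (mulfI (x := - Complex 0 1 : C)); first by rewrite oppr_eq0.
    by rewrite mulrBr [X in _ - X]mulNr opprK e2; ring.
  have : ip f (zmon n) *+ 2 = (a * b) *+ 2.
    rewrite -[LHS](_ : (ip f (zmon n) + conjc (ip f (zmon n))) +
       (ip f (zmon n) - conjc (ip f (zmon n))) = _); last by ring.
    by rewrite e1 e3; ring.
  move=> /eqP; rewrite -subr_eq0 -mulrnBl mulrn_eq0 /= subr_eq0 => /eqP ->.
  by [].
split => //.
- move=> n n' Ln Ln' nn'; rewrite -/(zmon n) -/(zmon n') (ipn _ _ (He n Ln) Ln').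
  rewrite taylor_zmon; have /negbTE -> : n' != n by apply/eqP => e; apply: nn'; rewrite e.
  by rewrite mul0r.
- move=> f Hf fn; apply: (eq_on_Om Hf (H_0 HH)).
  apply: (H_taylor_eq Hf (@holo_cst _ _ 0 Om)) => n.
  rewrite [RHS]/taylor_coef Dn_Dseq Dseq0 mul0r.
  have [Ln|nL] := pselect (L n); last by have [h _] := c3a f Hf; exact: h.
  have := fn n Ln; rewrite -/(zmon n) ipn// => /eqP.
  by rewrite mulf_eq0 (negbTE (b2 n)) orbF => /eqP.
Qed.

(** * Recovering the index set from the expansion of the kernel *)

Lemma lincomb_monom_holo (s : seq (C * mi)) :
  holo Om (lincomb (fun n z => monom z n) s) /\
  forall n, taylor_coef (lincomb (fun n z => monom z n) s) n =
    \sum_(p <- s) p.1 * (n == p.2)%:R.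
Proof.
elim: s => [|p s [IH1 IH2]].
  rewrite lincomb_nil; split; first exact: holo_cst.
  by move=> n; rewrite /taylor_coef Dn_Dseq Dseq0 mul0r big_nil.
rewrite lincomb_cons; have mU := @holo_monom R m p.2 Om.
split; first exact: (holoD (holoZ _ mU) IH1).
move=> n; rewrite (taylorD Om_opn O0 n (holoZ _ mU) IH1) IH2 big_cons.
by rewrite (taylorZ Om_opn O0 _ n mU) taylor_monom.
Qed.

(* With w = (d, ..., d), every term of the series at (z, w), z in the polydisc of radius d, is
   dominated by the positive term at (w, w): the series converges uniformly in z and its
   Taylor coefficients may be read off. *)
Lemma cond5_taylor L alpha (d : R) n : cond5 Om kappa L alpha -> 0 < d ->
  pdisc 0 (2 * d) `<=` Om ->
  let w : pt := \row_j d%:C%C in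
  taylor_coef (kerf w) n = if `[< L n >] then (real_complex R (alpha n) : C) * conjc (monom w n) else 0.
Proof.
move=> [_ a0 c5] d0 dO w.
have Ow : Om w.
  by apply: dO => j; rewrite !mxE subr0 cmod_real gtr0_norm//; lra.
set t := (if _ then _ else _); apply/eqP; rewrite -subr_eq0 -cmod_eq0.
rewrite eq_le cmod_ge0 andbT.
have [K K0 KP] := @taylor_le R m d n d0.
rewrite leNgt; apply/negP => q0.
set q := cmod _ in q0.
have K10 : 0 < 3 * (K + 1) by rewrite mulr_gt0// ltr_wpDl.
have e0 : 0 < q / (3 * (K + 1)) by rewrite divr_gt0.
(* The difference g below is bounded by 3 eps, so its n-th coefficient is at most 3 K eps < q,
   against the definition of q. *)
set eps := q / _ in e0.
pose T (z : pt) k : C := (real_complex R (alpha k) : C) * monom z k * conjc (monom w k).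
have sT z : Om z -> has_usum L (T z) (kappa z w) by move=> Oz; exact: c5.
have := sT w Ow => /has_usumP/(_ _ e0)[F0 [F0L F0P]].
(* When n is in L it is put into F, so that the n-th coefficient of the partial sum is exactly t. *)
pose F : {fset mi} := if `[< L n >] then (n |` F0)%fset else F0.
have F0F : [set` F0] `<=` [set` F].
  by move=> x /= xF; rewrite /F; case: asboolP => // _; rewrite !inE xF orbT.
have FL : [set` F] `<=` L.
  by rewrite /F; case: asboolP => // Ln x /=; rewrite !inE => /orP[/eqP->|/F0L].
pose s := [seq ((real_complex R (alpha k) : C) * conjc (monom w k), k) | k <- F].
have [sU sTay] := lincomb_monom_holo s.
pose g : fn := fun z => kerf w z + (-1) * lincomb (fun n z => monom z n) s z.
have gU : holo Om g by apply: holoD (H_holo (H_kerf Ow)) (holoZ _ sU).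
have gTay : taylor_coef g n = taylor_coef (kerf w) n - t.
  rewrite (taylorD Om_opn O0 n (H_holo (H_kerf Ow)) (holoZ _ sU)) (taylorZ Om_opn O0 _ n sU).
  rewrite sTay mulN1r big_map /=; congr (_ - _).
  rewrite /t /F; case: asboolP => Ln.
    rewrite (bigD1_seq n) ?fset_uniq ?inE ?eqxx//= mulr1 big1 ?addr0// => k /negbTE.
    by rewrite eq_sym => ->; rewrite mulr0.
  rewrite big_seq big1// => k /F0L Lk; case: eqP => [nk|_]; last by rewrite mulr0.
  by rewrite nk in Ln.
have dOm : pdisc 0 d `<=` Om by apply: subset_trans dO; apply: pdisc_le; lra.
have gM z : pdisc 0 d z -> cmod (g z) <= 3 * eps.
  move=> zd; have Oz := dOm z zd.
  have := sT z Oz => /has_usumP/(_ _ e0)[F1 [F1L F1P]].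
  pose G := (F `|` F1)%fset.
  have GL : [set` G] `<=` L by exact: fsetU_sub.
  have FG : [set` F] `<=` [set` G] by move=> x /= xF; rewrite inE xF.
  have h1 : cmod (\sum_(k <- G) T z k - kappa z w) < eps.
    by apply: F1P GL => x /= xF; rewrite inE xF orbT.
  have h2 : cmod (\sum_(k <- G) T w k - kappa w w) < eps.
    by apply: F0P GL; exact: subset_trans FG.
  have h3 : cmod (\sum_(k <- F) T w k - kappa w w) < eps by exact: F0P.
  have split_sum (v : mi -> C) :
      \sum_(k <- G) v k = \sum_(k <- F) v k + \sum_(k <- (G `\` F)%fset) v k.
    rewrite (big_fsetID _ (fun x => x \in F)) /=; congr (_ + _).
      apply: eq_fbigl => x; rewrite !inE /= andbC.
      by case: (x \in F).
    by apply: eq_fbigl => x; rewrite !inE /= andbC.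
  have gE : g z = (kappa z w - \sum_(k <- G) T z k) + \sum_(k <- (G `\` F)%fset) T z k.
    rewrite split_sum /g /kerf restr_in// mulN1r opprD addrA subrK; congr (_ - _).
    rewrite /lincomb big_map; apply: eq_bigr => k _ /=.
    by rewrite /T mulrAC.
  have Tle k : L k -> cmod (T z k) <= Re (T w k) /\ T w k = (Re (T w k))%:C%C.
    move=> Lk; have Twk : T w k = (alpha k * cmod (monom w k) ^+ 2)%:C%C.
      by rewrite /T -mulrA mul_conjc [RHS]rmorphM.
    rewrite Twk; split => //=.
    rewrite /T !cmodM cmod_real gtr0_norm ?a0// cmod_conjc -mulrA ler_wpM2l ?(ltW (a0 k Lk))//.
    rewrite expr2 ler_wpM2r ?cmod_ge0// /monom !cmod_prod.
    apply: ler_prod => j _; rewrite cmod_ge0 /= !cmodX lerXn2r ?nnegrE ?cmod_ge0//.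
    have := zd j; rewrite !mxE subr0 cmod_real (gtr0_norm d0); exact: ltW.
  (* At (w, w) the terms are nonnegative reals, and the sum over G minus F is a difference of two
     partial sums, each within eps of the total. *)
  have tail : cmod (\sum_(k <- (G `\` F)%fset) T z k) <= 2 * eps.
    have GFL k : k \in (G `\` F)%fset -> L k by rewrite inE => /andP[_ kG]; exact: GL.
    rewrite (le_trans (cmod_sum _ _ _))//.
    apply: (@le_trans _ _ (cmod (\sum_(k <- (G `\` F)%fset) T w k))); last first.
      have := cmodB (\sum_(k <- G) T w k - kappa w w) (\sum_(k <- F) T w k - kappa w w).
      rewrite opprB addrA subrK split_sum addrAC subrr add0r -split_sum.
      by move: h2 h3; lra.
    rewrite big_seq (eq_big_seq (fun k => (Re (T w k))%:C%C)); last first.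
      by move=> k /GFL /Tle[].
    rewrite -rmorph_sum cmod_real ger0_norm; last first.
      rewrite big_seq sumr_ge0// => k /GFL/Tle[h _]; exact: le_trans (cmod_ge0 _) h.
    by rewrite [leRHS]big_seq ler_sum// => k /GFL/Tle[].
  rewrite gE (le_trans (cmodD _ _))//.
  by move: h1 tail; rewrite (cmodBC (kappa z w)); lra.
have := KP g (3 * eps) (holo_sub dOm gU) gM; rewrite gTay -/q.
rewrite /eps => h.
have : K * (3 * (q / (3 * (K + 1)))) < q.
  rewrite (_ : K * _ = q * (K / (K + 1))); last by field; rewrite lt0r_neq0// ltr_wpDl.
  by rewrite gtr_pMr// ltr_pdivrMr ?ltr_wpDl// mul1r ltrDl.
by rewrite ltNge h.
Qed.

(** Condition (4) provides a second expansion of the same kernel. Since all coordinates of w are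
    nonzero, the n-th Taylor coefficient of [kerf w] is nonzero exactly when n is in the index set,
    for either expansion. *)
Lemma cond5_unique L L' alpha : cond4 Om H ip L -> cond5 Om kappa L' alpha -> L = L'.
Proof.
move=> c4 c5; have c5' := cond4_imp_cond5 c4.
have [r r0 rO] := Om_opn O0.
have d0 : 0 < r / 2 by rewrite divr_gt0.
have dO : pdisc 0 (2 * (r / 2)) `<=` Om by rewrite mulrC divfK.
have t1 n := cond5_taylor n c5 d0 dO; have t2 n := cond5_taylor n c5' d0 dO.
rewrite /= in t1 t2.
have nz n (a : R) : 0 < a ->
    (real_complex R a : C) * conjc (monom (\row_j (r / 2)%:C%C : pt) n) != 0.
  move=> a0; rewrite -cmod_gt0 cmodM cmod_conjc cmod_real mulr_gt0 ?normr_gt0 ?lt0r_neq0//.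
  rewrite /monom cmod_prod prodr_gt0// => j _.
  by rewrite cmodX mxE cmod_real exprn_gt0// normr_gt0 lt0r_neq0.
case: c5 c5' => [_ a0 _] [_ a0' _].
apply/seteqP; split => n Ln; apply: contrapT => nL; have := t1 n; rewrite t2.
  case: asboolP => // _; case: asboolP => // _ /eqP.
  by rewrite (negbTE (nz n _ (a0' n Ln))).
case: asboolP => // _; case: asboolP => // _ /esym/eqP.
by rewrite (negbTE (nz n _ (a0 n Ln))).
Qed.

End Setting.

(** The scheme is (1) <=> (2), (2) => (4) => (5) => (1) and (3) <=> (4). For the index sets, (3)
    gives (4) with the same set, and (4) determines it. *)
Theorem theorem2p11 (R : realType) (m : nat) (Om : set (pt R m))
  (H : set (fn R m)) (ip : fn R m -> fn R m -> CC R)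
  (kappa : pt R m -> pt R m -> CC R) :
  reinhardt_domain Om -> Om 0 ->
  hilbert_fun_space Om H ip ->
  reproducing_kernel Om H ip kappa ->
  coord_invariant H ->
  hol_cont_incl Om H ip ->
  [/\ cond1 Om kappa <-> cond2 H ip,
      cond2 H ip <-> (exists beta L, cond3 H ip beta L),
      (exists beta L, cond3 H ip beta L) <-> (exists L', cond4 Om H ip L'),
      (exists L', cond4 Om H ip L') <->
        (exists L'' alpha, cond5 Om kappa L'' alpha) &
      forall beta L L' L'' alpha,
        cond3 H ip beta L -> cond4 Om H ip L' -> cond5 Om kappa L'' alpha ->
        L = L' /\ L' = L''].
Proof.
move=> hR O0 HH rk ci hc.
have c12 : cond1 Om kappa -> cond2 H ip := cond1_imp_cond2 hR HH rk.
have c21 : cond2 H ip -> cond1 Om kappa := cond2_imp_cond1 hR HH rk.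
have c24 : cond2 H ip -> exists L, cond4 Om H ip L.
  by move=> c2; eexists; exact: (cond2_imp_cond4 hR O0 HH ci hc c2).
have c45 : (exists L, cond4 Om H ip L) -> exists L alpha, cond5 Om kappa L alpha.
  by move=> [L c4]; exists L; eexists; exact: (cond4_imp_cond5 hR O0 HH rk c4).
have c51 : (exists L alpha, cond5 Om kappa L alpha) -> cond1 Om kappa.
  by move=> [L [alpha c5]]; exact: (cond5_imp_cond1 hR c5).
have c43 : (exists L, cond4 Om H ip L) -> exists beta L, cond3 H ip beta L.
  by move=> [L c4]; eexists; exists L; exact: (cond4_imp_cond3 hR O0 HH hc c4).
have c34 : (exists beta L, cond3 H ip beta L) -> exists L, cond4 Om H ip L.
  by move=> [beta [L c3]]; exists L; exact: (cond3_imp_cond4 hR O0 HH hc c3).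
split.
- by split.
- by split => [/c24/c43//|/c34/c45/c51/c12].
- by split.
- by split => // /c51/c12/c24.
move=> beta L L' L'' alpha /(cond3_imp_cond4 hR O0 HH hc) c4 c4' c5; split.
  have u := cond4_unique hR O0 HH hc; apply/seteqP; split=> n.
    by move=> /(u _ n c4)/(u _ n c4').
  by move=> /(u _ n c4')/(u _ n c4).
exact: (cond5_unique hR O0 HH rk hc c4' c5).
Qed.
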